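(* Let $\hat v=\min_{x\in\mathcal X}\sup_{\mathbb Q\in\mathcal P_\epsilon}\mathbb E_{\mathbb Q}[\ell(x,\xi)]$ with set of minimizers $\mathcal S$, and let $\hat v_M=\min_{x\in\mathcal X}\sup_{\mathbb Q\in\mathcal P_\epsilon^M}\mathbb E_{\mathbb Q}[\ell(x,\xi)]$ with minimizer $\hat x_M$. As $M\to\infty$, $$\hat v_M\xrightarrow{p}\hat v\qquad\text{and}\qquad\mathrm{dist}(\hat x_M,\mathcal S)\xrightarrow{p}0.$$ Furthermore, let $\epsilon>0$ and assume there exists an optimal dual measure $\nu$, i.e. the $\nu$-component of an optimal solution of $$\begin{aligned}\min\ &\alpha+\beta\Omega+\int_{\mathcal X}\big(\mathbb E_{\hat{\mathbb P}_N}[\ell(z,\xi)]+\epsilon\big)\nu(\mathrm dz)\\ \text{s.t. }&x\in\mathcal X,\ \alpha\in\mathbb R,\ \beta\in\mathbb R_+,\ \nu\in\mathcal M_+(\mathcal X),\quad \ell(x,\xi)\le\alpha+\beta\|\xi\|^2+\int_{\mathcal X}\ell(z,\xi)\nu(\mathrm dz)\ \ \forall\xi\in\Xi,\end{aligned}$$ such that $\gamma\mathbb Z-\nu\in\mathcal M_+(\mathcal X)$ for some $\gamma\in\mathbb R_+$. Let $\gamma^\star=\inf\{\gamma\in\mathbb R_+:\gamma\mathbb Z-\nu\in\mathcal M_+(\mathcal X)\}$. Then there is an absolute constant $C>0$ such that for all $J,M\ge2$ and $\tau\in(0,1)$, with probability at least $1-\tau$, $$\sup_{\mathbb Q\in\mathcal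 P_\epsilon}\mathbb E_{\mathbb Q}[\ell(\hat x_M,\xi)]\le\min_{x\in\mathcal X}\sup_{\mathbb Q\in\mathcal P_\epsilon}\mathbb E_{\mathbb Q}[\ell(x,\xi)]+\gamma^\star\left(C\,R\sqrt{\frac{J\log J(\log M)^3}{M}}+2(c_1+c_2\sqrt\Omega)\sqrt{\frac1{2M}\log\frac1\tau}\right).$$
   Context: $\mathcal X\subseteq\mathbb R^{D_x}$ is compact and convex with $\sup_{x\in\mathcal X}\|x\|\le R_x$, and $\Xi\subseteq\mathbb R^{D_\xi}$ is compact with $\sup_{\xi\in\Xi}\|\xi\|\le R_\xi$; $\mathscr P(\Xi)$ is the set of probability distributions on $\Xi$ and $\mathcal M_+(\mathcal X)$ the cone of finite nonnegative Borel measures on $\mathcal X$. The loss is $\ell(x,\xi)=\max_{j\in[J]}\big(a_j(x)^\top\xi+b_j(x)\big)$ with $a_j(x)=\mathbf A_jx+\bar{\mathbf a}_j$, $b_j(x)=\mathbf b_j^\top x+\bar b_j$; $c_1,c_2\ge0$ satisfy $|\ell(x,\xi)|\le c_1+c_2\|\xi\|$ on $\mathcal X\times\Xi$; $$R=\max_{j\in[J]}\left\|\begin{bmatrix}\mathbf A_j^\top&\mathbf b_j\\ \bar{\mathbf a}_j^\top&\bar b_j\end{bmatrix}\right\|_{\mathrm{op}}\sqrt{R_\xi^2+1}\,\sqrt{R_x^2+1}.$$ $\mathbb P^\star$ is the true distribution and $\hat{\mathbb P}_N\in\mathscr P(\Xi)$ a fixed reference distribution; $\Omega$ satisfies $\mathbb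 E_{\hat{\mathbb P}_N}[\|\xi\|^2]<\Omega$ and $\mathbb E_{\mathbb P^\star}[\|\xi\|^2]\le\Omega$; $\epsilon\ge0$. $\mathbb Z$ is a probability distribution with full support on $\mathcal X$ and $z_1,z_2,\dots$ are i.i.d. from $\mathbb Z$ (probability refers to these samples). $[u]_+=\max\{u,0\}$. Define $$\mathcal P_\epsilon=\Big\{\mathbb Q\in\mathscr P(\Xi):\mathbb E_{z\sim\mathbb Z}\big[\big[\mathbb E_{\mathbb Q}[\ell(z,\xi)]-\mathbb E_{\hat{\mathbb P}_N}[\ell(z,\xi)]-\epsilon\big]_+\big]\le0,\ \mathbb E_{\mathbb Q}[\|\xi\|^2]\le\Omega\Big\},$$ $$\mathcal P_\epsilon^M=\Big\{\mathbb Q\in\mathscr P(\Xi):\tfrac1M\sum_{m\in[M]}\big[\mathbb E_{\mathbb Q}[\ell(z_m,\xi)]-\mathbb E_{\hat{\mathbb P}_N}[\ell(z_m,\xi)]-\epsilon\big]_+\le0,\ \mathbb E_{\mathbb Q}[\|\xi\|^2]\le\Omega\Big\}.$$ $\mathrm{dist}(x,\mathcal S)$ is the Euclidean distance from $x$ to $\mathcal S$ and $\xrightarrow{p}$ is convergence in probability. *)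

(* Defs.v *)
From HB Require Import structures.
From mathcomp Require Import all_boot all_order all_algebra.
From mathcomp Require Import all_classical all_reals all_analysis.

Set Implicit Arguments.
Unset Strict Implicit.
Unset Printing Implicit Defensive.

Import Order.TTheory GRing.Theory Num.Theory.
Import numFieldNormedType.Exports.

Local Open Scope classical_set_scope.
Local Open Scope ring_scope.

(* The norm carried by 'cV[R]_n in the library is the max norm; it induces the
   same topology as the Euclidean norm below. *)
Definition enorm (R : realType) (n : nat) (v : 'cV[R]_n) : R :=
  Num.sqrt (\sum_(i < n) v i ord0 ^+ 2).

Definition edist_set (R : realType) (n : nat) (x : 'cV[R]_n)
    (S : set 'cV[R]_n) : R :=
  inf [set enorm (x - y) | y in S].

Definition opnorm (R : realType) (m n : nat) (B : 'M[R]_(m, n)) : R :=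
  sup [set enorm (B *m v) | v in [set v : 'cV[R]_n | enorm v <= 1]].

(* R^n with its Borel sigma-algebra *)
Notation Rvec R n := (g_sigma_algebraType (@open 'cV[R]_n)).

Definition distr_on (R : realType) (n : nat) (S : set 'cV[R]_n) :
    set (probability (Rvec R n) R) :=
  [set Q | Q S = 1%E].

Definition measure_on (R : realType) (n : nat) (S : set 'cV[R]_n) :
    set {finite_measure set (Rvec R n) -> \bar R} :=
  [set nu | nu (~` S) = 0%E].

Definition full_support (R : realType) (n : nat) (S : set 'cV[R]_n)
    (Z : probability (Rvec R n) R) : Prop :=
  forall U : set 'cV[R]_n, open U -> U `&` S !=set0 -> (0 < Z U)%E.

(* Below, expect is only applied to functions that are measurable and bounded
   on a set of full Q-measure, so that no value is lost by taking fine. *)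
Definition expect (R : realType) (n : nat) (Q : probability (Rvec R n) R)
    (f : 'cV[R]_n -> R) : R :=
  fine 'E_Q[f].

Definition second_moment (R : realType) (n : nat)
    (Q : probability (Rvec R n) R) : \bar R :=
  'E_Q[fun xi : 'cV[R]_n => enorm xi ^+ 2].

Definition pospart (R : realType) (u : R) : R := Num.max u 0.

Definition max_ord (R : realType) (J : nat) (J_gt0 : (0 < J)%N)
    (f : 'I_J -> R) : R :=
  \big[Num.max/f (Ordinal J_gt0)]_(j < J) f j.

Definition affine_coef (R : realType) (dx dxi : nat) (A : 'M[R]_(dxi, dx))
    (abar : 'cV[R]_dxi) (x : 'cV[R]_dx) : 'cV[R]_dxi :=
  A *m x + abar.

Definition affine_cst (R : realType) (dx : nat) (b : 'cV[R]_dx) (bbar : R)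
    (x : 'cV[R]_dx) : R :=
  (b^T *m x) ord0 ord0 + bbar.

Definition max_affine_loss (R : realType) (dx dxi J : nat) (J_gt0 : (0 < J)%N)
    (A : 'I_J -> 'M[R]_(dxi, dx)) (abar : 'I_J -> 'cV[R]_dxi)
    (b : 'I_J -> 'cV[R]_dx) (bbar : 'I_J -> R)
    (x : 'cV[R]_dx) (xi : 'cV[R]_dxi) : R :=
  max_ord J_gt0 (fun j =>
    ((affine_coef (A j) (abar j) x)^T *m xi) ord0 ord0
    + affine_cst (b j) (bbar j) x).

Record dro (R : realType) := Dro {
  dx : nat;
  dxi : nat;
  Xset : set 'cV[R]_dx;
  Xiset : set 'cV[R]_dxi;
  Rx : R;
  Rxi : R;
  nJ : nat;
  J_gt0 : (0 < nJ)%N;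
  A_ : 'I_nJ -> 'M[R]_(dxi, dx);
  abar_ : 'I_nJ -> 'cV[R]_dxi;
  b_ : 'I_nJ -> 'cV[R]_dx;
  bbar_ : 'I_nJ -> R;
  c1 : R;
  c2 : R;
  Pstar : probability (Rvec R dxi) R;
  Phat : probability (Rvec R dxi) R;
  Omega : R;
  eps : R;
  Zlaw : probability (Rvec R dx) R;
  Xset_compact : compact Xset;
  Xset_convex : convex_set Xset;
  Xset_bounded : forall x, Xset x -> enorm x <= Rx;
  Xiset_compact : compact Xiset;
  Xiset_bounded : forall xi, Xiset xi -> enorm xi <= Rxi;
  c1_ge0 : 0 <= c1;
  c2_ge0 : 0 <= c2;
  loss_growth : forall x xi, Xset x -> Xiset xi ->
    `|max_affine_loss J_gt0 A_ abar_ b_ bbar_ x xi| <= c1 + c2 * enorm xi;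
  Pstar_on_Xi : distr_on Xiset Pstar;
  Phat_on_Xi : distr_on Xiset Phat;
  Phat_moment : (second_moment Phat < Omega%:E)%E;
  Pstar_moment : (second_moment Pstar <= Omega%:E)%E;
  eps_ge0 : 0 <= eps;
  Z_on_X : distr_on Xset Zlaw;
  Z_full_support : full_support Xset Zlaw
}.

Arguments Xset {R} d.
Arguments Xiset {R} d.

Unset Implicit Arguments.

Definition loss {R : realType} (D : dro R) :
    'cV[R]_(dx D) -> 'cV[R]_(dxi D) -> R :=
  max_affine_loss (J_gt0 D) (@A_ R D) (@abar_ R D) (@b_ R D) (@bbar_ R D).

Definition loss_radius {R : realType} (D : dro R) : R :=
  max_ord (J_gt0 D) (fun j =>
    opnorm (block_mx (A_ j)^T (b_ j) (abar_ j)^T (bbar_ j)%:M))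
  * Num.sqrt (Rxi D ^+ 2 + 1) * Num.sqrt (Rx D ^+ 2 + 1).

Definition loss_excess {R : realType} (D : dro R)
    (Q : probability (Rvec R (dxi D)) R) (z : 'cV[R]_(dx D)) : R :=
  pospart (expect Q (loss D z) - expect (Phat D) (loss D z) - eps D).

Definition ambiguity_set {R : realType} (D : dro R) :
    set (probability (Rvec R (dxi D)) R) :=
  [set Q | [/\ distr_on (Xiset D) Q,
               ('E_(Zlaw D)[loss_excess D Q] <= 0)%E &
               (second_moment Q <= (Omega D)%:E)%E]].

Definition sampled_ambiguity_set {R : realType} (D : dro R) (M : nat)
    (z : nat -> 'cV[R]_(dx D)) : set (probability (Rvec R (dxi D)) R) :=
  [set Q | [/\ distr_on (Xiset D) Q,
               M%:R^-1 * \sum_(m < M) loss_excess D Q (z m) <= 0 &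
               (second_moment Q <= (Omega D)%:E)%E]].

(* sup and inf are real-valued: the ambiguity sets above contain Phat, and
   expected losses are bounded uniformly in Q and in x over X. *)
Definition worst_case {R : realType} (D : dro R)
    (P : set (probability (Rvec R (dxi D)) R)) (x : 'cV[R]_(dx D)) : R :=
  sup [set expect Q (loss D x) | Q in P].

Definition dro_value {R : realType} (D : dro R)
    (P : set (probability (Rvec R (dxi D)) R)) : R :=
  inf [set worst_case D P x | x in Xset D].

Definition dro_argmin {R : realType} (D : dro R)
    (P : set (probability (Rvec R (dxi D)) R)) : set 'cV[R]_(dx D) :=
  [set x | Xset D x /\
           forall y, Xset D y -> worst_case D P x <= worst_case D P y].

Definition dual_feasible {R : realType} (D : dro R) (x : 'cV[R]_(dx D))
    (alpha beta : R) (nu : {finite_measure set (Rvec R (dx D)) -> \bar R}) :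
    Prop :=
  [/\ Xset D x, 0 <= beta, measure_on (Xset D) nu &
      forall xi, Xiset D xi ->
        loss D x xi <= alpha + beta * enorm xi ^+ 2
                     + \int[nu]_(z in Xset D) loss D z xi].

Definition dual_objective {R : realType} (D : dro R) (alpha beta : R)
    (nu : {finite_measure set (Rvec R (dx D)) -> \bar R}) : R :=
  alpha + beta * Omega D
  + \int[nu]_(z in Xset D) (expect (Phat D) (loss D z) + eps D).

Definition optimal_dual_measure {R : realType} (D : dro R)
    (nu : {finite_measure set (Rvec R (dx D)) -> \bar R}) : Prop :=
  exists x alpha beta, dual_feasible D x alpha beta nu /\
    forall x' alpha' beta' nu', dual_feasible D x' alpha' beta' nu' ->
      dual_objective D alpha beta nu <= dual_objective D alpha' beta' nu'.

(* gamma in R_+ such that gamma Z - nu is an element of M_+(X) *)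
Definition dominating_factors {R : realType} (D : dro R)
    (nu : {finite_measure set (Rvec R (dx D)) -> \bar R}) : set R :=
  [set gamma | 0 <= gamma /\
    exists2 mu : {finite_measure set (Rvec R (dx D)) -> \bar R},
      measure_on (Xset D) mu &
      forall B : set (Rvec R (dx D)), measurable B ->
        mu B = (gamma%:E * Zlaw D B - nu B)%E].

Set Implicit Arguments.

Definition mutually_independent (d d' : measure_display)
    (T : measurableType d) (T' : measurableType d') (R : realType)
    (P : probability T R) (z : nat -> {mfun T >-> T'}) : Prop :=
  forall (s : seq nat) (B : nat -> set T'), uniq s ->
    (forall i, measurable (B i)) ->
    P (\bigcap_(i in [set` s]) (z i @^-1` B i))
    = (\prod_(i <- s) P (z i @^-1` B i))%E.

Definition iid_samples (d d' : measure_display)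
    (T : measurableType d) (T' : measurableType d') (R : realType)
    (P : probability T R) (Z : probability T' R)
    (z : nat -> {mfun T >-> T'}) : Prop :=
  mutually_independent P z /\
  forall m (B : set T'), measurable B -> distribution P (z m) B = Z B.

(* Minimizers are selected without any measurability requirement, so
   probabilities of the events below are outer (resp. inner) probabilities;
   they agree with P on measurable events. *)
Definition cvg_in_probability (d : measure_display) (T : measurableType d)
    (R : realType) (P : probability T R) (X : nat -> T -> R) (l : R) : Prop :=
  forall e : R, 0 < e ->
    mu_ext P [set w | e <= `|X M w - l|] @[M --> \oo] --> 0%E.

Definition with_probability_ge (d : measure_display) (T : measurableType d)
    (R : realType) (P : probability T R) (p : R) (E : set T) : Prop :=
  exists F : set T, [/\ measurable F, F `<=` E & (p%:E <= P F)%E].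

Definition sampling_error (R : realType) (D : dro R) (C : R) (M : nat)
    (tau : R) : R :=
  C * loss_radius D
    * Num.sqrt ((nJ D)%:R * ln (nJ D)%:R * ln M%:R ^+ 3 / M%:R)
  + 2 * (c1 D + c2 D * Num.sqrt (Omega D))
    * Num.sqrt ((2 * M%:R)^-1 * ln (tau^-1)).

(* Main.v *)
(* Everything is Lipschitz, so X and Xi may be cut into finitely many small
   cells and the samples replaced by their cells; probabilities then live on a
   finite product space.

   Since Z has full support, P_eps consists of the laws Q satisfying the moment
   bound and E_Q l(z) <= E_Phat l(z) + eps for all z in X, while P_eps^M imposes
   this at the sample points only.  Samples become dense in X with probability
   tending to 1, and weak compactness of the laws on Xi (obtained from a Loeb
   measure pushed forward by the standard part map) shows that constraints on a
   dense set determine the worst case in the limit; this gives consistency.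

   For the rate, let (x, alpha, beta, nu) be optimal for the dual, with
   nu <= gamma Z.  Integrating the dual constraint against Q in P_eps^M yields
   E_Q l(x) <= dual value + gamma E_Z[excess_Q], and excess_Q vanishes at the
   samples, so E_Z[excess_Q] is at most a uniform deviation.  McDiarmid's
   inequality controls it around its mean, and symmetrization, contraction of
   the positive part, passage from Q to Dirac masses, and vector contraction of
   the maximum of J functions that are linear in the same (xi, 1) bound the mean
   by 4 R sqrt (J / M).  The dual value is at most the primal one because
   eps > 0 makes Phat a Slater point. *)

Require Import Defs.
From HB Require Import structures.
From mathcomp Require Import all_boot all_order all_algebra.
From mathcomp Require Import all_classical all_reals all_analysis.
From mathcomp Require Import measurable_realfun ring lra.

Set Implicit Arguments.
Unset Strict Implicit.
Unset Printing Implicit Defensive.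

Import Order.TTheory GRing.Theory Num.Theory.
Import numFieldNormedType.Exports.

Local Open Scope classical_set_scope.
Local Open Scope ring_scope.

(** * Hoeffding's and McDiarmid's inequalities on finite spaces *)

Section hoeffding.
Context {R : realType}.

(** The sampled ambiguity set is random, so the deviation is controlled uniformly over a fixed
    larger class: all laws on Xi with the moment bound, written [constr D set0]. Membership in the
    sampled set then only serves to make the empirical term vanish. The radius R appears because, in
    homogeneous coordinates (x, 1) and (xi, 1), each affine piece of the loss is the bilinear form
    of its block matrix, so Cauchy-Schwarz yields the operator norm times the two square roots. For
    duality, multipliers are produced only for finitely many constraints, at cell centres, and only
    up to an error e. This is enough: the given nu is optimal, hence at least as good as every such
    discrete candidate, and e is arbitrary, so no limit of discrete dual solutions is taken. For
    consistency, stability under dense sampling is needed at one fixed minimizer only, never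
    uniformly in x, since the reverse comparison of values is mere inclusion of constraint sets. *)

Lemma le0_of_derive (f f' : R -> R) :
  (forall x : R, is_derive x 1 f (f' x)) -> (forall x : R,
    0 <= x -> 0 <= f' x) ->
  forall x : R, 0 <= x -> f 0 <= f x.
Proof.
move=> df f'0 x x0.
apply: (@ger0_derive1_ndecry R f 0) => //.
- move=> y; rewrite in_itv/= andbT => /ltW y0.
  by rewrite derive1E; have [_ ->] := df y; exact: f'0.
- apply: derivable_within_continuous => y _.
  by [].
Qed.

(** The logarithm of the left side is the cumulant generating function of a Bernoulli variable. Its
    second derivative is the variance of a tilted Bernoulli variable, hence at most 1/4; integrating
    twice from 0 gives the bound. *)
Lemma bernoulli_subgaussian (q h : R) : 0 <= q <= 1 -> 0 <= h ->
  1 - q + q * expR h <= expR (q * h + h ^+ 2 / 8).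
Proof.
move=> /andP[q0 q1] h0.
pose w (x : R) : R := 1 - q + q * expR x.
have w_gt0 (x : R) : 0 < w x.
  rewrite /w; have := expR_gt0 x => e0.
  have [->|qn0] := eqVneq q 0; first by rewrite mul0r subr0 addr0.
  by rewrite ltr_wpDl ?subr_ge0// mulr_gt0// lt_neqAle eq_sym qn0.
have dw (x : R) : is_derive x 1 w (q * expR x).
  rewrite /w; apply: is_derive_eq.
  by rewrite /GRing.scale/=; ring.
(* The derivative of [D] below, with q e^x / w written as 1 - (1 - q) / w so that the exponential
   enters only through [w]. Nonnegativity of its own derivative is the inequality 4ab <= (a +
   b)^2. *)
pose D1 (x : R) : R := x / 4 + q - 1 + (1 - q) / w x.
have dD1 (x : R) : is_derive x 1 D1 (4^-1 - (1 - q) * (q * expR x) / w x ^+ 2).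
  rewrite /D1.
  have dv : is_derive x 1 (fun y => (w y)^-1) (- (w x) ^- 2 *: (q * expR x)).
    by apply: is_deriveV; rewrite gt_eqF.
  apply: is_derive_eq.
  rewrite /GRing.scale /=.
  by field; rewrite gt_eqF.
have D1_ge0 (x : R) : 0 <= x -> 0 <= D1 x.
  move=> x0; suff : D1 0 <= D1 x.
    have -> // : D1 0 = 0.
    by rewrite /D1 /w expR0 mulr1 subrK divr1 mul0r; ring.
  apply: (le0_of_derive dD1) => // y _.
  rewrite subr_ge0 ler_pdivrMr ?exprn_gt0//.
  rewrite /w; have := sqr_ge0 ((1 - q) - q * expR y); lra.
pose D (x : R) : R := x ^+ 2 / 8 + q * x - ln (w x).
have dD (x : R) : is_derive x 1 D (D1 x).
  rewrite /D.
  have dln : is_derive x 1 (fun y => ln (w y)) ((w x)^-1 * (q * expR x)).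
    have dl := @is_derive1_ln R (w x) (w_gt0 x).
    exact: (@is_derive1_comp _ (@ln R) w x _ _ dl (dw x)).
  apply: is_derive_eq.
  rewrite /D1 /GRing.scale /=.
  by rewrite /w; field; rewrite gt_eqF//; exact: w_gt0.
have := le0_of_derive dD D1_ge0 h0.
rewrite {1}/D /w expR0 mulr1 subrK ln1 expr0n/= !(mul0r,mulr0) addr0 subr0.
rewrite /D subr_ge0 => H.
rewrite -[leLHS]lnK ?posrE; last exact: w_gt0.
by rewrite ler_expR (le_trans H)// addrC.
Qed.

Lemma expR_chord (h x : R) : 0 <= x <= 1 -> expR (h * x) <= 1 - x + x * expR h.
Proof.
move=> /andP[x0 x1].
have := @convex_expR R (Itv01 x0 x1) h 0.
rewrite !convRE/= expR0 mulr0 addr0 mulr1 /unstable.onem => H.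
by rewrite mulrC (le_trans H)// addrC.
Qed.

End hoeffding.

Section iid_average.
Context {R : realType} (K : finType) (p : K -> R).
Hypothesis p_ge0 : forall k, 0 <= p k.
Hypothesis p_sum1 : \sum_k p k = 1.

Definition avg (f : K -> R) : R := \sum_k p k * f k.

Lemma avg_cst (a : R) : avg (fun=> a) = a.
Proof. by rewrite /avg -mulr_suml p_sum1 mul1r. Qed.

Lemma avg_le (f g : K -> R) : (forall k, f k <= g k) -> avg f <= avg g.
Proof. by move=> fg; apply: ler_sum => k _; exact: ler_wpM2l. Qed.

Lemma avgD (f g : K -> R) : avg (fun k => f k + g k) = avg f + avg g.
Proof. by rewrite /avg -big_split; apply: eq_bigr => k _; rewrite mulrDr. Qed.

Lemma avgZ (a : R) (f : K -> R) : avg (fun k => a * f k) = a * avg f.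
Proof. by rewrite /avg mulr_sumr; apply: eq_bigr => k _; rewrite mulrCA. Qed.

Lemma avg_inhabited : exists k : K, True.
Proof.
apply: contrapT => K0; have := p_sum1.
rewrite big1 => [/eqP|k _]; first by rewrite eq_sym oner_eq0.
by exfalso; apply: K0; exists k.
Qed.

(** Expectation over n independent draws, one coordinate at a time. Integrands take sequences, so no
    product space is built and inductions on n isolate the first draw. *)
Fixpoint iid_avg (n : nat) (F : seq K -> R) : R :=
  if n is n'.+1 then avg (fun k => iid_avg n' (fun s => F (k :: s)))
  else F [::].

Lemma iid_avg_le n (F G : seq K -> R) :
  (forall s, size s = n -> F s <= G s) -> iid_avg n F <= iid_avg n G.
Proof.
elim: n F G => [|n IH] F G FG /=; first exact: FG.
by apply: avg_le => k; apply: IH => s sn; apply: FG; rewrite /= sn.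
Qed.

Lemma eq_iid_avg n (F G : seq K -> R) :
  (forall s, size s = n -> F s = G s) -> iid_avg n F = iid_avg n G.
Proof.
by move=> FG; apply: le_anti; rewrite !iid_avg_le// => s /FG ->.
Qed.

Lemma iid_avg_cst n (a : R) : iid_avg n (fun=> a) = a.
Proof. by elim: n => [//|n IH] /=; rewrite IH avg_cst. Qed.

Lemma iid_avgD n (F G : seq K -> R) :
  iid_avg n (fun s => F s + G s) = iid_avg n F + iid_avg n G.
Proof.
elim: n F G => [//|n IH] F G /=; rewrite -avgD.
by apply: eq_bigr => k _; rewrite IH.
Qed.

Lemma iid_avgZ n (a : R) (F : seq K -> R) :
  iid_avg n (fun s => a * F s) = a * iid_avg n F.
Proof.
elim: n F => [//|n IH] F /=; rewrite -avgZ.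
by apply: eq_bigr => k _; rewrite IH.
Qed.

Lemma iid_avg_avg n (F : K -> seq K -> R) :
  iid_avg n (fun s => avg (F ^~ s)) = avg (fun k => iid_avg n (F k)).
Proof.
elim: n F => [//|n IH] F /=.
transitivity (avg (fun k => avg (fun j => iid_avg n (fun s => F j (k :: s))))).
  by apply: eq_bigr => k _; rewrite IH.
rewrite /avg; under eq_bigr do rewrite mulr_sumr.
rewrite exchange_big; apply: eq_bigr => k _; rewrite mulr_sumr.
by apply: eq_bigr => j _; rewrite mulrCA.
Qed.

(** After rescaling to [0, 1], convexity of the exponential bounds the moment generating function by
    that of a Bernoulli variable with the same mean. *)
Lemma hoeffding_lemma (G : K -> R) (c lam : R) : 0 <= lam -> 0 < c ->
  (forall k k', G k <= G k' + c) ->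
  avg (fun k => expR (lam * G k))
    <= expR (lam * avg G + lam ^+ 2 * c ^+ 2 / 8).
Proof.
move=> lam0 c0 Gc; have [k0 _] := avg_inhabited.
pose a := G [arg min_(k < k0) G k]%O.
have Ga k : a <= G k by rewrite /a; case: arg_minP => // i _; apply.
pose X k := (G k - a) / c.
have X01 k : 0 <= X k <= 1.
  rewrite /X divr_ge0 ?subr_ge0 ?(ltW c0)//= ler_pdivrMr// mul1r lerBlDl.
  exact: Gc.
have GX k : G k = a + c * X k.
  by rewrite /X mulrC divfK ?gt_eqF// addrC subrK.
have avgX : 0 <= avg X <= 1.
  apply/andP; split.
    by rewrite -(avg_cst 0) avg_le// => k; case/andP: (X01 k).
  by rewrite -(avg_cst 1) avg_le// => k; case/andP: (X01 k).
have -> : avg G = a + c * avg X.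
  rewrite -avgZ -[X in _ = X + _](avg_cst a) -avgD.
  by apply: eq_bigr => k _; rewrite GX.
apply: (@le_trans _ _ (avg (fun k => expR (lam * a) *
    (1 + (expR (lam * c) - 1) * X k)))).
  apply: avg_le => k; rewrite GX mulrDr expRD ler_pM2l ?expR_gt0// mulrA.
  by apply: (le_trans (expR_chord (lam * c) (X01 k))); lra.
rewrite avgZ avgD avg_cst avgZ (mulrDr lam) -(addrA (lam * a)) expRD ler_pM2l
  ?expR_gt0//.
have lc0 : 0 <= lam * c by rewrite mulr_ge0// ltW.
have := bernoulli_subgaussian avgX lc0.
rewrite (_ : avg X * (lam * c) = lam * (c * avg X)); last by ring.
by rewrite exprMn; apply: le_trans; lra.
Qed.

(** The martingale argument as an induction: the hypothesis handles the later draws with the first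
    one fixed, and the resulting conditional mean, as a function of the first draw, oscillates by at
    most c. *)
Lemma mgf_bounded_differences n (F : seq K -> R) (c lam : R) :
  0 <= lam -> 0 < c ->
  (forall s1 s2 k k', (size s1 + size s2).+1 = n ->
     F (s1 ++ k :: s2) <= F (s1 ++ k' :: s2) + c) ->
  iid_avg n (fun s => expR (lam * F s))
    <= expR (lam * iid_avg n F + n%:R * (lam ^+ 2 * c ^+ 2 / 8)).
Proof.
move=> lam0 c0; elim: n F => [|n IH] F Fc /=.
  by rewrite mul0r addr0.
apply: (@le_trans _ _ (avg (fun k =>
   expR (lam * iid_avg n (fun s => F (k :: s)))
   * expR (n%:R * (lam ^+ 2 * c ^+ 2 / 8))))).
  apply: avg_le => k; rewrite -expRD; apply: IH => s1 s2 k1 k2 sn.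
  by apply: (Fc (k :: s1)); rewrite /= addSn sn.
set E := expR (n%:R * _).
have -> : avg (fun k => expR (lam * iid_avg n (fun s => F (k :: s))) * E)
   = E * avg (fun k => expR (lam * iid_avg n (fun s => F (k :: s)))).
  by rewrite -avgZ; apply: eq_bigr => k _; rewrite [in RHS](mulrC E).
rewrite -nat1r mulrDl mul1r addrA expRD [leRHS]mulrC ler_pM2l ?expR_gt0//.
apply: hoeffding_lemma => // k k'.
rewrite -(iid_avg_cst n c) -iid_avgD; apply: iid_avg_le => s sn.
by apply: (Fc [::]); rewrite /= add0n sn.
Qed.

Lemma mcdiarmid n (F : seq K -> R) (c tau : R) :
  (0 < n)%N -> 0 < c -> 0 < tau < 1 ->
  (forall s1 s2 k k', (size s1 + size s2).+1 = n ->
     F (s1 ++ k :: s2) <= F (s1 ++ k' :: s2) + c) ->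
  iid_avg n (fun s =>
    (iid_avg n F + c * Num.sqrt (n%:R * ln tau^-1 / 2) <= F s)%R%:R) <= tau.
Proof.
move=> n0 c0 /andP[t0 t1] Fc.
set u := c * _; set m := iid_avg n F.
have n0' : (0 : R) < n%:R by rewrite ltr0n.
have L0 : 0 < ln tau^-1 by rewrite ln_gt0// invf_gt1.
have u0 : 0 <= u by rewrite mulr_ge0 ?(ltW c0)// sqrtr_ge0.
have u2 : u ^+ 2 = c ^+ 2 * (n%:R * ln tau^-1 / 2).
  by rewrite exprMn sqr_sqrtr// divr_ge0// mulr_ge0// ltW.
(* Minimizer of the Chernoff exponent -lam u + n lam^2 c^2 / 8. The minimum is -2 u^2 / (n c^2), and
   [u] was chosen so that this equals ln tau. *)
pose lam := 4 * u / (n%:R * c ^+ 2).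
have lam0 : 0 <= lam by rewrite divr_ge0 ?mulr_ge0 ?exprn_ge0// ltW.
apply: (@le_trans _ _ (iid_avg n (fun s =>
   expR (- (lam * (m + u))) * expR (lam * F s)))).
  apply: iid_avg_le => s _; rewrite -expRD.
  case: (lerP (m + u) (F s)) => [H|_] /=; last exact: expR_ge0.
  by rewrite -expR0 ler_expR addrC subr_ge0 ler_wpM2l.
rewrite iid_avgZ.
apply: (@le_trans _ _ (expR (- (lam * (m + u))) *
  expR (lam * m + n%:R * (lam ^+ 2 * c ^+ 2 / 8)))).
  by rewrite ler_pM2l ?expR_gt0//; exact: mgf_bounded_differences.
rewrite -expRD.
have -> : - (lam * (m + u)) + (lam * m + n%:R * (lam ^+ 2 * c ^+ 2 / 8))
  = - (2 * u ^+ 2 / (n%:R * c ^+ 2)).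
  by rewrite /lam; field; rewrite !gt_eqF.
have -> : 2 * u ^+ 2 / (n%:R * c ^+ 2) = ln tau^-1.
  by rewrite u2; field; rewrite !gt_eqF.
by rewrite expRN lnK ?posrE ?invr_gt0// invrK.
Qed.

End iid_average.

(** * Euclidean geometry *)

Section euclid.
Context {R : realType}.

Definition dotv n (u v : 'cV[R]_n) : R := (u^T *m v) ord0 ord0.

Lemma dotvE n (u v : 'cV[R]_n) : dotv u v = \sum_i u i ord0 * v i ord0.
Proof. by rewrite /dotv mxE; apply: eq_bigr => i _; rewrite mxE. Qed.

Lemma dotvC n (u v : 'cV[R]_n) : dotv u v = dotv v u.
Proof. by rewrite !dotvE; apply: eq_bigr => i _; rewrite mulrC. Qed.

Lemma dotvDl n (u v w : 'cV[R]_n) : dotv (u + v) w = dotv u w + dotv v w.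
Proof. by rewrite /dotv linearD/= mulmxDl mxE. Qed.

Lemma dotvZl n (a : R) (u w : 'cV[R]_n) : dotv (a *: u) w = a * dotv u w.
Proof. by rewrite /dotv linearZ/= -scalemxAl mxE. Qed.

Lemma dotv0l n (w : 'cV[R]_n) : dotv 0 w = 0.
Proof. by rewrite /dotv trmx0 mul0mx mxE. Qed.

Lemma dotvDr n (u v w : 'cV[R]_n) : dotv w (u + v) = dotv w u + dotv w v.
Proof. by rewrite !(dotvC w) dotvDl. Qed.

Lemma dotvZr n (a : R) (u w : 'cV[R]_n) : dotv w (a *: u) = a * dotv w u.
Proof. by rewrite !(dotvC w) dotvZl. Qed.

Lemma dotvNl n (u w : 'cV[R]_n) : dotv (- u) w = - dotv u w.
Proof. by rewrite -scaleN1r dotvZl mulN1r. Qed.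

Lemma dotvNr n (u w : 'cV[R]_n) : dotv w (- u) = - dotv w u.
Proof. by rewrite !(dotvC w) dotvNl. Qed.

Lemma dotv_mulmx n m (B : 'M[R]_(n, m)) u v :
  dotv (B^T *m u) v = dotv u (B *m v).
Proof. by rewrite /dotv trmx_mul trmxK mulmxA. Qed.

Lemma enorm_sq n (v : 'cV[R]_n) : enorm v ^+ 2 = dotv v v.
Proof.
rewrite /enorm sqr_sqrtr; last by apply: sumr_ge0 => i _; exact: sqr_ge0.
by rewrite dotvE.
Qed.

Lemma enorm_ge0 n (v : 'cV[R]_n) : 0 <= enorm v.
Proof. exact: sqrtr_ge0. Qed.

Lemma enorm_eq0 n (v : 'cV[R]_n) : enorm v = 0 -> v = 0.
Proof.
move=> v0; apply/matrixP => i j; rewrite ord1 mxE; apply/eqP.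
rewrite -[_ == 0](@sqrf_eq0 R) eq_le sqr_ge0 andbT.
have <- : \sum_i v i ord0 ^+ 2 = 0.
  have := enorm_sq v; rewrite v0 expr0n/= dotvE => /esym dv; rewrite -[RHS]dv.
  by apply: eq_bigr => k _; rewrite expr2.
by rewrite (bigD1 i)//= lerDl sumr_ge0// => k _; exact: sqr_ge0.
Qed.

Lemma dotv_sqD n (u v : 'cV[R]_n) :
  enorm (u + v) ^+ 2 = enorm u ^+ 2 + 2 * dotv u v + enorm v ^+ 2.
Proof. by rewrite !enorm_sq dotvDl !dotvDr (dotvC v u); ring. Qed.

Lemma enormN n (v : 'cV[R]_n) : enorm (- v) = enorm v.
Proof. by congr Num.sqrt; apply: eq_bigr => i _; rewrite mxE sqrrN. Qed.

Lemma enormZ n (a : R) (v : 'cV[R]_n) : enorm (a *: v) = `|a| * enorm v.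
Proof.
apply/eqP; rewrite -(@eqrXn2 _ 2)//; last 2 first.
- exact: enorm_ge0.
- by rewrite mulr_ge0// enorm_ge0.
by rewrite exprMn real_normK ?num_real// !enorm_sq dotvZl dotvZr mulrA expr2.
Qed.

Lemma enorm0 n : enorm (0 : 'cV[R]_n) = 0.
Proof. by rewrite -(scale0r 0) enormZ normr0 mul0r. Qed.

Lemma cauchy_schwarz n (u v : 'cV[R]_n) : dotv u v <= enorm u * enorm v.
Proof.
have [u0|un0] := eqVneq (enorm u) 0.
  by rewrite (enorm_eq0 u0) enorm0 mul0r -(scale0r 0) dotvZl mul0r.
have [v0|vn0] := eqVneq (enorm v) 0.
  by rewrite (enorm_eq0 v0) enorm0 mulr0 -(scale0r 0) dotvZr mul0r.
have ab : 0 < enorm u * enorm v.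
  by rewrite mulr_gt0// lt_neqAle eq_sym ?un0 ?vn0 enorm_ge0.
have := sqr_ge0 (enorm (enorm v *: u + (- enorm u) *: v)).
rewrite dotv_sqD !enormZ dotvZl dotvZr normrN !(ger0_norm (enorm_ge0 _)).
move=> H; rewrite -(ler_pM2l ab).
have -> : enorm u * enorm v * (enorm u * enorm v)
  = (enorm v * enorm u) ^+ 2 by ring.
rewrite (mulrC (enorm u) (enorm v)) in H *.
lra.
Qed.

Lemma cauchy_schwarz_norm n (u v : 'cV[R]_n) : `|dotv u v| <= enorm u * enorm v.
Proof.
rewrite ler_norml cauchy_schwarz andbT lerNl -dotvNl -(enormN u).
exact: cauchy_schwarz.
Qed.

Lemma enormD n (u v : 'cV[R]_n) : enorm (u + v) <= enorm u + enorm v.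
Proof.
rewrite -(@ler_pXn2r _ 2)// ?nnegrE ?addr_ge0 ?enorm_ge0//.
by rewrite dotv_sqD sqrrD -mulr_natl; have := cauchy_schwarz u v; lra.
Qed.

Lemma enormB n (u v : 'cV[R]_n) : enorm (u - v) = enorm (v - u).
Proof. by rewrite -enormN opprB. Qed.

Lemma enorm_dist n (u v : 'cV[R]_n) : `|enorm u - enorm v| <= enorm (u - v).
Proof.
rewrite ler_norml; apply/andP; split.
  rewrite lerNl opprB lerBlDr.
  by have := enormD (v - u) u; rewrite subrK enormB.
by rewrite lerBlDr; have := enormD (u - v) v; rewrite subrK.
Qed.

Lemma enorm_parallelogram n (u v : 'cV[R]_n) :
  enorm (u + v) ^+ 2 + enorm (u - v) ^+ 2 = 2 * (enorm u ^+ 2 + enorm v ^+ 2).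
Proof. by rewrite !dotv_sqD dotvNr enormN; ring. Qed.

Lemma enorm_le_norm1 n (v : 'cV[R]_n) : enorm v <= \sum_i `|v i ord0|.
Proof.
have S0 : 0 <= \sum_i `|v i ord0| by apply: sumr_ge0.
rewrite -(@ler_pXn2r _ 2)// ?nnegrE ?enorm_ge0//.
rewrite enorm_sq dotvE [leRHS]expr2 mulr_suml.
apply: ler_sum => i _; rewrite (le_trans (ler_norm _))// normrM.
by rewrite ler_wpM2l// (bigD1 i)//= lerDl sumr_ge0.
Qed.

Lemma norm_coord n (v : 'cV[R]_n) i : `|v i ord0| <= `|v|.
Proof.
rewrite [leRHS]/Num.norm/= mx_normrE.
exact: (le_bigmax _ (fun ij : 'I_n * 'I_1 => `|v ij.1 ij.2|) (i, ord0)).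
Qed.

Lemma enorm_le_norm n (v : 'cV[R]_n) : enorm v <= n%:R * `|v|.
Proof.
apply: (le_trans (enorm_le_norm1 v)).
apply: (@le_trans _ _ (\sum_(i < n) `|v|)).
  by apply: ler_sum => i _; exact: norm_coord.
by rewrite sumr_const card_ord mulr_natl.
Qed.

Lemma mulmx_enorm_bound n m (B : 'M[R]_(n, m)) :
  exists b, forall v, enorm (B *m v) <= b * enorm v.
Proof.
exists (\sum_i enorm (row i B)^T) => v.
apply: (le_trans (enorm_le_norm1 _)); rewrite mulr_suml.
apply: ler_sum => i _.
have -> : (B *m v) i ord0 = dotv (row i B)^T v.
  by rewrite /dotv trmxK -row_mul [RHS]mxE.
exact: cauchy_schwarz_norm.
Qed.

Lemma opnorm_has_sup n m (B : 'M[R]_(n, m)) :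
  has_sup [set enorm (B *m v) | v in [set v : 'cV[R]_m | enorm v <= 1]].
Proof.
split; first by exists (enorm (B *m 0)); exists 0 => //=; rewrite enorm0.
have [b Bb] := mulmx_enorm_bound B; exists `|b| => _ [v /= v1 <-].
apply: (le_trans (Bb v)); rewrite (le_trans (ler_norm _))// normrM.
by rewrite ler_piMr// (ger0_norm (enorm_ge0 _)).
Qed.

Lemma opnorm_ge0 n m (B : 'M[R]_(n, m)) : 0 <= opnorm B.
Proof.
have [_ ub] := opnorm_has_sup B.
rewrite -(enorm0 n) -(mulmx0 _ B); apply: ub_le_sup => //.
by exists 0 => //=; rewrite enorm0.
Qed.

Lemma opnormP n m (B : 'M[R]_(n, m)) v : enorm (B *m v) <= opnorm B * enorm v.
Proof.
have [v0|vn0] := eqVneq (enorm v) 0.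
  by rewrite v0 mulr0 (enorm_eq0 v0) mulmx0 enorm0.
have v0 : 0 < enorm v by rewrite lt_neqAle eq_sym vn0 enorm_ge0.
rewrite -ler_pdivrMr//.
have -> : enorm (B *m v) / enorm v = enorm (B *m ((enorm v)^-1 *: v)).
  by rewrite -scalemxAr enormZ ger0_norm ?invr_ge0 ?enorm_ge0// mulrC.
have [_ ub] := opnorm_has_sup B.
apply: ub_le_sup => //; exists ((enorm v)^-1 *: v) => //=.
by rewrite enormZ ger0_norm ?invr_ge0 ?enorm_ge0// mulVf.
Qed.

(** |B^T v|^2 = <v, B B^T v> is at most |v| times the norm of B times |B^T v|, and one factor
    cancels. Needed because the samples enter through the transposed blocks. *)
Lemma opnorm_trP n m (B : 'M[R]_(n, m)) v :
  enorm (B^T *m v) <= opnorm B * enorm v.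
Proof.
have [w0|wn0] := eqVneq (enorm (B^T *m v)) 0.
  by rewrite w0 mulr_ge0 ?opnorm_ge0 ?enorm_ge0.
have w0 : 0 < enorm (B^T *m v) by rewrite lt_neqAle eq_sym wn0 enorm_ge0.
rewrite -(ler_pM2r w0) -expr2 enorm_sq dotv_mulmx.
apply: (le_trans (cauchy_schwarz _ _)).
apply: (le_trans (ler_wpM2l (enorm_ge0 v) (opnormP B _))).
by rewrite mulrA (mulrC (enorm v)).
Qed.

(** Homogeneous coordinates: they turn the affine pieces of the loss into bilinear forms while
    leaving differences, hence Lipschitz estimates, unchanged. *)
Definition homog n (x : 'cV[R]_n) : 'cV[R]_(n + 1) := col_mx x 1%:M.

Lemma enorm_homog n (x : 'cV[R]_n) : enorm (homog x) = Num.sqrt (enorm x ^+ 2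
  + 1).
Proof.
rewrite {1}/enorm; congr Num.sqrt; rewrite big_split_ord/= enorm_sq dotvE.
congr (_ + _).
  by apply: eq_bigr => i _; rewrite col_mxEu expr2.
by rewrite big_ord1 col_mxEd mxE eqxx expr1n.
Qed.

Lemma homogB n (x y : 'cV[R]_n) : enorm (homog x - homog y) = enorm (x - y).
Proof.
rewrite /homog opp_col_mx add_col_mx subrr {1}/enorm big_split_ord/=.
rewrite big_ord1 col_mxEd mxE expr0n/= addr0; congr Num.sqrt.
by apply: eq_bigr => i _; rewrite col_mxEu.
Qed.

Lemma enorm_homog_le n (x : 'cV[R]_n) r : enorm x <= r ->
  enorm (homog x) <= Num.sqrt (r ^+ 2 + 1).
Proof.
move=> xr; rewrite enorm_homog ler_sqrt; last by rewrite addr_ge0// sqr_ge0.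
by rewrite lerD2r ler_pXn2r// nnegrE ?(le_trans _ xr) ?enorm_ge0.
Qed.

Lemma affine_homog dx dxi (A : 'M[R]_(dxi, dx)) abar b bbar x xi :
  ((affine_coef A abar x)^T *m xi) ord0 ord0 + affine_cst b bbar x
  = dotv (homog x) (block_mx A^T b abar^T bbar%:M *m homog xi).
Proof.
rewrite /dotv /homog mul_block_col tr_col_mx mul_row_col !mulmx1 trmx1 mul1mx.
have addE (u v : 'M[R]_1) : (u + v) ord0 ord0 = u ord0 ord0 + v ord0 ord0.
  by rewrite mxE.
rewrite /affine_coef /affine_cst linearD/= mulmxDl trmx_mul mulmxDr !addE.
have -> : (bbar%:M : 'M[R]_1) ord0 ord0 = bbar by rewrite mxE eqxx mulr1n.
rewrite mulmxA -!addrA; congr (_ + _).  rewrite addrCA; congr (_ + (_ + _)).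
exact: dotvC.
Qed.

End euclid.

(** * Rademacher averages *)

Section suprema.
Context {R : realType} {S : Type} (A : set S).

Definition supr (F : S -> R) : R := sup [set F s | s in A].

(** Real [sup] has a default value on sets unbounded above, so boundedness accompanies every
    function. The bound is two-sided because the functions are both added and subtracted. *)
Definition bnd (F : S -> R) : Prop := exists b, forall s, A s -> `|F s| <= b.

Lemma bndD F G : bnd F -> bnd G -> bnd (F + G).
Proof.
move=> [b Fb] [c Gc]; exists (b + c) => s As.
by rewrite (le_trans (ler_normD _ _))// lerD ?Fb ?Gc.
Qed.

Lemma bndZ (a : R) F : bnd F -> bnd (fun s => a * F s).
Proof.
move=> [b Fb]; exists (`|a| * b) => s As.
by rewrite normrM ler_wpM2l// Fb.
Qed.

Lemma bndN F : bnd F -> bnd (- F).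
Proof. by move=> [b Fb]; exists b => s As; rewrite /= normrN Fb. Qed.

Lemma bnd_cst (a : R) : bnd (fun=> a).
Proof. by exists `|a|. Qed.

Lemma bnd_sum (I : Type) (r : seq I) (F : I -> S -> R) :
  (forall i, bnd (F i)) -> bnd (\sum_(i <- r) F i).
Proof.
move=> bF; elim/big_rec : _ => [|i G _]; first exact: (bnd_cst 0).
exact: bndD.
Qed.

Lemma supr_ub F s : bnd F -> A s -> F s <= supr F.
Proof.
move=> [b Fb] As; apply: ub_le_sup; last by exists s.
by exists b => _ [t At <-]; rewrite (le_trans (ler_norm _))// Fb.
Qed.

Hypothesis A0 : A !=set0.

Lemma supr_le F c : (forall s, A s -> F s <= c) -> supr F <= c.
Proof.
move=> Fc; apply: ge_sup => [|_ [t At <-]]; last exact: Fc.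
by have [s As] := A0; exists (F s), s.
Qed.

Lemma supr_add_le F G c :
  (forall s t, A s -> A t -> F s + G t <= c) -> supr F + supr G <= c.
Proof.
move=> FGc; rewrite -lerBrDr; apply: supr_le => s As.
by rewrite lerBrDr -lerBrDl; apply: supr_le => t At; rewrite lerBrDl FGc.
Qed.

End suprema.

Section rademacher.
Context {R : realType}.

(* E F(x + sum_i s_i a_i) for independent uniform signs s_i. *)
Fixpoint rad (V : zmodType) (a : seq V) (F : V -> R) (x : V) : R :=
  if a is v :: a' then (rad a' F (x + v) + rad a' F (x - v)) / 2 else F x.

(** Simulation principle for two signed sums in different groups: a relation preserved by every
    signed step transfers the final comparison. It is used to pass from functions to numbers, from
    laws to points, and from functions to vectors. *)
Lemma rad_rel (I : Type) (V W : zmodType) (f : I -> V) (g : I -> W)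
    (r : V -> W -> Prop) (F : V -> R) (G : W -> R) :
  (forall y z, r y z -> F y <= G z) ->
  (forall i y z, r y z -> r (y + f i) (z + g i) /\ r (y - f i) (z - g i)) ->
  forall s x z, r x z -> rad (map f s) F x <= rad (map g s) G z.
Proof.
move=> FG rfg; elim=> [|i s IH] x z rxz /=; first exact: FG.
by rewrite ler_pM2r ?invr_gt0// lerD// IH//; have [] := rfg i _ _ rxz.
Qed.

Section zmod.
Context {V : zmodType}.
Implicit Types (a b : seq V) (F G : V -> R).

Lemma eq_rad a F G : F =1 G -> rad a F =1 rad a G.
Proof. by move=> FG; elim: a => [|v a IH] x //=; rewrite !IH. Qed.

Lemma radD a F G x : rad a (fun y => F y + G y) x = rad a F x + rad a G x.
Proof. by elim: a x => [//|v a IH] x /=; rewrite !IH; lra. Qed.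

Lemma radZ a (c : R) F x : rad a (fun y => c * F y) x = c * rad a F x.
Proof. by elim: a x => [//|v a IH] x /=; rewrite !IH; lra. Qed.

Lemma rad_cst a (c : R) x : rad a (fun=> c) x = c.
Proof. by elim: a x => [//|v a IH] x /=; rewrite !IH; lra. Qed.

Lemma rad_shift a F u x : rad a (fun y => F (y + u)) x = rad a F (x + u).
Proof. by elim: a x => [//|v a IH] x /=;
  rewrite !IH (addrAC x v) (addrAC x (- v)). Qed.

Lemma rad_reflect a F x u : rad a (fun y => F (u - y)) x = rad a F (u - x).
Proof.
elim: a x => [//|v a IH] x /=; rewrite !IH; congr (_ / 2).
rewrite [RHS]addrC; congr (_ + _).
  by rewrite opprD addrA.
by rewrite opprB addrA addrAC.
Qed.

Lemma rad_symmetric a F u :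
  rad a F u = rad a (fun y => (F (u + y) + F (u - y)) / 2) 0.
Proof.
have -> : rad a (fun y => (F (u + y) + F (u - y)) / 2) 0
    = rad a (fun y => 2^-1 * (F (y + u) + F (u - y))) 0.
  by apply: eq_rad => y; rewrite mulrC (addrC u y).
by rewrite radZ radD rad_reflect rad_shift subr0 add0r; lra.
Qed.

Lemma rad_cat a b F x : rad (a ++ b) F x = rad a (rad b F) x.
Proof. by elim: a x => [//|v a IH] x /=; rewrite !IH. Qed.

Lemma rad_cons v a F x :
  rad (v :: a) F x = rad a (fun y => (F (y + v) + F (y - v)) / 2) x.
Proof.
have -> : rad a (fun y => (F (y + v) + F (y - v)) / 2) x
    = rad a (fun y => 2^-1 * (F (y + v) + F (y - v))) x.
  by apply: eq_rad => y; rewrite mulrC.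
by rewrite radZ radD !rad_shift mulrC.
Qed.

Lemma rad_swap a b F x : rad a (rad b F) x = rad b (rad a F) x.
Proof.
elim: a x => [|v a IH] x; first by apply: eq_rad.
rewrite /= !IH -!rad_shift -radD mulrC -radZ.
by apply: eq_rad => y; rewrite /= mulrC.
Qed.

End zmod.

Lemma rad_sqr (a : seq R) (x : R) :
  rad a (fun y => y ^+ 2) x = x ^+ 2 + \sum_(v <- a) v ^+ 2.
Proof.
elim: a x => [|v a IH] x; first by rewrite big_nil addr0.
by rewrite big_cons /= !IH; lra.
Qed.

(** The bound is the fourth moment of a Gaussian with mean x and the same variance; each sign falls
    short of it by 2 v^4. *)
Lemma rad_pow4 (a : seq R) (x : R) :
  rad a (fun y => y ^+ 4) x <= x ^+ 4 + 6 * x ^+ 2 * (\sum_(v <- a) v ^+ 2)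
    + 3 * (\sum_(v <- a) v ^+ 2) ^+ 2.
Proof.
elim: a x => [|v a IH] x; first by rewrite big_nil /= expr0n/= !mulr0 !addr0.
rewrite big_cons /=; set s := \sum_(w <- a) _.
have := IH (x + v); have := IH (x - v); rewrite -/s => H1 H2.
have := sqr_ge0 (v ^+ 2).
by move: H1 H2; nra.
Qed.

Lemma rad_le (V : zmodType) (a : seq V) (F G : V -> R) x :
  (forall y, F y <= G y) -> rad a F x <= rad a G x.
Proof.
move=> FG; elim: a x => [|v a IH] x /=; first exact: FG.
by rewrite ler_pM2r ?invr_gt0// lerD.
Qed.

(* Littlewood's argument: the quartic below stays under |y| and only sees the
   second and fourth moments; Szarek's sharp constant is sqrt 2. *)
Lemma khintchine (a : seq R) :
  Num.sqrt (\sum_(v <- a) v ^+ 2) <= 2 * rad a (fun y => `|y|) 0.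
Proof.
set s2 := \sum_(v <- a) v ^+ 2; set s := Num.sqrt s2.
have s20 : 0 <= s2 by apply: sumr_ge0 => v _; exact: sqr_ge0.
have [s0|sn0] := eqVneq s 0.
  have : rad a (fun=> 0 : R) 0 <= rad a (fun y => `|y|) 0 by exact: rad_le.
  by rewrite rad_cst s0 => ?; rewrite mulr_ge0.
have s0 : 0 < s by rewrite lt_neqAle eq_sym sn0 sqrtr_ge0.
have ss : s ^+ 2 = s2 by rewrite sqr_sqrtr.
(* In units t = |y| / s the quartic is s (3 t^2 / 4 - t^4 / 16), which touches |y| at t = 2: the
   difference is s t (t - 2)^2 (t + 4) / 16. Its mean is at least 3/4 - 3/16 = 9/16 of s, which
   exceeds s / 2. *)
pose c1 := 3 / 4 / s; pose c2 := - (16 * s ^+ 3)^-1.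
have poly_le (y : R) : c1 * y ^+ 2 + c2 * y ^+ 4 <= `|y|.
  pose t := `|y| / s.
  have yt : `|y| = s * t by rewrite /t mulrC divfK// gt_eqF.
  have t0 : 0 <= t by rewrite divr_ge0// ltW.
  have -> : c1 * y ^+ 2 + c2 * y ^+ 4
      = s * (3 / 4 * t ^+ 2 - t ^+ 4 / 16).
    have y2 : y ^+ 2 = (s * t) ^+ 2 by rewrite -yt real_normK ?num_real.
    have -> : y ^+ 4 = (y ^+ 2) ^+ 2 by rewrite -exprM.
    by rewrite y2 /c1 /c2; field; rewrite gt_eqF.
  rewrite yt ler_pM2l// -subr_ge0.
  have -> : t - (3 / 4 * t ^+ 2 - t ^+ 4 / 16)
    = t * ((t - 2) ^+ 2 * (t + 4)) / 16 by field.
  by rewrite divr_ge0// mulr_ge0// mulr_ge0 ?sqr_ge0// addr_ge0.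
have := rad_le a 0 poly_le; rewrite radD !radZ rad_sqr.
have := rad_pow4 a 0; rewrite -/s2 -ss !expr0n/= !mulr0 mul0r !add0r => H4 H.
have : c1 * s ^+ 2 + c2 * (3 * s ^+ 2 ^+ 2) <= rad a (fun y => `|y|) 0.
  apply: le_trans H; rewrite lerD2l ler_wnM2l// /c2 oppr_le0 invr_ge0.
  by rewrite mulr_ge0// exprn_ge0// ltW.
have -> : c1 * s ^+ 2 + c2 * (3 * s ^+ 2 ^+ 2) = 9 / 16 * s.
  by rewrite /c1 /c2; field; rewrite gt_eqF.
by move: s0; lra.
Qed.

(** Jensen's inequality one sign at a time: concavity of the square root, then the parallelogram law
    to average the two squared norms. *)
Lemma rad_enorm n (a : seq 'cV[R]_n) (x : 'cV[R]_n) :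
  rad a (@enorm R n) x
    <= Num.sqrt (enorm x ^+ 2 + \sum_(v <- a) enorm v ^+ 2).
Proof.
elim: a x => [|v a IH] x.
  by rewrite big_nil addr0 /= sqrtr_sqr ger0_norm// enorm_ge0.
rewrite big_cons /=; set s := \sum_(w <- a) _ in IH *.
have s0 : 0 <= s by apply: sumr_ge0 => w _; exact: sqr_ge0.
apply: (@le_trans _ _ ((Num.sqrt (enorm (x + v) ^+ 2 + s)
   + Num.sqrt (enorm (x - v) ^+ 2 + s)) / 2)).
  by rewrite ler_pM2r ?invr_gt0// lerD.
have p0 (w : 'cV[R]_n) : 0 <= enorm w ^+ 2 + s by rewrite addr_ge0// sqr_ge0.
rewrite -(@ler_pXn2r _ 2)// ?nnegrE ?divr_ge0 ?addr_ge0 ?sqrtr_ge0//.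
rewrite [leRHS]sqr_sqrtr ?addr_ge0 ?sqr_ge0//.
have := sqr_ge0 (Num.sqrt (enorm (x + v) ^+ 2 + s)
  - Num.sqrt (enorm (x - v) ^+ 2 + s)).
have := sqr_sqrtr (p0 (x + v)); have := sqr_sqrtr (p0 (x - v)).
have := enorm_parallelogram x v.
set g := Num.sqrt _; set h := Num.sqrt _.
by move=> H1 H2 H3 H4; lra.
Qed.

End rademacher.

(** * Scalar and vector contraction principles *)

Section contraction.
Context {R : realType} {S : Type} (A : set S).
Hypothesis A0 : A !=set0.

(** The sum of the two suprema is tested on pairs (s, t), where h s - h t is at most |e s - e t|.
    The sign of e s - e t decides which of the two points is tested in U + e and which in U - e. *)
Lemma supr_contraction (U h e : S -> R) :
  bnd A U -> bnd A e ->
  (forall s t, A s -> A t -> `|h s - h t| <= `|e s - e t|) ->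
  supr A (U + h) + supr A (U - h) <= supr A (U + e) + supr A (U - e).
Proof.
move=> bU be he; apply: supr_add_le => // s t As At /=.
have := he s t As At; rewrite ler_norml => /andP[_].
have hs := @supr_ub _ _ A (U + e) _ (bndD bU be).
have ht := @supr_ub _ _ A (U - e) _ (bndD bU (bndN be)).
have := hs s As; have := hs t At; have := ht s As; have := ht t At.
rewrite !fctE /=; case: ger0P; lra.
Qed.

(* Maurer's vector contraction: Khintchine's inequality turns the Euclidean
   distance |f s - f t| into |X s - X t| for the signed sum X of the f_j, and
   the symmetry of X removes the absolute value. *)
Lemma supr_vector_contraction (J : Type) (r : seq J) (U h : S -> R)
    (f : J -> S -> R) :
  bnd A U -> (forall j, bnd A (f j)) ->
  (forall s t, A s -> A t ->
     `|h s - h t| <= Num.sqrt (\sum_(j <- r) (f j s - f j t) ^+ 2)) ->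
  (supr A (U + h) + supr A (U - h)) / 2
    <= rad [seq (fun s => 2 * f j s) | j <- r] (supr A) U.
Proof.
move=> bU bf hf; rewrite ler_pdivrMr// rad_symmetric.
have -> : rad [seq (fun s => 2 * f j s) | j <- r]
    (fun y => (supr A (U + y) + supr A (U - y)) / 2) 0 * 2
  = rad [seq (fun s => 2 * f j s) | j <- r]
    (fun y => supr A (U + y) + supr A (U - y)) 0.
  by rewrite mulrC -radZ; apply: eq_rad => y; rewrite mulrC divfK.
apply: supr_add_le => // s t As At.
(* The factor 2 cancels the constant of Khintchine's inequality. *)
pose d j := 2 * (f j s - f j t).
have kh : `|h s - h t| <= rad (map d r) (fun y => `|y|) 0.
  have := khintchine (map d r); rewrite big_map.
  have -> : \sum_(j <- r) d j ^+ 2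
      = 2 ^+ 2 * \sum_(j <- r) (f j s - f j t) ^+ 2.
    by rewrite mulr_sumr; apply: eq_bigr => j _; rewrite exprMn.
  rewrite sqrtrM ?exprn_ge0// sqrtr_sqr ger0_norm// ler_pM2l//.
  by apply: le_trans; exact: hf.
apply: (@le_trans _ _ (rad (map d r) (fun y => U s + U t + `|y|) 0)).
  rewrite radD rad_cst; move: kh; have := ler_norm (h s - h t).
  by rewrite !fctE /=; lra.
(* The real walk y is the difference between the values at s and t of the function-valued walk v, so
   sup (U + v) + sup (U - v) dominates U s + U t + |y| whatever the sign of y. *)
apply: (@rad_rel R J R (S -> R) d (fun j s => 2 * f j s)
  (fun y v => bnd A v /\ y = v s - v t)).
- move=> y v [bv ->].
  have hs := @supr_ub _ _ A (U + v) _ (bndD bU bv).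
  have ht := @supr_ub _ _ A (U - v) _ (bndD bU (bndN bv)).
  have := hs s As; have := hs t At; have := ht s As; have := ht t At.
  by rewrite !fctE /=; case: ger0P; lra.
- move=> j y v [bv ->]; rewrite /d; split; split.
  + exact/bndD/bndZ/bf.
  + by rewrite !fctE /=; lra.
  + exact/bndD/bndN/bndZ/bf.
  + by rewrite !fctE /=; lra.
- split; first exact: (bnd_cst A 0).
  by rewrite ?fctE subrr.
Qed.

Lemma rad_supr_le (I : Type) (r : seq I) (f : I -> S -> R)
    (F G : (S -> R) -> R) U :
  (forall i, bnd A (f i)) -> bnd A U ->
  (forall y, bnd A y -> F y <= G y) -> rad (map f r) F U <= rad (map f r) G U.
Proof.
move=> bf bU FG; apply: (@rad_rel R I _ _ f f (fun y v => bnd A y /\ y = v)).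
- by move=> y _ [by_ <-]; exact: FG.
- move=> i y _ [by_ <-]; split; split => //.
    exact/bndD/bf.
  exact/bndD/bndN/bf.
- by [].
Qed.

Lemma rad_vector_contraction (I J : Type) (q : seq I) (r : seq J)
    (h : I -> S -> R) (f : I -> J -> S -> R) U :
  bnd A U -> (forall i, bnd A (h i)) -> (forall i j, bnd A (f i j)) ->
  (forall i s t, A s -> A t ->
     `|h i s - h i t| <= Num.sqrt (\sum_(j <- r) (f i j s - f i j t) ^+ 2)) ->
  rad (map h q) (supr A) U
    <= rad [seq (fun s => 2 * f ij.1 ij.2 s) | ij <- [seq (i, j) | i <- q,
      j <- r]]
         (supr A) U.
Proof.
move=> bU bh bf hf; elim: q U bU => [//|i q IH] U bU.
rewrite allpairs_cons map_cat rad_cat -map_comp /=.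
rewrite -/(rad (h i :: map h q) _ _).
(* The sign of [h i] is made innermost so that the one-sign contraction acts directly on the
   supremum; the J new signs are then swapped outside, and the induction hypothesis applies
   inside. *)
have := @rad_cons R _ (h i) (map h q) (supr A) U => /= ->.
apply: (@le_trans _ _ (rad (map h q)
   (rad [seq (fun s => 2 * f i j s) | j <- r] (supr A)) U)).
  apply: rad_supr_le => // y by_.
  by apply: supr_vector_contraction => //; exact: hf.
rewrite [leLHS]rad_swap; apply: (@rad_supr_le J r (fun j s => 2 * f i j s)) =>
  // j.
exact/bndZ/bf.
Qed.

End contraction.

Section uniform_deviation.
Context {R : realType} (K : finType) (p : K -> R).
Hypothesis p_ge0 : forall k, 0 <= p k.
Hypothesis p_sum1 : \sum_k p k = 1.
Context {S : Type} (A : set S).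
Hypothesis A0 : A !=set0.

(** Left unnormalised: n times the gap between the mean and the empirical mean, so that each draw
    contributes one summand independent of n. *)
Definition deviation (phi : K -> S -> R) (s : seq K) : S -> R :=
  \sum_(k <- s) (fun q => avg p (phi ^~ q) - phi k q).

Lemma bnd_avg (phi : K -> S -> R) : (forall k, bnd A (phi k)) ->
  bnd A (fun q => avg p (phi ^~ q)).
Proof.
move=> bphi; rewrite (_ : (fun q => _) = \sum_k (fun q => p k * phi k q)).
  by apply: bnd_sum => k; exact: bndZ.
by apply/funext => q; rewrite fct_sumE.
Qed.

(* One sample point at a time, without a ghost sample: by convexity the supremum
   of V + E phi - phi_k is at most half the sum of the suprema of V + 2 E phi
   and V - 2 phi_k, and E phi leaves the supremum by convexity again. *)
Lemma symmetrization (phi e : K -> S -> R) n U :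
  (forall k, bnd A (phi k)) -> (forall k, bnd A (e k)) ->
  (forall k s t, A s -> A t ->
     `|phi k s - phi k t| <= `|e k s - e k t|) ->
  bnd A U ->
  iid_avg p n (fun s => supr A (U + deviation phi s))
   <= iid_avg p n (fun s => rad [seq (fun q => 2 * e k q) | k <- s] (supr A) U).
Proof.
move=> bphi be phie; have bP := bnd_avg bphi.
have bdev s : bnd A (deviation phi s).
  by apply: bnd_sum => k; apply: bndD => //; exact: bndN.
elim: n U => [|n IH] U bU /=.
  by rewrite /deviation big_nil addr0.
have b2e k : bnd A (fun q => 2 * e k q) by exact: bndZ.
have b2phi k : bnd A (fun q => 2 * phi k q) by exact: bndZ.
pose W (V : S -> R) s := supr A (V + deviation phi s).
apply: (@le_trans _ _ (avg p (fun k => 2^-1 *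
   (iid_avg p n (W (U + (fun q => 2 * e k q)))
    + iid_avg p n (W (U - (fun q => 2 * e k q))))))); last first.
  apply: avg_le => // k; rewrite -iid_avgD -iid_avgZ /W.
  rewrite iid_avgZ iid_avgD.
  apply: (@le_trans _ _ (2^-1 * (
    iid_avg p n (fun s => rad [seq (fun q => 2 * e k q) | k <- s] (supr A)
      (U + (fun q => 2 * e k q)))
    + iid_avg p n (fun s => rad [seq (fun q => 2 * e k q) | k <- s] (supr A)
      (U - (fun q => 2 * e k q)))))).
    rewrite ler_pM2l ?invr_gt0//; apply: lerD; apply: IH.
      exact: bndD.
    exact/bndD/bndN.
  rewrite -iid_avgD -iid_avgZ; apply: iid_avg_le => // s _.
  by rewrite mulrC.
rewrite -!iid_avg_avg.
under [X in _ <= avg _ X]eq_fun do rewrite -iid_avgD -iid_avgZ.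
rewrite -iid_avg_avg; apply: iid_avg_le => // s _.
set V := U + deviation phi s.
have bV : bnd A V by exact: bndD.
apply: (@le_trans _ _ (avg p (fun k => 2^-1 *
  (supr A (V + (fun q => 2 * phi k q)) + supr A (V - (fun q =>
    2 * phi k q)))))).
  pose P2 : S -> R := fun q => 2 * avg p (phi ^~ q).
  apply: (@le_trans _ _ (avg p (fun k => 2^-1 *
    (supr A (V + P2) + supr A (V - (fun q => 2 * phi k q)))))).
    apply: avg_le => // k; apply: supr_le => // q Aq.
    have := @supr_ub _ _ A (V + P2) q (bndD bV (bndZ 2 bP)) Aq.
    have := @supr_ub _ _ A (V - (fun q => 2 * phi k q)) q
      (bndD bV (bndN (b2phi k))) Aq.
    rewrite /deviation big_cons /V /P2 /deviation !fctE /=.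
    by lra.
  rewrite !avgZ// ler_pM2l ?invr_gt0// !avgD lerD2r avg_cst//.
  apply: supr_le => // q Aq.
  rewrite /P2 fctE /= -avgZ -(avg_cst p_sum1 (V q)) -avgD.
  apply: avg_le => // k.
  exact: (@supr_ub _ _ A (V + (fun q => 2 * phi k q)) q (bndD bV (b2phi k)) Aq).
(* [phi] is exchanged for [e] while its sign is introduced; in the application this removes the
   positive part. *)
apply: avg_le => // k; rewrite ler_pM2l ?invr_gt0//.
rewrite /W -!addrA !(addrC _ (deviation _ _)) !addrA -/V.
apply: supr_contraction => // s0 t As At.
by rewrite -!mulrBr !normrM ler_pM2l ?normr_gt0// phie.
Qed.

(** [r y v] stands for the link y Q = E_Q v between functions of a law and functions of a point; the
    supremum over laws is then at most the one over points. The constant 4 is 2 from symmetrization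
    times 2 from Khintchine. What remains is the norm of a signed sum of n J vectors of length at
    most 4 [omega], paired with vectors of length at most [rho]. *)
Lemma iid_avg_deviation_le (X : Type) (B : set X) (e : K -> S -> R)
    (phi : K -> S -> R) (l : K -> X -> R) (r : (S -> R) -> (X -> R) -> Prop)
    (J d : nat) (w : K -> 'I_J -> 'cV[R]_d) (h : X -> 'cV[R]_d)
    (rho omega : R) n :
  B !=set0 ->
  (forall k, bnd A (phi k)) -> (forall k, bnd A (e k)) ->
  (forall k, bnd B (l k)) ->
  (forall k s t, A s -> A t -> `|phi k s - phi k t| <= `|e k s - e k t|) ->
  r 0 0 ->
  (forall k y v, r y v ->
     r (y + (fun q => 2 * e k q)) (v + (fun x => 2 * l k x)) /\
     r (y - (fun q => 2 * e k q)) (v - (fun x => 2 * l k x))) ->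
  (forall y v, r y v -> bnd B v -> supr A y <= supr B v) ->
  (forall k x x', B x -> B x' ->
     `|l k x - l k x'|
     <= Num.sqrt (\sum_j (dotv (w k j) (h x) - dotv (w k j) (h x')) ^+ 2)) ->
  0 <= rho -> 0 <= omega ->
  (forall x, B x -> enorm (h x) <= rho) ->
  (forall k j, enorm (w k j) <= omega) ->
  iid_avg p n (fun s => supr A (deviation phi s))
    <= 4 * rho * omega * Num.sqrt (n%:R * J%:R).
Proof.
move=> B0 bphi be bl phie r00 rD rsup lw rho0 om0 hrho womega.
have bdot k j : bnd B (fun x => dotv (w k j) (h x)).
  exists (omega * rho) => x Bx; apply: (le_trans (cauchy_schwarz_norm _ _)).
  by rewrite ler_pM ?enorm_ge0 ?hrho ?womega.
have bl2 k : bnd B (fun x => 2 * l k x) by exact: bndZ.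
apply: (@le_trans _ _ (iid_avg p n (fun s =>
   rad [seq (fun q => 2 * e k q) | k <- s] (supr A) 0))).
  apply: le_trans (symmetrization _ bphi be phie (bnd_cst A 0)).
  by apply: iid_avg_le => // s _; rewrite add0r.
rewrite -(iid_avg_cst p_sum1 n (4 * rho * omega * _)).
apply: iid_avg_le => // s sn.
apply: (@le_trans _ _ (rad [seq (fun x => 2 * l k x) | k <- s] (supr B) 0)).
  apply: (rad_rel (r := fun y v => r y v /\ bnd B v)).
  - by move=> y v [ryv bv]; exact: rsup.
  - move=> k y v [ryv bv]; have [r1 r2] := rD k y v ryv.
    split; split => //; first exact: bndD.
    exact/bndD/bndN.
  - by split => //; exact: (bnd_cst B 0).
apply: (le_trans (@rad_vector_contraction R X B B0 K 'I_J s (enum 'I_J)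
  (fun k x => 2 * l k x) (fun k j x => 2 * dotv (w k j) (h x)) 0
  (bnd_cst B 0) bl2 (fun k j => bndZ 2 (bdot k j)) _)).
  move=> k x x' Bx Bx'; rewrite -mulrBr normrM ger0_norm// big_enum/=.
  have -> : \sum_j (2 * dotv (w k j) (h x) - 2 * dotv (w k j) (h x')) ^+ 2
    = 2 ^+ 2 * \sum_j (dotv (w k j) (h x) - dotv (w k j) (h x')) ^+ 2.
    by rewrite mulr_sumr; apply: eq_bigr => j _; rewrite -mulrBr exprMn.
  by rewrite sqrtrM ?exprn_ge0// sqrtr_sqr normr_nat ler_pM2l// lw.
pose v (ij : K * 'I_J) : 'cV[R]_d := 4 *: w ij.1 ij.2.
set q := [seq _ | i <- s, j <- _].
apply: (@le_trans _ _ (rad (map v q) (fun u => rho * enorm u) 0)).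
  apply: (rad_rel (r := fun y u => forall x, B x -> y x = dotv u (h x))).
  - move=> y u yu; apply: supr_le => // x Bx; rewrite yu//.
    by rewrite (le_trans (cauchy_schwarz _ _))// mulrC ler_wpM2r ?enorm_ge0
      ?hrho.
  - move=> ij y u yu; rewrite /v; split => x Bx; rewrite !fctE /= yu//.
      by rewrite dotvDl dotvZl; lra.
    by rewrite dotvDl dotvNl dotvZl; lra.
  - by move=> x _; rewrite dotv0l.
rewrite radZ; have := rad_enorm (map v q) 0.
rewrite enorm0 expr0n/= add0r big_map => H.
have -> : 4 * rho * omega * Num.sqrt (n%:R * J%:R)
  = rho * (4 * (omega * Num.sqrt (n%:R * J%:R))) by ring.
rewrite ler_wpM2l//.
apply: (le_trans H).
have -> : 4 * (omega * Num.sqrt (n%:R * J%:R))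
  = Num.sqrt (\sum_(ij <- q) (4 * omega) ^+ 2).
  rewrite big_const_seq count_predT iter_addr_0 /q size_allpairs sn.
  rewrite size_enum_ord -(mulr_natr (_ ^+ 2)) natrM [RHS]sqrtrM ?sqr_ge0//
    sqrtr_sqr.
  by rewrite ger0_norm ?mulr_ge0// mulrA.
rewrite ler_sqrt; last by apply: sumr_ge0 => i _; exact: sqr_ge0.
apply: ler_sum => ij _; rewrite /v enormZ ger0_norm//.
by rewrite ler_pXn2r ?nnegrE ?mulr_ge0 ?enorm_ge0// ler_pM2l.
Qed.

End uniform_deviation.

(** * Integration of bounded functions *)

Section bounded_integrals.
Context d (T : measurableType d) (R : realType).
Variables (D : set T) (mD : measurable D).

Definition bmeas (f : T -> R) : Prop :=
  measurable_fun D f /\ exists b, forall x, D x -> `|f x| <= b.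

Lemma bmeas_cst (a : R) : bmeas (fun=> a).
Proof. by split => //; exists `|a|. Qed.

Lemma bmeasD f g : bmeas f -> bmeas g -> bmeas (fun x => f x + g x).
Proof.
move=> [mf [b fb]] [mg [c gc]]; split; first exact: measurable_funD.
exists (b + c) => x Dx.
by rewrite (le_trans (ler_normD _ _))// lerD ?fb ?gc.
Qed.

Lemma bmeasZ a f : bmeas f -> bmeas (fun x => a * f x).
Proof.
move=> [mf [b fb]]; split; first exact: measurable_funM.
by exists (`|a| * b) => x Dx; rewrite normrM ler_wpM2l// fb.
Qed.

Lemma bmeas_sum (I : Type) (r : seq I) (f : I -> T -> R) :
  (forall i, bmeas (f i)) -> bmeas (fun x => \sum_(i <- r) f i x).
Proof.
move=> bf; elim: r => [|i r IH].
  by under eq_fun do rewrite big_nil; exact: bmeas_cst.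
by under eq_fun do rewrite big_cons; exact: bmeasD.
Qed.

Lemma bmeas_indic A : measurable A -> bmeas \1_A.
Proof.
move=> mA; split; first exact: measurable_indic.
by exists 1 => x _; rewrite indicE; case: (_ \in _); rewrite ?normr1 ?normr0.
Qed.

Section finite_measure.
Variable mu : {finite_measure set T -> \bar R}.

Lemma bmeas_integrable f : bmeas f -> mu.-integrable D (EFin \o f).
Proof.
move=> [mf [b fb]]; apply: measurable_bounded_integrable => //.
  by rewrite ltey_eq fin_num_measure.
exists b; split; first exact: num_real.
by move=> c bc x Dx /=; rewrite (le_trans (fb x Dx))// ltW.
Qed.

Lemma bmeas_EFin f : bmeas f ->
  (\int[mu]_(x in D) (f x)%:E)%E = (\int[mu]_(x in D) f x)%:E.
Proof.
by move=> bf; rewrite fineK// integrable_fin_num//; exact: bmeas_integrable.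
Qed.

Lemma bmeas_integralD f g : bmeas f -> bmeas g ->
  \int[mu]_(x in D) (f x + g x)
  = \int[mu]_(x in D) f x + \int[mu]_(x in D) g x.
Proof. by move=> bf bg; rewrite RintegralD//; exact: bmeas_integrable. Qed.

Lemma bmeas_integralZ a f : bmeas f ->
  \int[mu]_(x in D) (a * f x) = a * \int[mu]_(x in D) f x.
Proof. by move=> bf; rewrite RintegralZl//; exact: bmeas_integrable. Qed.

Lemma bmeas_integral_le f g : bmeas f -> bmeas g ->
  (forall x, D x -> f x <= g x) ->
  \int[mu]_(x in D) f x <= \int[mu]_(x in D) g x.
Proof. by move=> bf bg; apply: le_Rintegral => //; exact: bmeas_integrable. Qed.

Lemma bmeas_integral_sum (I : Type) (r : seq I) (f : I -> T -> R) :
  (forall i, bmeas (f i)) ->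
  \int[mu]_(x in D) (\sum_(i <- r) f i x)
  = \sum_(i <- r) \int[mu]_(x in D) f i x.
Proof.
move=> bf; elim: r => [|i r IH].
  rewrite big_nil; under eq_Rintegral do rewrite big_nil.
  by rewrite Rintegral_cst// mul0r.
rewrite big_cons; under eq_Rintegral do rewrite big_cons.
by rewrite bmeas_integralD ?IH//; exact: bmeas_sum.
Qed.

Lemma bmeas_integral_indic A : measurable A ->
  \int[mu]_(x in D) \1_A x = fine (mu (A `&` D)).
Proof. by move=> mA; rewrite /Rintegral integral_indic. Qed.

(* All integrals below are compared with finite sums over small cells; this
   replaces Fubini's theorem and product measures. *)
Lemma integral_cells (K : finType) (kappa : T -> K) (c : K -> R)
    (f : T -> R) (delta : R) :
  (forall k, measurable (kappa @^-1` [set k])) ->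
  bmeas f -> (forall x, D x -> `|f x - c (kappa x)| <= delta) ->
  `|\int[mu]_(x in D) f x
    - \sum_k c k * fine (mu ((kappa @^-1` [set k]) `&` D))|
  <= delta * fine (mu D).
Proof.
move=> mk bf fc.
pose A k := kappa @^-1` [set k].
pose s x := \sum_k c k * \1_(A k) x.
have sE x : s x = c (kappa x).
  rewrite /s (bigD1 (kappa x))//= big1 ?addr0 => [|k kx].
    by rewrite indicE mem_set// mulr1.
  rewrite indicE memNset ?mulr0// /A /= => xk.
  by move: kx; rewrite xk eqxx.
have bA k : bmeas (fun x => c k * \1_(A k) x) by exact/bmeasZ/bmeas_indic/mk.
have bs : bmeas s by exact: bmeas_sum.
have <- : \int[mu]_(x in D) s x = \sum_k c k * fine (mu (A k `&` D)).
  rewrite bmeas_integral_sum//; apply: eq_bigr => k _.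
  by rewrite bmeas_integralZ ?bmeas_integral_indic//;
    [exact: mk|exact/bmeas_indic/mk].
have H f1 f2 : bmeas f1 -> bmeas f2 ->
    (forall x, D x -> f1 x <= f2 x + delta) ->
    \int[mu]_(x in D) f1 x - \int[mu]_(x in D) f2 x <= delta * fine (mu D).
  move=> b1 b2 f12; rewrite lerBlDl -Rintegral_cst//.
  rewrite -bmeas_integralD//; last exact: bmeas_cst.
  by apply: bmeas_integral_le => //; exact/bmeasD/bmeas_cst.
rewrite ler_norml; apply/andP; split.
  rewrite lerNl opprB; apply: H => // x Dx; rewrite sE.
  by have := fc x Dx; rewrite ler_norml; lra.
apply: H => // x Dx; rewrite sE.
by have := fc x Dx; rewrite ler_norml; lra.
Qed.

Lemma integral_full f : mu (~` D) = 0%E -> measurable_fun setT f -> bmeas f ->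
  mu.-integrable setT (EFin \o f) /\
  (\int[mu]_x (f x)%:E)%E = (\int[mu]_(x in D) f x)%:E.
Proof.
move=> muD mf bf; have mDc := measurableC mD.
have If : mu.-integrable setT (EFin \o f).
  apply/(@negligible_integrable _ _ _ mu setT (~` D)) => //.
    exact/measurable_EFinP.
  by rewrite setTD setCK; exact: bmeas_integrable.
split => //; rewrite (@negligible_integral _ _ _ mu setT (~` D))//.
by rewrite setTD setCK bmeas_EFin.
Qed.

End finite_measure.
End bounded_integrals.

Section combination.
Context d (T : measurableType d) (R : realType).
Variables (mu nu : {finite_measure set T -> \bar R}) (a b : {nonneg R}).

Definition mcomb : set T -> \bar R := measure_add (mscale a mu) (mscale b nu).

HB.instance Definition _ := Measure.on mcomb.

Lemma mcombE A : mcomb A = (a%:num%:E * mu A + b%:num%:E * nu A)%E.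
Proof. by rewrite /mcomb measure_addE. Qed.

Lemma mcomb_fin : fin_num_fun mcomb.
Proof.
move=> A mA; rewrite mcombE.
by rewrite fin_numD !fin_numM// fin_num_measure.
Qed.

HB.instance Definition _ := Measure_isFinite.Build _ _ _ mcomb mcomb_fin.

Lemma integral_mcomb (D : set T) f : measurable D -> bmeas D f ->
  \int[mcomb]_(x in D) f x
  = a%:num * \int[mu]_(x in D) f x + b%:num * \int[nu]_(x in D) f x.
Proof.
move=> mD bf; have [mf [c fc]] := bf.
(* The shift makes the integrand nonnegative, where integration against a sum of measures is
   additive; the constant is subtracted again at the end. *)
pose g x := f x + c.
have g0 x : D x -> 0 <= g x.
  by move=> Dx; have := fc x Dx; rewrite ler_norml /g; lra.
have bg : bmeas D g by exact/bmeasD/bmeas_cst.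
have mg : measurable_fun D (EFin \o g) by case: bg => ? _;
  exact/measurable_EFinP.
have gE (m : {finite_measure set T -> \bar R}) :
    \int[m]_(x in D) g x = \int[m]_(x in D) f x + c * fine (m D).
  by rewrite bmeas_integralD ?Rintegral_cst//; exact: bmeas_cst.
have H : \int[mcomb]_(x in D) g x
    = a%:num * \int[mu]_(x in D) g x + b%:num * \int[nu]_(x in D) g x.
  apply: EFin_inj; rewrite EFinD !EFinM -!bmeas_EFin//.
  rewrite ge0_integral_measure_add//.
  by rewrite !ge0_integral_mscale.
move: H; rewrite !gE /= mcombE fineD ?fin_numM ?fin_num_measure//.
by rewrite !fineM ?fin_num_measure//=; lra.
Qed.

End combination.

Section probability_of_measure.
Context d (T : measurableType d) (R : realType).
Variables (m : {measure set T -> \bar R}) (m1 : m setT = 1%E).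

(** The vacuous [let] keeps the proof [m1] among the arguments, from which the probability structure
    can be inferred. *)
Definition probability_of : set T -> \bar R := let _ := m1 in m.

HB.instance Definition _ := Measure.copy probability_of m.
HB.instance Definition _ := Measure_isProbability.Build _ _ _ probability_of m1.

End probability_of_measure.

(** * Borel sets of R^n and finite partitions into small cells *)

Section borel.
Context {R : realType} {n : nat}.

Lemma open_Rvec_measurable (U : set 'cV[R]_n) : open U ->
  measurable (U : set (Rvec R n)).
Proof. exact: sub_sigma_algebra. Qed.

Lemma closed_Rvec_measurable (U : set 'cV[R]_n) : closed U ->
  measurable (U : set (Rvec R n)).
Proof.
move=> cU; rewrite -(setCK U); apply: measurableC.
by apply: open_Rvec_measurable; rewrite openC.
Qed.

Lemma compact_Rvec_measurable (U : set 'cV[R]_n) : compact U ->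
  measurable (U : set (Rvec R n)).
Proof.
move=> cU; apply: closed_Rvec_measurable; exact: compact_closed.
Qed.

Lemma continuous_Rvec_measurable (f : 'cV[R]_n -> R) : continuous f ->
  measurable_fun setT (f : Rvec R n -> R).
Proof.
move=> /continuousP cf; apply: (measurability _ (RGenOpens.measurableE R)).
move=> _ [_ [a [b ->] <-]]; rewrite setTI.
apply: open_Rvec_measurable; apply: cf.
exact: (@interval_open R (BRight a) (BLeft b) isT isT).
Qed.

Lemma lipschitz_continuous (f : 'cV[R]_n -> R) (L : R) :
  (forall x y, `|f x - f y| <= L * enorm (x - y)) -> continuous f.
Proof.
move=> fL x; apply/(@cvgrPdist_le _ _ _ (nbhs x)) => e e0.
pose c := `|L| * n%:R + 1.
have c0 : 0 < c by rewrite ltr_wpDl// mulr_ge0.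
near=> y; rewrite (le_trans (fL _ _))//.
apply: (@le_trans _ _ (c * `|x - y|)).
  rewrite /c mulrDl mul1r -mulrA (le_trans (ler_norm _))// normrM.
  rewrite (ger0_norm (enorm_ge0 _)) ler_wpDr// ler_wpM2l//.
  exact: enorm_le_norm.
rewrite mulrC -ler_pdivlMr//.
near: y; apply: cvgr_dist_le => //; exact: divr_gt0.
Unshelve. all: by end_near. Qed.

Lemma compact_cells (X : set 'cV[R]_n) (delta : R) : compact X -> X !=set0 ->
  0 < delta ->
  exists (m : nat) (kappa : Rvec R n -> 'I_m.+1) (c : 'I_m.+1 -> 'cV[R]_n),
    [/\ forall k, measurable (kappa @^-1` [set k]),
        forall k, X (c k) &
        forall x, X x -> enorm (x - c (kappa x)) <= delta].
Proof.
move=> cX [x0 Xx0] d0.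
have n1 : (0 : R) < n%:R + 1 by rewrite ltr_wpDl.
(* Balls are taken in the max norm, and the Euclidean norm is at most n times larger; adding 1
   covers n = 0. *)
pose r := delta / (n%:R + 1).
have r0 : 0 < r by rewrite divr_gt0.
have := cX; rewrite compact_cover => /(_ _ X (fun c => ball c r)) [].
- by move=> i Xi; exact: ball_open.
- by move=> x Xx; exists x => //; exact: ballxx.
move=> F FX XF.
pose s : seq 'cV[R]_n := finmap.enum_fset F.
pose fnd (t : seq 'cV[R]_n) (z : 'cV[R]_n) :=
  find (fun c => `[< ball c r z >]) t.
have mfnd t k : measurable ([set z | fnd t z = k] : set (Rvec R n)).
  elim: t k => [|c t IH] k.
    have [k0|k0] := pselect (0%N = k).
      by rewrite (_ : [set z | _] = setT)//; apply/seteqP; split => z /=.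
    by rewrite (_ : [set z | _] = set0)//; apply/seteqP; split => z /=.
  have mb : measurable (ball c r : set (Rvec R n)).
    by apply: open_Rvec_measurable; exact: ball_open.
  case: k => [|k].
    rewrite (_ : [set z | _] = ball c r)//; apply/seteqP; split => z /=.
      by rewrite /fnd /=; case: asboolP.
    by move=> cz; rewrite /fnd /=; case: asboolP.
  rewrite (_ : [set z | _] = ~` ball c r `&` [set z | fnd t z = k]).
    by apply: measurableI => //; exact: measurableC.
  apply/seteqP; split => z /=.
    by rewrite /fnd /=; case: asboolP => // nb [].
  by rewrite /fnd /=; case: asboolP => [? []|_ [_ ->]].
(* The cell of z is the index of the first ball of the subcover that contains it. The extra index
   [size s] collects the points outside all balls and gets the default centre [x0]. *)
exists (size s), (fun z => inord (fnd s z)), (fun k => nth x0 s k); split.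
- move=> k; rewrite (_ : _ @^-1` _ = [set z | fnd s z = k])//.
  have fle z : (fnd s z < (size s).+1)%N by rewrite ltnS; exact: find_size.
  apply/seteqP; split => z /=; first by move=> <-; rewrite inordK.
  by move=> zk; apply/val_inj; rewrite /= inordK.
- move=> k; have [ks|ks] := ltnP k (size s); last by rewrite nth_default.
  have /FX : nth x0 s k \in s by exact: mem_nth.
  by rewrite inE.
- move=> x Xx; have [c /= cF cx] := XF x Xx.
  have hs : has (fun c => `[< ball c r x >]) s.
    by apply/hasP; exists c => //; exact/asboolP.
  have fle : (fnd s x < (size s).+1)%N by rewrite ltnS; exact: find_size.
  rewrite inordK//; have /asboolP := nth_find x0 hs.
  rewrite -/(fnd s x) -ball_normE /= => xr.
  rewrite (le_trans (enorm_le_norm _))//.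
  rewrite distrC (le_trans (ler_wpM2l _ (ltW xr)))//.
  rewrite /r mulrCA ler_piMr ?(ltW d0)// ler_pdivrMr// mul1r.
  by rewrite lerDl.
Qed.

End borel.

(** * Loeb measures and weak compactness *)

Section ultralimit.
Context {R : realType} (U : set_system nat) (UU : UltraFilter U).

Lemma ultra_compact_cvg (X : topologicalType) (A : set X) (x : nat -> X) :
  compact A -> U [set k | A (x k)] -> exists2 p, A p & x @ U --> p.
Proof.
move=> cA UA; have [p [Ap clp]] := cA (x @ U) _ UA.
exists p => // V Vp; rewrite /=.
have [//|UnV] := in_ultra_setVsetC (x @^-1` V) UU.
by have [y [nVy Vy]] := clp (~` V) V UnV Vp.
Qed.

Definition ulim (x : nat -> R) : R := lim (x @ U).

Lemma ulim_cvg (x : nat -> R) b : (forall k, `|x k| <= b) -> x @ U --> ulim x.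
Proof.
move=> xb; have := @ultra_compact_cvg R `[(- b)%R,
  b]%classic x (@segment_compact R (- b) b).
case=> [|p _ xp].
  by apply: filterE => k /=; rewrite in_itv/= -ler_norml.
by rewrite /ulim (cvg_lim _ xp).
Qed.

Lemma ulim_le (x y : nat -> R) b c :
  (forall k, `|x k| <= b) -> (forall k, `|y k| <= c) ->
  U [set k | x k <= y k] -> ulim x <= ulim y.
Proof.
by move=> xb yc xy; apply: (ler_cvg_to (ulim_cvg xb) (ulim_cvg yc)).
Qed.

Lemma ulim_cst (a : R) : ulim (fun=> a) = a.
Proof. by rewrite /ulim; apply: cvg_lim => //; exact: cvg_cst. Qed.

Lemma ulimD (x y : nat -> R) b c :
  (forall k, `|x k| <= b) -> (forall k, `|y k| <= c) ->
  ulim (fun k => x k + y k) = ulim x + ulim y.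
Proof.
move=> xb yc; apply: cvg_lim => //.
by apply: cvgD; [exact: ulim_cvg xb|exact: ulim_cvg yc].
Qed.

Lemma ulimZ (a : R) (x : nat -> R) b :
  (forall k, `|x k| <= b) -> ulim (fun k => a * x k) = a * ulim x.
Proof.
by move=> xb; apply: cvg_lim => //; apply: cvgMr; exact: ulim_cvg xb.
Qed.

Lemma ulim_sum (I : Type) (r : seq I) (x : I -> nat -> R) b :
  (forall i k, `|x i k| <= b) ->
  ulim (fun k => \sum_(i <- r) x i k) = \sum_(i <- r) ulim (x i).
Proof.
move=> xb; elim: r => [|i r IH].
  by rewrite big_nil; under eq_fun do rewrite big_nil; rewrite ulim_cst.
rewrite big_cons -IH; under eq_fun do rewrite big_cons.
apply: (@ulimD _ _ b (\sum_(j <- r) b)) => // k.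
by rewrite (le_trans (ler_norm_sum _ _ _))// ler_sum.
Qed.

End ultralimit.

(* Loeb space of a sequence of probability spaces: an internal set is an
   ultraproduct of measurable sets. *)
Section loeb.
Context d (T : measurableType d) (U : set_system nat) (UU : UltraFilter U).

Definition loeb : Type := let _ := UU in nat -> T.

HB.instance Definition _ := Pointed.copy loeb (nat -> T).

Definition internal (a : nat -> set T) : set loeb :=
  [set w | U [set k | a k (w k)]].

Lemma internalC a : internal (fun k => ~` a k) = ~` internal a.
Proof.
apply/seteqP; split => w /= H.
  by move=> H'; have [k [//]] := filter_ex (filterI H H').
by have [] := in_ultra_setVsetC [set k | a k (w k)] UU.
Qed.

Lemma internalI a b : internal (fun k =>
  a k `&` b k) = internal a `&` internal b.
Proof.
apply/seteqP; split => w /= H; last by case: H => ? ?; exact: filterI.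
by split; apply: filterS H => k [].
Qed.

Lemma internalU a b : internal (fun k =>
  a k `|` b k) = internal a `|` internal b.
Proof.
rewrite -[LHS]setCK -internalC.
under eq_fun do rewrite setCU.
by rewrite internalI !internalC setCI !setCK.
Qed.

Lemma internal0 : internal (fun=> set0) = set0.
Proof. by apply/seteqP; split => w //= H; have [] := filter_ex H. Qed.

Lemma internalT : internal (fun=> setT) = setT.
Proof. by apply/seteqP; split => w //= _; exact: filterT. Qed.

(** If inclusion failed for U-many indices, choosing a counterexample at each of them would assemble
    into a point of the first internal set outside the second. *)
Lemma internal_sub a b : internal a `<=` internal b -> U [set k | a k `<=` b k].
Proof.
move=> ab; have [//|nab] := in_ultra_setVsetC [set k | a k `<=` b k] UU.
have /choice[w wP] : forall k, exists x, (~ a k `<=` b k) -> a k x /\ ~ b k x.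
  move=> k; have [|] := pselect (a k `<=` b k); first by exists point.
  by move=> /existsNP[x /not_implyP[ax bx]]; exists x.
have aw : internal a w.
  by apply: filterS nab => k /= /wP[].
have [k [bk nabk]] := filter_ex (filterI (ab w aw) nab).
by have [] := wP k nabk.
Qed.

Definition loeb_measurable : set (set loeb) :=
  [set A | exists2 a, (forall k, measurable (a k)) & A = internal a].

Lemma loeb_measurable0 : loeb_measurable set0.
Proof. by exists (fun=> set0); rewrite ?internal0. Qed.

Lemma loeb_measurableU : setU_closed loeb_measurable.
Proof.
move=> _ _ [a ma ->] [b mb ->]; exists (fun k => a k `|` b k).
  by move=> k; exact: measurableU.
by rewrite internalU.
Qed.

Lemma loeb_measurableC : setC_closed loeb_measurable.
Proof.
move=> _ [a ma ->]; exists (fun k => ~` a k); last by rewrite internalC.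
by move=> k; exact: measurableC.
Qed.

HB.instance Definition _ := isAlgebraOfSets.Build default_measure_display loeb
  loeb_measurable0 loeb_measurableU loeb_measurableC.

Context {R : realType} (Q : nat -> probability T R).

(** An internal set has many representing sequences; one is chosen here, and [loeb_contentE] shows
    that the content does not depend on the choice. *)
Definition internal_repr (A : set loeb) : nat -> set T :=
  xget (fun=> set0) [set a | (forall k, measurable (a k)) /\ A = internal a].

Lemma internal_repr_measurable A k : measurable (internal_repr A k).
Proof. by rewrite /internal_repr; case: xgetP => // a _ []. Qed.

Lemma internal_rep a : (forall k, measurable (a k)) ->
  internal (internal_repr (internal a)) = internal a.
Proof.
move=> ma; rewrite /internal_repr; case: xgetP => [b _ []//|H].
by exfalso; apply: (H a).
Qed.

Definition coord_prob (a : nat -> set T) (k : nat) : R := fine (Q k (a k)).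

Lemma coord_prob_ge0 a k : 0 <= coord_prob a k.
Proof. exact: fine_ge0. Qed.

Lemma coord_prob_norm a k : measurable (a k) -> `|coord_prob a k| <= 1.
Proof.
move=> mak; rewrite ger0_norm ?coord_prob_ge0// /coord_prob -lee_fin fineK
  ?fin_num_measure//.
exact: probability_le1.
Qed.

Definition loeb_content (A : set loeb) : \bar R :=
  (ulim U (coord_prob (internal_repr A)))%:E.

Lemma loeb_contentE a : (forall k, measurable (a k)) ->
  loeb_content (internal a) = (ulim U (coord_prob a))%:E.
Proof.
move=> ma; congr EFin.
have mr k := internal_repr_measurable (internal a) k.
have sub b c : (forall k, measurable (b k)) -> (forall k, measurable (c k)) ->
    internal b = internal c -> ulim U (coord_prob b) <= ulim U (coord_prob c).
  move=> mb mc bc; apply: (@ulim_le _ _ _ _ _ 1 1) => [k|k|].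
  - exact: coord_prob_norm.
  - exact: coord_prob_norm.
  - have : internal b `<=` internal c by rewrite bc.
    move=> /internal_sub; apply: filterS => k bk /=.
    rewrite /coord_prob fine_le ?fin_num_measure// le_measure// inE//.
by apply: le_anti; rewrite !sub ?internal_rep.
Qed.

Lemma loeb_content_ge0 A : (0 <= loeb_content A)%E.
Proof.
rewrite lee_fin -(@ulim_cst R U _ 0); apply: (@ulim_le _ _ _ _ _ 0 1).
- by move=> k; rewrite normr0.
- by move=> k; apply: coord_prob_norm; exact: internal_repr_measurable.
- by apply: filterE => k; exact: coord_prob_ge0.
Qed.

Lemma loeb_content_semi_additive : measure_function.semi_additive loeb_content.
Proof.
apply/additive2P.
  rewrite -internal0 loeb_contentE// (_ : coord_prob _ = fun=> 0) ?ulim_cst//.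
  by apply/funext => k; rewrite /coord_prob measure0.
move=> _ _ [a ma ->] [b mb ->] ab0.
rewrite -internalU !loeb_contentE//; last by move=> k; exact: measurableU.
rewrite -EFinD; congr EFin; rewrite -(@ulimD _ _ _ _ _ 1 1); last 2 first.
- by move=> k; exact: coord_prob_norm.
- by move=> k; exact: coord_prob_norm.
(* Disjointness of the internal sets only gives disjointness of the coordinates for U-many indices,
   which is all an ultralimit sees. *)
have Uab : U [set k | a k `&` b k `<=` set0].
  by apply: (@internal_sub _ (fun=> set0)); rewrite internalI ab0 internal0.
have UE : U [set k | coord_prob (fun k =>
  a k `|` b k) k = coord_prob a k + coord_prob b k].
  apply: filterS Uab => k abk /=; rewrite /coord_prob -fineD ?fin_num_measure//.
  by rewrite measureU//; apply/seteqP; split.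
have n2 k : `|coord_prob a k + coord_prob b k| <= 2.
  by rewrite (le_trans (ler_normD _ _))// (@natrD _ 1 1) lerD// coord_prob_norm.
have n1 k : `|coord_prob (fun k => a k `|` b k) k| <= 1.
  by apply: coord_prob_norm; exact: measurableU.
by apply: le_anti; apply/andP; split;
  [apply: (ulim_le UU n1 n2)|apply: (ulim_le UU n2 n1)];
  apply: filterS UE => k /= ->.
Qed.

HB.instance Definition _ := isContent.Build _ loeb R loeb_content
  loeb_content_ge0 loeb_content_semi_additive.

Hypothesis Uoo : \oo `<=` U.

(** A point of the last nonempty set of index at most K lies in all earlier ones. *)
Lemma decreasing_pick (E : nat -> set T) K :
  (forall i, E i.+1 `<=` E i) ->
  exists x, forall i, (i <= K)%N -> E i !=set0 -> E i x.
Proof.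
move=> dE; elim: K => [|K [x xP]].
  have [[x Ex]|E0] := pselect (E 0%N !=set0).
    by exists x => i; rewrite leqn0 => /eqP ->.
  by exists point => i; rewrite leqn0 => /eqP ->.
have [[y Ey]|E0] := pselect (E K.+1 !=set0).
  exists y => i iK _; move: Ey; rewrite -(subnK iK).
  elim: (_ - _)%N => [//|m IH]; rewrite addSn => Ey; apply: IH.
  exact: dE.
exists x => i; rewrite leq_eqVlt => /predU1P[->//|]; rewrite ltnS.
exact: xP.
Qed.

(* Countable saturation of the ultraproduct. *)
Lemma internal_saturated (E : nat -> nat -> set T) :
  (forall i k, E i.+1 k `<=` E i k) ->
  (forall i, internal (E i) !=set0) -> exists w, forall i, internal (E i) w.
Proof.
move=> dE E0.
have /choice[w wP] : forall k, exists x,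
    forall i, (i <= k)%N -> E i k !=set0 -> E i k x.
  by move=> k; apply: (@decreasing_pick (E ^~ k)) => i; exact: dE.
exists w => i; have [v vE] := E0 i.
have : U [set k | (i <= k)%N] by apply: Uoo; exact: nbhs_infty_ge.
by move=> Ui; apply: filterS (filterI Ui vE) => k [ik vk]; apply: wP => //;
  exists (v k).
Qed.

(** A countable cover of an internal set by internal sets has a finite subcover: otherwise the
    decreasing remainders are nonempty and saturation yields an uncovered point. Countable
    subadditivity is thus finite subadditivity. *)
Lemma loeb_content_sigma_subadditive :
  measurable_subset_sigma_subadditive loeb_content.
Proof.
move=> A F mF mA AF.
have [N AN] : exists N, A `<=` \big[setU/set0]_(i < N) F i.
  apply: contrapT => nN; case: mA => a ma AE.
  have /choice[f fP] : forall i, exists f, (forall k,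
    measurable (f k)) /\ F i = internal f.
    by move=> i; have [f mf fE] := mF i; exists f.
  pose E i k := a k `\` \big[setU/set0]_(j < i) f j k.
  have EE i : internal (E i) = A `\` \big[setU/set0]_(j < i) F j.
    elim: i => [|i IH].
      by rewrite big_ord0 setD0 AE; congr internal; apply/funext => k;
        rewrite /E big_ord0 setD0.
    rewrite big_ord_recr/= setDUr -IH (fP i).2 setDE -internalC.
    have -> : E i.+1 = fun k => E i k `&` (a k `&` ~` f i k).
      by apply/funext => k; rewrite /E big_ord_recr/= setDUr setDE.
    transitivity (internal (E i) `&` internal (fun k => a k `&` ~` f i k)).
      exact: internalI.
    by congr (_ `&` _); rewrite internalI AE.
  have [] := @internal_saturated E.
  - move=> i k x [ax nx]; split => // xf; apply: nx; rewrite big_ord_recr/=.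
    by left.
  - move=> i; rewrite EE; apply: contrapT => E0; apply: nN; exists i => w Aw.
    by apply: contrapT => nF; apply: E0; exists w.
  move=> w wE; have Aw : A w by have := wE 0%N; rewrite EE => -[].
  have [i _ Fi] := AF w Aw; have := wE i.+1; rewrite EE => -[_]; apply.
  by rewrite big_ord_recr/=; right.
apply: (@le_trans _ _ (\sum_(i < N) loeb_content (F i))%E).
  by apply: content_subadditive.
rewrite -(big_mkord xpredT (fun i => loeb_content (F i))).
by apply: nneseries_lim_ge => // k _ _; exact: loeb_content_ge0.
Qed.

HB.instance Definition _ := Content_SigmaSubAdditive_isMeasure.Build _ R loeb
  loeb_content loeb_content_sigma_subadditive.

Definition loeb_sigma := g_sigma_algebraType loeb_measurable.

Definition loeb_measure : {measure set loeb_sigma -> \bar R} :=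
  measure_extension loeb_content.

Lemma loeb_measureE a : (forall k, measurable (a k)) ->
  loeb_measure (internal a) = (ulim U (coord_prob a))%:E.
Proof.
move=> ma; rewrite /loeb_measure /= /measure_extension measurable_mu_extE.
  exact: loeb_contentE.
by exists a.
Qed.

Lemma internal_measurable a : (forall k, measurable (a k)) ->
  measurable (internal a : set loeb_sigma).
Proof. by move=> ma; apply: sub_sigma_algebra; exists a. Qed.

End loeb.

(** * The standard part map and weak limits of laws *)

Section weak_compactness.
Context {R : realType} {n : nat} (Xi : set 'cV[R]_n) (cXi : compact Xi).
Variables (xi0 : 'cV[R]_n) (Xi0 : Xi xi0).
Context (U : set_system nat) (UU : UltraFilter U) (Uoo : \oo `<=` U).
Variable Q : nat -> probability (Rvec R n) R.
Hypothesis QXi : forall k, Q k Xi = 1%E.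

Local Notation Omega := (@loeb _ (Rvec R n) U UU).
Local Notation Sigma := (@loeb_sigma _ (Rvec R n) U UU).
Local Notation int := (@internal _ (Rvec R n) U UU).
Local Notation L := (@loeb_measure _ _ _ UU R Q Uoo).

Let mXi : measurable (Xi : set (Rvec R n)). Proof. exact:
  compact_Rvec_measurable. Qed.

(** The fallback [xi0], used off the internal set of Xi, makes the map take values in Xi
    everywhere. *)
Definition standard_part (w : Sigma) : Rvec R n :=
  if pselect (int (fun=> Xi) w) then lim ((w : nat -> 'cV[R]_n) @ U) else xi0.

Lemma standard_part_cvg (w : Sigma) : int (fun=> Xi) w ->
  (w : nat -> 'cV[R]_n) @ U --> (standard_part w : 'cV[R]_n).
Proof.
move=> wXi; rewrite /standard_part; case: pselect => [?|//] /=.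
have [p _ wp] := @ultra_compact_cvg U UU 'cV[R]_n Xi w cXi wXi.
by rewrite (cvg_lim _ wp).
Qed.

Lemma standard_part_in (w : Sigma) : Xi (standard_part w).
Proof.
rewrite /standard_part; case: pselect => [wXi|//] /=.
have [p Xip wp] := @ultra_compact_cvg U UU 'cV[R]_n Xi w cXi wXi.
by rewrite (cvg_lim _ wp).
Qed.

(** With K j the closed set of points whose ball of radius 1/(j+1) lies in G, the limit of w is in G
    exactly when, for some j, w k lies in K j for U-many k. The preimage is thus a countable union
    of internal sets, up to the fallback value. *)
Lemma measurable_standard_part : measurable_fun setT standard_part.
Proof.
apply: (@measurability _ _ Sigma (Rvec R n) setT standard_part (@open
  'cV[R]_n)) => //.
move=> _ [G oG <-]; rewrite setTI.
pose K (j : nat) : set 'cV[R]_n := [set x | ball x j.+1%:R^-1 `<=` G].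
have cK j : closed (K j).
  move=> x clx y; rewrite -ball_normE /= => xy.
  pose e := j.+1%:R^-1 - `|x - y|.
  have e0 : 0 < e by rewrite subr_gt0.
  have [z [Kz]] := clx _ (nbhsx_ballx x e e0).
  rewrite -ball_normE /= => xz; apply: Kz; rewrite -ball_normE /=.
  rewrite (_ : z - y = (z - x) + (x - y)); last by rewrite addrA subrK.
  rewrite (le_lt_trans (ler_normD _ _))// distrC.
  by rewrite -ltrBrDr.
have mK j : measurable (int (fun=> (K j : set (Rvec R n))) : set Sigma).
  by apply: internal_measurable => k; exact: closed_Rvec_measurable.
have mX : measurable (int (fun=> (Xi : set (Rvec R n))) : set Sigma).
  by apply: internal_measurable.
have -> : standard_part @^-1` G =
    (int (fun=> Xi) `&` \bigcup_j int (fun=> K j)) `|`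
    (~` int (fun=> Xi) `&` (if `[< G xi0 >] then setT else set0)).
  apply/seteqP; split => w /=.
    move=> Gw; have [wXi|wXi] := pselect (int (fun=> Xi) w).
      left; split => //.
      have /nbhs_ballP [e /= e0 eO] : nbhs (standard_part w : 'cV[R]_n) G.
        exact: open_nbhs_nbhs.
      have [j je] : exists j, j.+1%:R^-1 < e / 2.
        have /ltr_add_invr[j] : 0 < e / 2 by rewrite divr_gt0.
        by rewrite add0r => ?; exists j.
      exists j => //; rewrite /internal /=.
      have := standard_part_cvg wXi.
      move=> /(_ _ (nbhsx_ballx _ (e / 2) _)) /=.
      rewrite divr_gt0// => /(_ isT); apply: filterS => k /= wk y wky;
        apply: eO.
      rewrite (splitr e); apply: (ball_triangle wk).
      by apply: le_ball wky; exact: ltW.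
    right; split => //; move: Gw; rewrite /standard_part;
      case: pselect => [//|?] /= Gx.
    by rewrite asboolT.
  case=> [[wXi [j _ Kj]]|[wXi]].
    have := @closed_cvg _ _ U _ (w : nat -> 'cV[R]_n) (K j) (cK j) Kj _
      (standard_part_cvg wXi).
    by apply; apply: ballxx; rewrite invr_gt0.
  case: asboolP => // Gx _; rewrite /standard_part;
    case: pselect => [wXi'|//] /=.
  by have := wXi wXi'.
apply: measurableU; apply: measurableI => //.
- by apply: bigcup_measurable.
- exact: measurableC.
- by case: asboolP.
Qed.


Lemma loeb_measureT : L setT = 1%E.
Proof.
rewrite -(@internalT _ (Rvec R n) U UU) loeb_measureE// (_ : coord_prob _ _ =
  fun=> 1).
  by rewrite ulim_cst.
by apply/funext => k; rewrite /coord_prob probability_setT.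
Qed.

Definition standard_part_law : probability (Rvec R n) R :=
  distribution (probability_of loeb_measureT : probability _ _)
    (mfun_Sub (mem_set measurable_standard_part) : {mfun Sigma >-> Rvec R n}).

Lemma standard_part_law_on : standard_part_law Xi = 1%E.
Proof.
have -> : standard_part_law Xi = L (standard_part @^-1` Xi) by [].
rewrite (_ : _ @^-1` _ = setT) ?loeb_measureT//.
by apply/seteqP; split => // w _; exact: standard_part_in.
Qed.


(* The image of the Loeb measure under the standard part is a weak limit of the
   Q k along U, since nearby points of Xi lie in the same cell. *)
Lemma standard_part_law_integral_le (h : 'cV[R]_n -> R) (lip b : R) :
  0 <= lip -> continuous h ->
  (forall x y, Xi x -> Xi y -> `|h x - h y| <= lip * enorm (x - y)) ->
  (forall e : R, 0 < e -> \forall k \near \oo,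
    \int[Q k]_(x in Xi) h x <= b + e) ->
  \int[standard_part_law]_(x in Xi) h x <= b.
Proof.
move=> lip0 ch hlip hb; apply/ler_addgt0Pr => e e0.
(* Three losses: cells under the Loeb measure, cells under Q k, and the slack in the assumed
   bound. *)
pose eta : R := e / 3; have eta0 : 0 < eta by rewrite divr_gt0.
pose delta : R := eta / (lip + 1).
have l1 : 0 < lip + 1 by rewrite ltr_wpDl.
have d0 : 0 < delta by rewrite divr_gt0.
have lipd : lip * delta <= eta.
  by rewrite /delta mulrCA ler_piMr ?(ltW eta0)// ler_pdivrMr// mul1r lerDl.
have [m [kappa [c [mk cX kc]]]] := compact_cells cXi (ex_intro _ xi0 Xi0) d0.
have hcell x : Xi x -> `|h x - h (c (kappa x))| <= eta.
  move=> Xx; apply: (le_trans (hlip _ _ Xx (cX _))); apply: le_trans lipd.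
  by rewrite ler_wpM2l// kc.
have mh : measurable_fun setT (h : Rvec R n -> R).
  exact: continuous_Rvec_measurable.
have bh : exists B : R, forall x, Xi x -> `|h x| <= B.
  exists (`|h xi0| + \sum_i `|h (c i) - h xi0| + eta) => x Xx.
  have H1 := hcell x Xx.
  have H2 : `|h (c (kappa x)) - h xi0| <= \sum_i `|h (c i) - h xi0|.
    by rewrite (bigD1 (kappa x))//= lerDl sumr_ge0.
  have -> : h x = h xi0 + (h (c (kappa x)) - h xi0) + (h x - h (c (kappa x))).
    by ring.
  rewrite (le_trans (ler_normD _ _))// lerD//.
  by rewrite (le_trans (ler_normD _ _))// lerD.
have [B hB] := bh.
have bmh : @bmeas _ (Rvec R n) R Xi h.
  by split; [exact: measurable_funS mh|exists B].
pose D : set Sigma := int (fun=> Xi).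
have mD : measurable D by apply: internal_measurable.
pose P : probability Sigma R := probability_of loeb_measureT.
have PE (a : nat -> set (Rvec R n)) : (forall k, measurable (a k)) ->
    P (int a) = (ulim U (coord_prob Q a))%:E.
  by move=> ma; rewrite -loeb_measureE.
have PD : P D = 1%E.
  rewrite PE// (_ : coord_prob _ _ = fun=> 1) ?ulim_cst//.
  by apply/funext => k; rewrite /coord_prob QXi.
have PDc : P (~` D) = 0%E by rewrite probability_setC// PD subee.
have hX w : `|h (standard_part w)| <= B by apply/hB/standard_part_in.
have mhX : measurable_fun setT (fun w : Sigma => h (standard_part w)).
  exact: (measurableT_comp mh measurable_standard_part).
have bhX : bmeas D (fun w : Sigma => h (standard_part w)).
  by split; [exact: measurable_funS mhX|exists B].
have EE : \int[standard_part_law]_(x in Xi) h x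
    = \int[P]_(w in D) h (standard_part w).
  apply: EFin_inj.
  have lawC : standard_part_law (~` Xi) = 0%E.
    by rewrite probability_setC// standard_part_law_on subee.
  have [_ <-] := integral_full mXi lawC mh bmh.
  have [iX <-] := integral_full mD PDc mhX bhX.
  by rewrite integral_distribution//; exact/measurable_EFinP.
(* There are finitely many cells, so the ultrafilter selects one that contains w k for U-many k. *)
have /choice[kap kapP] : forall w : Sigma, exists i,
    int (fun=> kappa @^-1` [set i]) w.
  move=> w; apply: contrapT => nw.
  have H (i : 'I_m.+1) : U [set k | kappa (w k) <> i].
    have [Ui|//] := in_ultra_setVsetC [set k | kappa (w k) = i] UU.
    by exfalso; apply: nw; exists i.
  have UF : U [set k | forall i, kappa (w k) <> i] by exact: filter_forall.
  have [k /(_ (kappa (w k)))] := filter_ex UF.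
  by [].
have kapE i : kap @^-1` [set i] = int (fun=> kappa @^-1` [set i]).
  apply/seteqP; split => w /= H; first by rewrite -H; exact: kapP.
  have [k [/= <- <-]] := filter_ex (filterI (kapP w) H).
  by [].
have mkap i : measurable (kap @^-1` [set i]).
  by rewrite kapE; apply: internal_measurable.
have kapD w : D w -> `|h (standard_part w) - h (c (kap w))| <= eta.
  move=> Dw; pose y (k : nat) : R := `|h (w k) - h (c (kap w))|.
  apply: (@closed_cvg _ _ U _ y (fun t => t <= eta) (@closed_le R eta)).
    apply: filterS (filterI Dw (kapP w)) => k [/= Xk kk].
    by rewrite /y -kk; exact: hcell.
  apply: cvg_norm; apply: cvgB; last exact: cvg_cst.
  apply: (@cvg_comp _ _ _ (w : nat ->
    'cV[R]_n) h U (nbhs (standard_part w : 'cV[R]_n))).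
    exact: standard_part_cvg.
  exact: ch.
have HP : `|\int[P]_(w in D) h (standard_part w)
    - \sum_i h (c i) * fine (P (kap @^-1` [set i] `&` D))| <= eta * fine (P D)
  := integral_cells mD P (c := fun i => h (c i)) mkap bhX kapD.
rewrite PD /= mulr1 -EE in HP.
pose a i (k : nat) : set (Rvec R n) := (kappa @^-1` [set i]) `&` Xi.
have ma i k : measurable (a i k) by exact: measurableI.
have PaE i : fine (P (kap @^-1` [set i] `&` D)) = ulim U (coord_prob Q (a i)).
  have -> : kap @^-1` [set i] `&` D = int (a i) by rewrite kapE -internalI.
  by rewrite PE.
have HQ k : \sum_i h (c i) * coord_prob Q (a i) k
  <= \int[Q k]_(x in Xi) h x + eta.
  have H : `|\int[Q k]_(x in Xi) h x - \sum_i h (c i) * coord_prob Q (a i) k|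
      <= eta * fine (Q k Xi)
    := integral_cells mXi (Q k) (c := fun i => h (c i)) mk bmh hcell.
  by move: H; rewrite QXi mulr1 ler_norml; lra.
have nS i k : `|h (c i) * coord_prob Q (a i) k| <= B.
  rewrite normrM (le_trans (ler_piMr _ (coord_prob_norm Q (ma i k))))//.
  exact: hB.
have SE : \sum_i h (c i) * fine (P (kap @^-1` [set i] `&` D))
    = ulim U (fun k => \sum_i h (c i) * coord_prob Q (a i) k).
  rewrite (ulim_sum UU _ nS).
  apply: eq_bigr => i _; rewrite PaE (ulimZ UU _ (b := 1))// => k.
  exact: coord_prob_norm.
have : ulim U (fun k => \sum_i h (c i) * coord_prob Q (a i) k) <= b + eta + eta.
  rewrite -(@ulim_cst R U UU (b + eta + eta)).
  apply: (ulim_le UU (b := \sum_(i < m.+1) B) (c :=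
    `|b + eta + eta|)) => [k|//|].
    by apply: (le_trans (ler_norm_sum _ _ _)); apply: ler_sum => i _; exact: nS.
  by apply: filterS (Uoo (hb _ eta0)) => k /= Hk; have := HQ k; lra.
rewrite -SE; move: HP; rewrite ler_norml /eta; lra.
Qed.

End weak_compactness.

(** Upper bounds are all that is asked of the limit; lower bounds follow by applying this to -h. The
    ultrafilter extends the cofinite filter, so that bounds valid for all large k are seen by it. *)
Lemma weak_compactness {R : realType} {n : nat} (Xi : set 'cV[R]_n)
    (Q : nat -> probability (Rvec R n) R) :
  compact Xi -> Xi !=set0 -> (forall k, Q k Xi = 1%E) ->
  exists2 Qoo : probability (Rvec R n) R, Qoo Xi = 1%E &
    forall (h : 'cV[R]_n -> R) (lip b : R), 0 <= lip -> continuous h ->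
    (forall x y, Xi x -> Xi y -> `|h x - h y| <= lip * enorm (x - y)) ->
    (forall e : R, 0 < e -> \forall k \near \oo,
      \int[Q k]_(x in Xi) h x <= b + e) ->
    \int[Qoo]_(x in Xi) h x <= b.
Proof.
move=> cXi [xi0 Xi0] QXi.
have [U [UU Uoo]] := ultraFilterLemma (@eventually_filter).
exists (standard_part_law cXi xi0 UU Uoo Q).
  exact: standard_part_law_on.
exact: standard_part_law_integral_le.
Qed.

(** * The distributionally robust problem *)

Section max_ord.
Context {R : realType} (J : nat) (J0 : (0 < J)%N).

Lemma max_ord_ge (f : 'I_J -> R) j : f j <= max_ord J0 f.
Proof. exact: (le_bigmax _ f). Qed.

Lemma max_ord_le (f : 'I_J -> R) c : (forall j, f j <= c) -> max_ord J0 f <= c.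
Proof. by move=> fc; apply: bigmax_le. Qed.

Lemma max_ord_dist (f g : 'I_J -> R) c : (forall j, `|f j - g j| <= c) ->
  `|max_ord J0 f - max_ord J0 g| <= c.
Proof.
move=> fgc; rewrite ler_norml; apply/andP; split.
  rewrite lerBrDr addrC lerBlDr; apply: max_ord_le => j.
  have := fgc j; have := max_ord_ge f j; rewrite ler_norml; lra.
rewrite lerBlDr; apply: max_ord_le => j.
by have := fgc j; have := max_ord_ge g j; rewrite ler_norml; lra.
Qed.

(** The hypothesis of the vector contraction; it holds because the sup norm is below the Euclidean
    one. *)
Lemma max_ord_dist_sqrt (f g : 'I_J -> R) :
  `|max_ord J0 f - max_ord J0 g| <= Num.sqrt (\sum_j (f j - g j) ^+ 2).
Proof.
apply: max_ord_dist => j; rewrite -sqrtr_sqr ler_sqrt; last first.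
  by apply: sumr_ge0 => k _; exact: sqr_ge0.
by rewrite (bigD1 j)//= lerDl sumr_ge0// => k _; exact: sqr_ge0.
Qed.

End max_ord.

Section dro_facts.
Context {R : realType} (D : dro R).

Local Notation X := (Xset D).
Local Notation Xi := (Xiset D).
Local Notation Law := (probability (Rvec R (dxi D)) R).

Definition loss_block (j : 'I_(nJ D)) : 'M[R]_(dx D + 1, dxi D + 1) :=
  block_mx (A_ j)^T (b_ j) (abar_ j)^T (bbar_ j)%:M.

Definition rho_x : R := Num.sqrt (Rx D ^+ 2 + 1).
Definition rho_xi : R := Num.sqrt (Rxi D ^+ 2 + 1).
Definition opmax : R := max_ord (J_gt0 D) (fun j => opnorm (loss_block j)).

Lemma loss_radiusE : loss_radius D = opmax * rho_xi * rho_x.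
Proof. by []. Qed.

Lemma opmax_ge0 : 0 <= opmax.
Proof.
exact: (le_trans (opnorm_ge0 _) (max_ord_ge _ _ (Ordinal (J_gt0 D)))).
Qed.

Lemma loss_homog x xi : loss D x xi =
  max_ord (J_gt0 D) (fun j => dotv (homog x) (loss_block j *m homog xi)).
Proof.
by congr max_ord; apply/funext => j; exact: affine_homog.
Qed.

Lemma loss_block_bound j u v :
  `|dotv u (loss_block j *m v)| <= opmax * enorm u * enorm v.
Proof.
apply: (le_trans (cauchy_schwarz_norm _ _)).
rewrite (mulrC opmax) -mulrA ler_wpM2l ?enorm_ge0//.
apply: (le_trans (opnormP _ _)); rewrite ler_wpM2r ?enorm_ge0//.
exact: (max_ord_ge _ (fun j => opnorm (loss_block j))).
Qed.

Lemma loss_lip_xi x xi xi' :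
  `|loss D x xi - loss D x xi'| <= opmax * enorm (homog x) * enorm (xi - xi').
Proof.
rewrite !loss_homog; apply: max_ord_dist => j.
rewrite -dotvNr -dotvDr -mulmxN -mulmxDr -homogB.
exact: loss_block_bound.
Qed.

Definition lip_x : R := opmax * rho_xi.

Lemma lip_x_ge0 : 0 <= lip_x.
Proof. by rewrite mulr_ge0 ?opmax_ge0 ?sqrtr_ge0. Qed.

Lemma loss_lip_x x y xi : Xi xi ->
  `|loss D x xi - loss D y xi| <= lip_x * enorm (x - y).
Proof.
move=> Xixi; rewrite !loss_homog; apply: max_ord_dist => j.
rewrite -dotvNl -dotvDl -homogB /lip_x mulrAC.
apply: (le_trans (loss_block_bound _ _ _)).
rewrite ler_wpM2l ?mulr_ge0 ?opmax_ge0 ?enorm_ge0//.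
by apply: enorm_homog_le; exact: Xiset_bounded.
Qed.

Lemma continuous_loss x : continuous (loss D x).
Proof. exact: lipschitz_continuous (loss_lip_xi x). Qed.

Lemma continuous_enorm n : continuous (@enorm R n).
Proof.
apply: (@lipschitz_continuous _ _ _ 1) => x y.
by rewrite mul1r enorm_dist.
Qed.

Definition sqnorm (xi : 'cV[R]_(dxi D)) : R := enorm xi ^+ 2.

Lemma continuous_sqnorm : continuous sqnorm.
Proof.
move=> x; apply: (@continuous_comp _ _ _ (@enorm R _) (fun u : R => u ^+ 2)).
  exact: continuous_enorm.
exact: exprn_continuous.
Qed.

Lemma sqnorm_lip x y : Xi x -> Xi y ->
  `|sqnorm x - sqnorm y| <= (Rxi D + Rxi D) * enorm (x - y).
Proof.
move=> Xx Xy; rewrite /sqnorm subr_sqr normrM mulrC ler_pM ?enorm_dist//.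
by rewrite ger0_norm ?addr_ge0 ?enorm_ge0// lerD// Xiset_bounded.
Qed.

Lemma measurable_Xi : measurable (Xi : set (Rvec R (dxi D))).
Proof. apply: compact_Rvec_measurable; exact: Xiset_compact. Qed.

Lemma measurable_X : measurable (X : set (Rvec R (dx D))).
Proof. apply: compact_Rvec_measurable; exact: Xset_compact. Qed.

Lemma distr_on_neq0 n (S : set 'cV[R]_n) (Q : probability (Rvec R n) R) :
  distr_on S Q -> S !=set0.
Proof.
move=> QS; apply/set0P/eqP => S0; move: QS; rewrite /distr_on /= S0 measure0.
by move=> /esym/eqP; rewrite onee_eq0.
Qed.

Lemma X_neq0 : X !=set0.
Proof. exact: distr_on_neq0 (Z_on_X D). Qed.

Lemma Xi_neq0 : Xi !=set0.
Proof. exact: distr_on_neq0 (Phat_on_Xi D). Qed.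

Lemma Rxi_ge0 : 0 <= Rxi D.
Proof.
by have [x /Xiset_bounded] := Xi_neq0; apply: le_trans; exact: enorm_ge0.
Qed.

Lemma continuous_bmeas f : continuous f -> @bmeas _ (Rvec R (dxi D)) R Xi f.
Proof.
move=> cf; split.
  by apply: measurable_funS (continuous_Rvec_measurable cf).
have cX := Xiset_compact (d := D).
have [c cXi cmax] := compact_EVT_max Xi_neq0 cX (continuous_subspaceT cf).
have [e eXi emin] := compact_EVT_min Xi_neq0 cX (continuous_subspaceT cf).
exists (`|f c| + `|f e|) => x Xx.
have fx1 := cmax x (mem_set Xx); have fx2 := emin x (mem_set Xx).
have := ler_norm (f c); have := ler_norm (- f e); rewrite normrN.
rewrite ler_norml; have := normr_ge0 (f c); have := normr_ge0 (f e).
by move: fx1 fx2; lra.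
Qed.

Lemma expectE (Q : Law) f : distr_on Xi Q -> continuous f ->
  ('E_Q[f] = (\int[Q]_(x in Xi) f x)%:E)%E.
Proof.
move=> QXi cf; rewrite unlock.
have QC : Q (~` Xi) = 0%E.
  by rewrite probability_setC ?QXi ?subee//; exact: measurable_Xi.
have [_ ->//] := integral_full measurable_Xi QC
  (continuous_Rvec_measurable cf) (continuous_bmeas cf).
Qed.

Lemma expect_int (Q : Law) f : distr_on Xi Q -> continuous f ->
  expect Q f = \int[Q]_(x in Xi) f x.
Proof. by move=> QXi cf; rewrite /expect expectE. Qed.

Lemma second_momentE (Q : Law) : distr_on Xi Q ->
  second_moment Q = (expect Q sqnorm)%:E.
Proof.
move=> QXi; rewrite /second_moment expectE//; last exact: continuous_sqnorm.
by rewrite expect_int//; exact: continuous_sqnorm.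
Qed.

Lemma continuousZ_fun (a : R) (f : 'cV[R]_(dxi D) -> R) : continuous f ->
  continuous (fun x => a * f x).
Proof.
move=> cf x; apply: (@continuous_comp _ _ _ f ( *%R a)); first exact: cf.
exact: mulrl_continuous.
Qed.

Lemma continuousD_fun (f g : 'cV[R]_(dxi D) -> R) : continuous f ->
  continuous g -> continuous (fun x => f x + g x).
Proof. by move=> cf cg x; apply: (@continuousD R R _ f g x);
  [exact: cf|exact: cg]. Qed.

Lemma expectD (Q : Law) (f g : 'cV[R]_(dxi D) -> R) : distr_on Xi Q ->
  continuous f -> continuous g ->
  expect Q (fun x => f x + g x) = expect Q f + expect Q g.
Proof.
move=> QXi cf cg; rewrite !expect_int//; last exact: continuousD_fun.
by rewrite bmeas_integralD//; [exact: measurable_Xi|exact: continuous_bmeas..].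
Qed.

Lemma expectZ (Q : Law) (a : R) (f : 'cV[R]_(dxi D) -> R) : distr_on Xi Q ->
  continuous f ->
  expect Q (fun x => a * f x) = a * expect Q f.
Proof.
move=> QXi cf; rewrite !expect_int//; last exact: continuousZ_fun.
by rewrite bmeas_integralZ//; [exact: measurable_Xi|exact: continuous_bmeas].
Qed.

Lemma expect_cst (Q : Law) (a : R) : distr_on Xi Q -> expect Q (fun=> a) = a.
Proof.
move=> QXi; rewrite expect_int//; last exact: cst_continuous.
rewrite Rintegral_cst; last exact: measurable_Xi.
by rewrite /= QXi mulr1.
Qed.

Lemma expect_le (Q : Law) (f g : 'cV[R]_(dxi D) -> R) : distr_on Xi Q ->
  continuous f -> continuous g ->
  (forall x, Xi x -> f x <= g x) -> expect Q f <= expect Q g.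
Proof.
move=> QXi cf cg fg; rewrite !expect_int//.
by apply: bmeas_integral_le => //;
  [exact: measurable_Xi|exact: continuous_bmeas..].
Qed.

Lemma expect_sum (Q : Law) (I : Type) (r : seq I) (f : I -> 'cV[R]_(dxi D) ->
  R) :
  distr_on Xi Q -> (forall i, continuous (f i)) ->
  continuous (fun x => \sum_(i <- r) f i x) /\
  expect Q (fun x => \sum_(i <- r) f i x) = \sum_(i <- r) expect Q (f i).
Proof.
move=> QXi cf; elim: r => [|i r [IHc IHe]].
  under eq_fun do rewrite big_nil.
  rewrite big_nil expect_cst//; split => //; exact: cst_continuous.
under eq_fun do rewrite big_cons.
rewrite big_cons expectD// IHe; split => //.
exact: continuousD_fun.
Qed.

Definition eloss (Q : Law) (x : 'cV[R]_(dx D)) : R := expect Q (loss D x).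

Lemma eloss_lip Q x y : distr_on Xi Q ->
  `|eloss Q x - eloss Q y| <= lip_x * enorm (x - y).
Proof.
move=> QXi.
have H u v : eloss Q u <= eloss Q v + lip_x * enorm (u - v).
  rewrite /eloss -[X in _ + X](expect_cst _ QXi) -expectD//.
  - apply: expect_le => // [||xi Xixi].
    + exact: continuous_loss.
    + apply: continuousD_fun; first exact: continuous_loss.
      exact: cst_continuous.
    + by have := loss_lip_x u v Xixi; rewrite ler_norml; lra.
  - exact: continuous_loss.
  - exact: cst_continuous.
have := H x y; have := H y x; rewrite (enormB y x) ler_norml; lra.
Qed.

Lemma Omega_gt0 : 0 < Omega D.
Proof.
have := Phat_moment D; rewrite second_momentE; last exact: Phat_on_Xi.
rewrite lte_fin; apply: le_lt_trans.
rewrite -(expect_cst 0 (Phat_on_Xi D)); apply: expect_le => //.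
- exact: Phat_on_Xi.
- exact: cst_continuous.
- exact: continuous_sqnorm.
- by move=> xi _; exact: sqr_ge0.
Qed.

Lemma eloss_bound Q x : distr_on Xi Q -> (second_moment Q <= (Omega D)%:E)%E ->
  X x -> `|eloss Q x| <= c1 D + c2 D * Num.sqrt (Omega D).
Proof.
move=> QXi; rewrite second_momentE// lee_fin => Qm Xx.
have s0 : 0 < Num.sqrt (Omega D) by rewrite sqrtr_gt0 Omega_gt0.
set s := Num.sqrt (Omega D) in s0 *.
have ss : s ^+ 2 = Omega D by rewrite sqr_sqrtr// ltW// Omega_gt0.
(* Jensen's inequality for the norm is replaced by |xi| <= (s + |xi|^2 / s) / 2 with s = sqrt Omega.
   It loses nothing here, since b + a Omega = c1 + c2 s. *)
pose a := c2 D / (2 * s); pose b := c1 D + c2 D * s / 2.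
have a0 : 0 <= a by rewrite divr_ge0 ?c2_ge0// mulr_ge0// ltW.
have cb : continuous (fun xi => b + a * sqnorm xi).
  apply: continuousD_fun; first exact: cst_continuous.
  exact/continuousZ_fun/continuous_sqnorm.
have Eb : expect Q (fun xi => b + a * sqnorm xi) <= c1 D + c2 D * s.
  rewrite expectD//; last 2 first.
  - exact: cst_continuous.
  - exact/continuousZ_fun/continuous_sqnorm.
  rewrite expect_cst// expectZ//; last exact: continuous_sqnorm.
  apply: (@le_trans _ _ (b + a * Omega D)); first by rewrite lerD2l ler_wpM2l.
  rewrite -ss /a /b le_eqVlt; apply/orP; left; apply/eqP.
  by field; rewrite gt_eqF.
have bound xi : Xi xi -> `|loss D x xi| <= b + a * sqnorm xi.
  move=> Xixi; apply: (le_trans (loss_growth Xx Xixi)).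
  rewrite /b -addrA lerD2l /a /sqnorm.
  have -> : c2 D * s / 2 + c2 D / (2 * s) * enorm xi ^+ 2
    = c2 D * ((s + enorm xi ^+ 2 / s) / 2) by field; rewrite gt_eqF.
  rewrite ler_wpM2l ?c2_ge0// ler_pdivlMr// -(ler_pM2r s0) mulrDl divfK
    ?gt_eqF//.
  by have := sqr_ge0 (s - enorm xi); lra.
rewrite ler_norml; apply/andP; split.
  rewrite lerNl; apply: le_trans Eb; rewrite -mulN1r -expectZ//;
    last exact: continuous_loss.
  apply: expect_le => // [|xi /bound].
  - exact/continuousZ_fun/continuous_loss.
  - by rewrite mulN1r ler_norml; lra.
apply: le_trans Eb; apply: expect_le => // [|xi /bound].
- exact: continuous_loss.
- by rewrite ler_norml; lra.
Qed.

Lemma pospart_dist (u v : R) : `|pospart u - pospart v| <= `|u - v|.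
Proof.
rewrite /pospart ler_norml.
by case: (leP u 0); case: (leP v 0); case: ger0P; lra.
Qed.

Lemma pospart_le0 (u : R) : (pospart u <= 0) = (u <= 0).
Proof. by rewrite /pospart ge_max lexx andbT. Qed.

Lemma pospart_ge0 (u : R) : 0 <= pospart u.
Proof. by rewrite /pospart le_max lexx orbT. Qed.

Lemma loss_excess_lip Q x y : distr_on Xi Q ->
  `|loss_excess D Q x - loss_excess D Q y| <= (2 * lip_x) * enorm (x - y).
Proof.
move=> QXi; rewrite (le_trans (pospart_dist _ _))//.
rewrite -/(eloss Q x) -/(eloss Q y) -/(eloss _ x) -/(eloss _ y).
have := eloss_lip x y QXi; have := eloss_lip x y (Phat_on_Xi D).
by rewrite !ler_norml; lra.
Qed.

Lemma continuous_loss_excess Q : distr_on Xi Q -> continuous (loss_excess D Q).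
Proof.
move=> QXi; apply: lipschitz_continuous => x y; exact: loss_excess_lip.
Qed.

(** Common form of the feasible sets: A is X for the true ambiguity set, the sample points for the
    sampled one, and empty when only the moment bound is kept. *)
Definition constr (A : set 'cV[R]_(dx D)) : set Law :=
  [set Q | [/\ distr_on Xi Q,
     forall z, A z -> eloss Q z - eloss (Phat D) z <= eps D &
     (second_moment Q <= (Omega D)%:E)%E]].

Lemma excess_le0 Q z :
  (loss_excess D Q z <= 0) = (eloss Q z - eloss (Phat D) z <= eps D).
Proof. by rewrite /loss_excess pospart_le0 subr_le0. Qed.

Lemma sampled_ambiguity_setE M (z : nat -> 'cV[R]_(dx D)) :
  sampled_ambiguity_set D M z = constr [set z m | m in [set m | (m < M)%N]].
Proof.
apply/seteqP; split => Q [QXi QM Qm]; split => //.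
  move=> _ [m /= mM <-]; rewrite -excess_le0.
  have M0 : (0 : R) < M%:R^-1 by rewrite invr_gt0 ltr0n (leq_ltn_trans _ mM).
  move: QM; rewrite pmulr_rle0//; apply: le_trans.
  rewrite (bigD1 (Ordinal mM))//= lerDl sumr_ge0// => i _.
  exact: pospart_ge0.
apply: mulr_ge0_le0; first by rewrite invr_ge0.
apply: sumr_le0 => m _; rewrite excess_le0; apply: QM.
by exists m => /=.
Qed.

Lemma excess_bmeas Q : distr_on Xi Q ->
  @bmeas _ (Rvec R (dx D)) R X (loss_excess D Q).
Proof.
move=> QXi; have cf := continuous_loss_excess QXi; split.
  by apply: measurable_funS (continuous_Rvec_measurable cf).
have [c cX cmax] := compact_EVT_max X_neq0 (Xset_compact (d :=
  D)) (continuous_subspaceT cf).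
exists (loss_excess D Q c) => x Xx; rewrite ger0_norm; last exact: pospart_ge0.
exact/cmax/mem_set.
Qed.

Lemma expectation_excess Q : distr_on Xi Q ->
  ('E_(Zlaw D)[loss_excess D Q] = (\int[Zlaw D]_(z in X) loss_excess D Q
    z)%:E)%E.
Proof.
move=> QXi; rewrite unlock.
have ZC : Zlaw D (~` X) = 0%E.
  have ZX := Z_on_X D.
  by rewrite probability_setC ?ZX ?subee//; exact: measurable_X.
have [_ ->//] := integral_full measurable_X ZC
  (continuous_Rvec_measurable (continuous_loss_excess QXi)) (excess_bmeas QXi).
Qed.

(** By continuity, an excess positive at one point of X stays above half its value on an open set,
    to which Z gives positive mass by full support. *)
Lemma ambiguity_setE : ambiguity_set D = constr X.
Proof.
apply/seteqP; split => Q [QXi QZ Qm]; split => //; last first.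
  rewrite expectation_excess// lee_fin.
  rewrite -(mul0r (fine (Zlaw D X))) -Rintegral_cst; last exact: measurable_X.
  apply: bmeas_integral_le => //.
  - exact: measurable_X.
  - exact: excess_bmeas.
  - exact: bmeas_cst.
  - by move=> z Xz; rewrite excess_le0; exact: QZ.
move=> z Xz; rewrite -excess_le0 leNgt; apply/negP => gz.
set c := loss_excess D Q z in gz *.
pose W : set 'cV[R]_(dx D) := [set y | c / 2 < loss_excess D Q y].
have oW : open W.
  have /continuousP/(_ _ (@open_gt R (c / 2))) := continuous_loss_excess QXi.
  by [].
have mW : measurable (W : set (Rvec R (dx D))) by exact: open_Rvec_measurable.
have Wz : W z by rewrite /W /= -/c; move: gz; lra.
have ZW : (0 < Zlaw D W)%E.
  by apply: (Z_full_support oW); exists z.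
have mf := continuous_Rvec_measurable (continuous_loss_excess QXi).
have := QZ; rewrite leNgt => /negP; apply.
rewrite unlock; apply: (@lt_le_trans _ _ ((c / 2)%:E * Zlaw D W)%E).
  by rewrite mule_gt0// lte_fin divr_gt0.
have -> : ((c / 2)%:E * Zlaw D W = \int[Zlaw D]_(y in W) (c / 2)%:E)%E.
  by rewrite integral_cst.
apply: (@le_trans _ _ (\int[Zlaw D]_(y in W) (loss_excess D Q y)%:E)%E).
  apply: ge0_le_integral => //.
  - by move=> y _; rewrite lee_fin divr_ge0// ltW.
  - by apply/measurable_EFinP; apply: measurable_funS mf.
  - by move=> y Wy; rewrite lee_fin ltW.
apply: ge0_subset_integral => //.
- exact/measurable_EFinP.
- by move=> y _; rewrite lee_fin; exact: pospart_ge0.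
Qed.

End dro_facts.

Arguments constr {R} D A.
Arguments eloss {R} D Q x.

(** * Regularity and stability of the worst-case expected loss *)

Section worst_case.
Context {R : realType} (D : dro R).

Local Notation X := (Xset D).
Local Notation Xi := (Xiset D).
Local Notation Law := (probability (Rvec R (dxi D)) R).

Lemma Phat_constr A : constr D A (Phat D).
Proof.
split; first exact: Phat_on_Xi.
  by move=> z _; rewrite subrr eps_ge0.
exact/ltW/Phat_moment.
Qed.

Lemma constr_sub A B : A `<=` B -> constr D B `<=` constr D A.
Proof. by move=> AB Q [QXi QB Qm]; split => // z /AB; exact: QB. Qed.

(** The growth bound is available on X only; the global Lipschitz estimate carries it to every x,
    which makes the worst case continuous on the whole space. *)
Lemma eloss_set_bounded A x :
  has_sup [set expect Q (loss D x) | Q in constr D A].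
Proof.
split; first by exists (expect (Phat D) (loss D x)); exists (Phat D) => //;
  exact: Phat_constr.
have [x0 Xx0] := X_neq0 D.
exists (c1 D + c2 D * Num.sqrt (Omega D) + lip_x D * enorm (x - x0)).
move=> _ [Q [QXi _ Qm] <-]; rewrite -/(eloss D Q x).
have := eloss_lip x x0 QXi; have := eloss_bound QXi Qm Xx0.
by rewrite !ler_norml; lra.
Qed.

Lemma worst_case_ub A Q x : constr D A Q ->
  eloss D Q x <= worst_case D (constr D A) x.
Proof.
by move=> AQ; apply: ub_le_sup; [case: (eloss_set_bounded A x)|exists Q].
Qed.

Lemma worst_case_le A x c : (forall Q, constr D A Q -> eloss D Q x <= c) ->
  worst_case D (constr D A) x <= c.
Proof.
move=> Ac; apply: ge_sup; first by case: (eloss_set_bounded A x).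
by move=> _ [Q AQ <-]; exact: Ac.
Qed.

Lemma worst_case_sub A B x : A `<=` B ->
  worst_case D (constr D B) x <= worst_case D (constr D A) x.
Proof.
move=> AB; apply: worst_case_le => Q BQ.
exact/worst_case_ub/(constr_sub AB).
Qed.

Lemma worst_case_lip A x y :
  `|worst_case D (constr D A) x - worst_case D (constr D A) y|
  <= lip_x D * enorm (x - y).
Proof.
have H u v : worst_case D (constr D A) u
    <= worst_case D (constr D A) v + lip_x D * enorm (u - v).
  apply: worst_case_le => Q AQ; have [QXi _ _] := AQ.
  have := eloss_lip u v QXi; have := worst_case_ub v AQ.
  by rewrite ler_norml; lra.
have := H x y; have := H y x; rewrite (enormB y x) ler_norml; lra.
Qed.

Lemma continuous_worst_case A : continuous (worst_case D (constr D A)).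
Proof. exact: lipschitz_continuous (worst_case_lip A). Qed.

Lemma argmin_neq0 A : dro_argmin D (constr D A) !=set0.
Proof.
have [c cX cmin] := compact_EVT_min (X_neq0 D) (Xset_compact (d := D))
  (continuous_subspaceT (@continuous_worst_case A)).
exists c; split; first exact: set_mem.
by move=> y Xy; apply: cmin; exact: mem_set.
Qed.

Lemma dro_valueE A x : dro_argmin D (constr D A) x ->
  dro_value D (constr D A) = worst_case D (constr D A) x.
Proof.
move=> [Xx xmin]; apply: le_anti; apply/andP; split.
  apply: ge_inf; last by exists x.
  by exists (worst_case D (constr D A) x) => _ [y Xy <-]; exact: xmin.
apply: lb_le_inf; first by exists (worst_case D (constr D A) x), x.
by move=> _ [y Xy <-]; exact: xmin.
Qed.

(* Weak compactness of the laws on Xi passes from the constraints at a dense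
   set of points to the constraints on all of X; no Slater condition, so that
   eps = 0 is covered. *)
Lemma worst_case_dense x (e : R) : 0 < e ->
  exists2 delta : R, 0 < delta & forall A : set 'cV[R]_(dx D),
    (forall y, X y -> exists2 a, A a & enorm (y - a) <= delta) ->
    worst_case D (constr D A) x <= worst_case D (constr D X) x + e.
Proof.
move=> e0; apply: contrapT => nd.
(* Were no delta suitable, delta = 1/(k+1) would yield a law exceeding the worst case by e. The
   losses expected under Q and under Phat each move by at most [lip_x] / (k+1), hence the factor 2
   in the relaxed constraint. *)
have /choice[Q QP] : forall k : nat, exists Q : Law, [/\ distr_on Xi Q,
    forall y, X y -> eloss D Q y - eloss D (Phat D) y
      <= eps D + 2 * lip_x D * k.+1%:R^-1,
    (second_moment Q <= (Omega D)%:E)%E &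
    worst_case D (constr D X) x + e <= eloss D Q x].
  move=> k; apply: contrapT => nQ; apply: nd.
  exists k.+1%:R^-1; first by rewrite invr_gt0.
  move=> A dA; apply: worst_case_le => Q [QXi QA Qm].
  rewrite leNgt; apply/negP => He; apply: nQ; exists Q; split => //;
    last exact: ltW.
  move=> y Xy; have [a Aa ya] := dA y Xy.
  have := QA a Aa; have := eloss_lip y a QXi.
  have := eloss_lip y a (Phat_on_Xi D).
  have := ler_wpM2l (lip_x_ge0 D) ya.
  by rewrite !ler_norml; move: (k.+1%:R^-1) => r; lra.
have QXi k : distr_on Xi (Q k) by case: (QP k).
have [Qoo QooXi Qle] := weak_compactness (Xiset_compact (d :=
  D)) (Xi_neq0 D) QXi.
have lxi (z : 'cV[R]_(dx D)) : 0 <= opmax D * enorm (homog z)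
  by rewrite mulr_ge0 ?opmax_ge0 ?enorm_ge0.
have Xi_lip z u v : Xi u -> Xi v ->
    `|loss D z u - loss D z v| <= opmax D * enorm (homog z) * enorm (u - v).
  by move=> _ _; exact: loss_lip_xi.
have Coo : constr D X Qoo.
  split => //; last first.
    rewrite second_momentE// expect_int//; last exact: continuous_sqnorm.
    rewrite lee_fin; apply: (Qle _ (Rxi D + Rxi D)).
    - by rewrite addr_ge0 ?Rxi_ge0.
    - exact: continuous_sqnorm.
    - exact: sqnorm_lip.
    - move=> e' e'0; apply: filterE => k; have [_ _ + _] := QP k.
      rewrite second_momentE// expect_int//; last exact: continuous_sqnorm.
      by rewrite lee_fin; move: e'0; lra.
  move=> z Xz; rewrite lerBlDr /eloss expect_int//; last exact: continuous_loss.
  apply: (Qle _ _ _ (lxi z) (@continuous_loss _ D z) (Xi_lip z)) => e' e'0.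
  have l0 : 0 < 2 * lip_x D + 1 by have := lip_x_ge0 D; lra.
  near=> k.
  have [_ /(_ z Xz) + _ _] := QP k.
  rewrite {1}/eloss expect_int//; last exact: continuous_loss.
  have : k.+1%:R^-1 < e' / (2 * lip_x D + 1).
    by near: k; exact: near_infty_natSinv_lt (PosNum (divr_gt0 e'0 l0)).
  rewrite ltr_pdivlMr// => He; have : 0 < k.+1%:R^-1 :> R by rewrite invr_gt0.
  by rewrite /eloss; move: (k.+1%:R^-1) He => r; lra.
have := worst_case_ub x Coo; apply/negP; rewrite -ltNge.
(* The limit law preserves upper bounds, so the excess e is passed on through -loss; it contradicts
   feasibility of the limit. *)
have : - eloss D Qoo x <= - (worst_case D (constr D X) x + e).
  rewrite -mulN1r -expectZ//; last exact: continuous_loss.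
  have cN : continuous (fun xi => -1 * loss D x xi).
    exact/continuousZ_fun/continuous_loss.
  rewrite expect_int//.
  apply: (Qle _ _ _ (lxi x) cN) => [u v Xu Xv|e' e'0].
    by rewrite -mulrBr mulN1r normrN; exact: Xi_lip.
  apply: filterE => k; have [_ _ _] := QP k.
  rewrite -expect_int// expectZ//; last exact: continuous_loss.
  by rewrite -/(eloss D (Q k) x); move: e'0; lra.
by lra.
Unshelve. all: by end_near. Qed.

Lemma edist_set_lip (S : set 'cV[R]_(dx D)) x y : S !=set0 ->
  `|edist_set x S - edist_set y S| <= 1 * enorm (x - y).
Proof.
move=> [s0 Ss0].
have H u v : edist_set u S <= edist_set v S + enorm (u - v).
  rewrite -lerBlDr; apply: lb_le_inf; first by exists (enorm (v - s0)), s0.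
  move=> _ [s Ss <-]; rewrite lerBlDr.
  apply: (@le_trans _ _ (enorm (u - s))).
    apply: ge_inf; last by exists s.
    by exists 0 => _ [t _ <-]; exact: enorm_ge0.
  rewrite (_ : u - s = (v - s) + (u - v)); first exact: enormD.
  by rewrite [RHS]addrC addrA subrK.
have := H x y; have := H y x; rewrite (enormB y x) ler_norml mul1r; lra.
Qed.

Lemma edist_set_ge0 n (S : set 'cV[R]_n) x : S !=set0 -> 0 <= edist_set x S.
Proof.
move=> [s Ss]; apply: lb_le_inf; first by exists (enorm (x - s)), s.
by move=> _ [t _ <-]; exact: enorm_ge0.
Qed.

Lemma edist_set_in n (S : set 'cV[R]_n) x : S x -> edist_set x S <= 0.
Proof.
move=> Sx; apply: ge_inf; last by exists x => //; rewrite subrr enorm0.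
by exists 0 => _ [t _ <-]; exact: enorm_ge0.
Qed.

(** The points of X at distance at least e from the minimizers form a compact set, so the worst case
    attains a minimum there, strictly above the optimal value; half the difference serves as gap. *)
Lemma near_optimal_dist (e : R) : 0 < e -> exists2 gap : R, 0 < gap &
  forall x, X x ->
    worst_case D (constr D X) x <= dro_value D (constr D X) + gap ->
    edist_set x (dro_argmin D (constr D X)) < e.
Proof.
move=> e0; set S := dro_argmin D (constr D X).
have S0 : S !=set0 by exact: argmin_neq0.
pose F := X `&` [set x | e <= edist_set x S].
have cdist : continuous (fun x => edist_set x S).
  by apply: (@lipschitz_continuous _ _ _ 1) => x y; exact: edist_set_lip.
have cF : compact F.
  apply: compact_closedI; first exact: Xset_compact.
  exact: (closed_comp (fun x _ => cdist x) (@closed_ge R e)).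
have [F0|F0] := pselect (F !=set0); last first.
  exists 1 => // x Xx _; rewrite ltNge; apply/negP => ex.
  by apply: F0; exists x.
have [c /set_mem [Xc ec] cmin] := compact_EVT_min F0 cF
  (continuous_subspaceT (@continuous_worst_case X)).
have [s Ss] := S0.
have vc : dro_value D (constr D X) < worst_case D (constr D X) c.
  rewrite ltNge; apply/negP => cv.
  have : S c.
    split => // y Xy; apply: (le_trans cv); rewrite (dro_valueE Ss).
    by case: Ss => _; apply.
  by move=> /edist_set_in; rewrite leNgt (lt_le_trans e0 ec).
exists ((worst_case D (constr D X) c - dro_value D (constr D X)) / 2).
  by rewrite divr_gt0// subr_gt0.
move=> x Xx xv; rewrite ltNge; apply/negP => ex.
have := cmin x (mem_set (conj Xx ex)); move: xv vc; lra.
Qed.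

End worst_case.

(** * Consistency *)

Section iid.
Context d (T : measurableType d) {R : realType} {n : nat}.
Variables (P : probability T R) (Z : probability (Rvec R n) R).
Variable z : nat -> {mfun T >-> Rvec R n}.
Hypothesis iid : iid_samples P Z z.

Lemma iid_preimage m (B : set (Rvec R n)) : measurable B ->
  P (z m @^-1` B) = Z B.
Proof. by move=> mB; have [_ /(_ m B mB)] := iid. Qed.

Lemma measurable_sample m (B : set (Rvec R n)) : measurable B ->
  measurable (z m @^-1` B).
Proof. by move=> mB; rewrite -[X in measurable X]setTI;
  exact: measurable_funP. Qed.

Lemma iid_all M (B : nat -> set (Rvec R n)) : (forall i, measurable (B i)) ->
  measurable [set w | forall m, (m < M)%N -> B m (z m w)] /\
  P [set w | forall m, (m < M)%N -> B m (z m w)] = (\prod_(m < M) Z (B m))%E.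
Proof.
move=> mB.
have -> : [set w | forall m, (m < M)%N -> B m (z m w)]
    = \bigcap_(i in [set` iota 0 M]) (z i @^-1` B i).
  apply/seteqP; split => w /= H.
    by move=> m /=; rewrite mem_iota add0n => /andP[_ mM]; exact: H.
  by move=> m mM; apply: (H m); rewrite /= mem_iota.
split.
  apply: fin_bigcap_measurable => // i _; exact: measurable_sample.
have [Hind _] := iid; rewrite (Hind _ _ (iota_uniq 0 M) mB).
have -> : iota 0 M = index_iota 0 M by rewrite /index_iota subn0.
rewrite big_mkord.
by apply: eq_bigr => m _; exact: iid_preimage.
Qed.

Lemma sample_avoid_cvg (U : set (Rvec R n)) : measurable U -> (0 < Z U)%E ->
  (fun M => P [set w | forall m, (m < M)%N -> ~ U (z m w)]) @ \oo --> 0%E.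
Proof.
move=> mU ZU.
pose q := fine (Z (~` U)).
have mUc : measurable (~` U) by exact: measurableC.
have qE : Z (~` U) = q%:E by rewrite fineK// fin_num_measure.
have q0 : 0 <= q by rewrite fine_ge0.
have q1 : q < 1.
  rewrite -lte_fin -qE probability_setC// lteBlDr ?fin_num_measure//.
  by rewrite lteDl// ?fin_num_measure.
rewrite (_ : (fun M => _) = (fun M => (q ^+ M)%:E)).
  by apply: cvg_EFin; [exact: nearW|apply: cvg_expr; rewrite ger0_norm].
apply/funext => M; rewrite (iid_all M (fun=> mUc)).2.
elim: M => [|M IH]; first by rewrite big_ord0.
by rewrite big_ord_recr /= IH qE -EFinM exprSr.
Qed.

End iid.

Section consistency.
Context {R : realType} (D : dro R).
Local Notation X := (Xset D).

Lemma dense_value (e : R) : 0 < e ->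
  exists2 delta : R, 0 < delta & forall A : set 'cV[R]_(dx D), A `<=` X ->
    (forall y, X y -> exists2 a, A a & enorm (y - a) <= delta) ->
    dro_value D (constr D X) <= dro_value D (constr D A)
      <= dro_value D (constr D X) + e.
Proof.
move=> e0; have [x xmin] := argmin_neq0 (D := D) X.
have [delta d0 dP] := worst_case_dense x e0.
exists delta => // A AX dA; have [y ymin] := argmin_neq0 A.
rewrite (dro_valueE xmin) (dro_valueE ymin).
have [Xx xle] := xmin; have [Xy yle] := ymin.
apply/andP; split.
  by rewrite (le_trans (xle y Xy))// worst_case_sub.
by rewrite (le_trans (yle x Xx))// dP.
Qed.

Context d (T : measurableType d) (P : probability T R).
Variable z : nat -> {mfun T >-> Rvec R (dx D)}.
Hypothesis iid : iid_samples P (Zlaw D) z.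

Definition sample_set M w : set 'cV[R]_(dx D) :=
  [set z m w | m in [set m | (m < M)%N]].

Lemma sample_in_X m : P [set w | ~ X (z m w)] = 0%E.
Proof.
have -> : [set w | ~ X (z m w)] = z m @^-1` (~` X) by [].
rewrite (iid_preimage iid); last by apply: measurableC; exact: measurable_X.
have ZX := Z_on_X D.
by rewrite probability_setC ?ZX ?subee//; exact: measurable_X.
Qed.

(** The events E M may be nonmeasurable. They are covered by a measurable event: some sample leaves
    X, which has probability 0, or some ball around one of finitely many centres is missed, which
    has vanishing probability. *)
Lemma sample_dense (delta : R) (E : nat -> set T) : 0 < delta ->
  (forall M w, (0 < M)%N -> sample_set M w `<=` X ->
    (forall y, X y -> exists2 a, sample_set M w a & enorm (y - a) <= delta) ->
    ~ E M w) ->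
  mu_ext P (E M) @[M --> \oo] --> 0%E.
Proof.
move=> d0 EP.
(* One half goes from y to its cell centre, the other from that centre to a sample. *)
have d20 : 0 < delta / 2 by rewrite divr_gt0.
have [K [kappa [c [_ cX kc]]]] := compact_cells (Xset_compact (d :=
  D)) (X_neq0 D) d20.
pose U i : set 'cV[R]_(dx D) := [set y | enorm (y - c i) < delta / 2].
have oU i : open (U i).
  have cd : continuous (fun y : 'cV[R]_(dx D) => enorm (y - c i)).
    apply: (@lipschitz_continuous _ _ _ 1) => x y; rewrite mul1r.
    apply: (le_trans (enorm_dist _ _)).
    by rewrite opprB addrA subrK.
  by have /continuousP/(_ _ (@open_lt R (delta / 2))) := cd.
have mU i : measurable (U i : set (Rvec R (dx D)))
  by exact: open_Rvec_measurable.
have ZU i : (0 < Zlaw D (U i))%E.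
  apply: (Z_full_support (oU i)); exists (c i); split => //.
  by rewrite /U /= subrr enorm0.
pose out m : set T := [set w | ~ X (z m w)].
pose miss (i M : nat) : set T :=
  [set w | forall m, (m < M)%N -> ~ U (inord i) (z m w)].
have mout m : measurable (out m).
  apply: (@measurable_sample _ _ _ _ z m (~` X)).
  by apply: measurableC; exact: measurable_X.
have mmiss i M : measurable (miss i M).
  by apply: (iid_all iid M (fun=> measurableC (mU (inord i)))).1.
pose bad M := (\big[setU/set0]_(m < M) out m) `|` \big[setU/set0]_(i < K.+1)
  miss i M.
have mbad M : measurable (bad M).
  by apply: measurableU; apply: bigsetU_measurable.
have Ebad M : (0 < M)%N -> E M `<=` bad M.
  move=> M0 w Ew; apply: contrapT => nbad.
  have SX : sample_set M w `<=` X.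
    move=> _ [m /= mM <-]; apply: contrapT => nX; apply: nbad; left.
    by rewrite -bigcup_mkord; exists m.
  apply: (EP M w M0 SX _ Ew) => y Xy.
  have : ~ [set w | forall m, (m < M)%N -> ~ U (kappa y) (z m w)] w.
    rewrite -[kappa y]inord_val.
    move=> my; apply: nbad; right.
    by rewrite -(bigcup_mkord K.+1 (fun i => miss i M)); exists (kappa y) => /=.
  move=> /existsNP[m /not_implyP[mM /contrapT Um]].
  exists (z m w); first by exists m.
  rewrite (_ : y - z m w = (y - c (kappa y)) - (z m w - c (kappa y))).
    rewrite (le_trans (enormD _ _))// enormN (splitr delta) lerD ?kc//.
    exact: ltW.
  by rewrite opprB addrA subrK.
have Pbad M : (P (bad M) <= \sum_(i < K.+1) P (miss i M))%E.
  apply: (@le_trans _ _ (P (\big[setU/set0]_(m < M) out m)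
      + P (\big[setU/set0]_(i < K.+1) miss i M))%E).
    by apply: measureU2; exact: bigsetU_measurable.
  apply: (@le_trans _ _ (\sum_(m < M) P (out m)
      + \sum_(i < K.+1) P (miss i M))%E).
    apply: leeD; first exact: (@Boole_inequality _ _ _ P out).
    exact: (@Boole_inequality _ _ _ P (miss ^~ M)).
  by rewrite big1 ?add0e// => m _; exact: sample_in_X.
have cmiss : (\sum_(i < K.+1) P (miss i M))%E @[M --> \oo] --> (\sum_(i <
  K.+1) 0)%E.
  apply: cvg_nnesum => i _.
    by apply: nearW => M; exact: measure_ge0.
  exact: (sample_avoid_cvg iid (mU (inord i)) (ZU (inord i))).
rewrite big1// in cmiss.
apply: (@squeeze_cvge _ _ _ _ (fun=> 0%E) _ (fun M =>
  \sum_(i < K.+1) P (miss i M))%E) => //.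
  near=> M; apply/andP; split; first exact: mu_ext_ge0.
  apply: (le_trans _ (Pbad M)).
  rewrite -(measurable_mu_extE P (mbad M)); apply: le_mu_ext.
  by apply: Ebad; near: M; exact: nbhs_infty_gt.
exact: cvg_cst.
Unshelve. all: by end_near. Qed.

Lemma consistency (xhat : nat -> T -> 'cV[R]_(dx D)) :
  (forall M w, (0 < M)%N -> dro_argmin D (constr D (sample_set M w)) (xhat M
    w)) ->
  cvg_in_probability P (fun M w => dro_value D (constr D (sample_set M w)))
    (dro_value D (constr D X)) /\
  cvg_in_probability P
    (fun M w => edist_set (xhat M w) (dro_argmin D (constr D X))) 0.
Proof.
move=> xmin; split => e e0.
  have e20 : 0 < e / 2 by rewrite divr_gt0.
  have [delta d0 dP] := dense_value e20.
  apply: (sample_dense d0) => M w M0 SX Sd /=; apply/negP; rewrite -ltNge.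
  have /andP[H1 H2] := dP _ SX Sd.
  by rewrite ger0_norm ?subr_ge0//; move: e0 H2; lra.
have [gap g0 gP] := near_optimal_dist D e0.
have [delta d0 dP] := dense_value g0.
apply: (sample_dense d0) => M w M0 SX Sd /=; apply/negP; rewrite -ltNge subr0.
have /andP[H1 H2] := dP _ SX Sd.
have xm := xmin M w M0; have [Xx _] := xm.
rewrite ger0_norm; last by apply: edist_set_ge0; exact: argmin_neq0.
apply: gP => //; apply: (le_trans (worst_case_sub _ SX)).
by rewrite -(dro_valueE xm).
Qed.

End consistency.

(** * Strong duality *)

Section lagrange.
Context {R : realType} {S : Type}.

(** In the plane of pairs (g q, f q), a line through (0, v) lying above all these points is sought.
    Its slope must separate the slopes to points with g > 0 from those to points with g < 0, and a
    Slater point bounds the former. *)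
Lemma lagrange_multiplier (C : set S) (f g : S -> R) (v : R) (q0 : S) :
  (forall q q' t, C q -> C q' -> 0 <= t <= 1 -> exists q'',
     [/\ C q'', f q'' = t * f q + (1 - t) * f q' &
                g q'' = t * g q + (1 - t) * g q']) ->
  C q0 -> g q0 < 0 ->
  (forall q, C q -> g q <= 0 -> f q <= v) ->
  exists2 lam, 0 <= lam & forall q, C q -> f q - lam * g q <= v.
Proof.
move=> mix Cq0 gq0 fv.
(* The element 0 makes the set nonempty and its supremum nonnegative. *)
pose E : set R := [set r | r = 0 \/ exists q, [/\ C q,
  0 < g q & r = (f q - v) / g q]].
have Eub q : C q -> g q < 0 -> ubound E ((v - f q) / (- g q)).
  move=> Cq gq _ [->|[q' [Cq' gq' ->]]].
    by rewrite divr_ge0 ?oppr_ge0 ?(ltW gq)// subr_ge0 fv// ltW.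
  have dg : 0 < g q' - g q by rewrite subr_gt0 (lt_trans gq gq').
  (* The weight at which the mixture satisfies g = 0, so that f <= v applies to it. *)
  pose t := - g q / (g q' - g q).
  have t01 : 0 <= t <= 1.
    rewrite /t divr_ge0 ?oppr_ge0 ?(ltW gq) ?(ltW dg)//= ler_pdivrMr// mul1r.
    by rewrite lerDr ltW.
  have [q'' [Cq'' fq'' gq'']] := mix q' q t Cq' Cq t01.
  have g0 : g q'' = 0.
    by rewrite gq'' /t; field; rewrite gt_eqF.
  have := fv q'' Cq''; rewrite g0 fq'' => /(_ (lexx _)).
  have -> : t * f q' + (1 - t) * f q
      = (- g q * f q' + g q' * f q) / (g q' - g q).
    by rewrite /t; field; rewrite gt_eqF.
  rewrite ler_pdivrMr// => H.
  by rewrite ler_pdivrMr// mulrAC ler_pdivlMr ?oppr_gt0//; lra.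
have E0 : E 0 by left.
have Esup : has_sup E.
  by split; [exists 0|exists ((v - f q0) / (- g q0)); exact: Eub].
exists (sup E); first by apply: ub_le_sup => //; case: Esup.
move=> q Cq; have [gq|gq|gq] := ltgtP (g q) 0.
- have : sup E <= (v - f q) / (- g q).
    by apply: ge_sup; [exists 0|exact: Eub].
  by rewrite ler_pdivlMr ?oppr_gt0//; lra.
- have : (f q - v) / g q <= sup E.
    by apply: ub_le_sup; [case: Esup|right; exists q].
  by rewrite ler_pdivrMr//; lra.
- by rewrite gq mulr0 subr0 fv// gq.
Qed.

(* The constraints are dualised one at a time, so that each step is a comparison
   of slopes and no separation theorem is needed. *)
Lemma lagrange_multipliers (I : Type) (r : seq I) (C : set S) (f : S -> R)
    (g : I -> S -> R) (v : R) (q0 : S) :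
  (forall q q' t, C q -> C q' -> 0 <= t <= 1 -> exists q'',
     [/\ C q'', f q'' = t * f q + (1 - t) * f q' &
         forall i, g i q'' = t * g i q + (1 - t) * g i q']) ->
  C q0 -> (forall i, g i q0 < 0) ->
  (forall q, C q -> (forall i, g i q <= 0 \/ ~ List.In i r) -> f q <= v) ->
  exists2 l : seq (R * I), (forall p, List.In p l -> 0 <= p.1) &
    forall q, C q -> f q - \sum_(p <- l) p.1 * g p.2 q <= v.
Proof.
elim: r f => [|i r IH] f mix Cq0 gq0 fv.
  exists [::] => // q Cq; rewrite big_nil subr0; apply: fv => // i.
  by right.
(* The constraints of [r] stay hard while constraint i is dualised; the induction then runs with the
   penalised objective. The disjunctions spare any decidable equality on [I]. *)
pose C' : set S := [set q | C q /\ forall j, g j q <= 0 \/ ~ List.In j r].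
have [lam lam0 Hlam] : exists2 lam, 0 <= lam &
    forall q, C' q -> f q - lam * g i q <= v.
  apply: (@lagrange_multiplier C' f (g i) v q0) => //.
  - move=> q q' t [Cq Hq] [Cq' Hq'] t01.
    have [q'' [Cq'' fq'' gq'']] := mix q q' t Cq Cq' t01.
    exists q''; split => //; split => // j.
    have [Hj|Hj] := Hq j; last by right.
    have [Hj'|Hj'] := Hq' j; last by right.
    left; rewrite gq''; move: t01 => /andP[t0 t1].
    have t1' : 0 <= 1 - t by rewrite subr_ge0.
    by have := mulr_ge0_le0 t0 Hj; have := mulr_ge0_le0 t1' Hj'; lra.
  - by split => // j; left; exact: ltW.
  - move=> q [Cq Hq] gq; apply: fv => // j.
    have [Hj|Hj] := Hq j; first by left.
    have [->|ij] := pselect (j = i); first by left.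
    by right => -[/esym/ij|/Hj].
have [|//|//||l l0 Hl] := IH (fun q => f q - lam * g i q).
- move=> q q' t Cq Cq' t01.
  have [q'' [Cq'' fq'' gq'']] := mix q q' t Cq Cq' t01.
  by exists q''; split => //; rewrite fq'' gq''; lra.
- by move=> q Cq Hq; exact: Hlam.
exists ((lam, i) :: l); first by move=> p [<-//|]; exact: l0.
by move=> q Cq; rewrite big_cons /=; have := Hl q Cq; lra.
Qed.

End lagrange.

Section strong_duality.
Context {R : realType} (D : dro R).
Local Notation X := (Xset D).
Local Notation Xi := (Xiset D).
Local Notation Law := (probability (Rvec R (dxi D)) R).

Lemma law_mix (Q Q' : Law) (t : R) : distr_on Xi Q -> distr_on Xi Q' ->
  0 <= t <= 1 -> exists2 Q'' : Law, distr_on Xi Q'' &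
  forall f, continuous f -> expect Q'' f = t * expect Q f
    + (1 - t) * expect Q' f.
Proof.
move=> QXi QXi' /andP[t0 t1].
have t1' : 0 <= 1 - t by rewrite subr_ge0.
pose m := mcomb Q Q' (NngNum t0) (NngNum t1').
have m1 : m setT = 1%E.
  by rewrite /m mcombE /= !probability_setT !mule1 -EFinD addrC subrK.
have mXi : distr_on Xi (probability_of m1 : Law).
  change (m Xi = 1%E); rewrite /m mcombE /= QXi QXi' !mule1 -EFinD.
  by rewrite addrC subrK.
exists (probability_of m1 : Law) => // f cf.
rewrite !expect_int//.
rewrite -[LHS]/(\int[m]_(x in Xi) f x) integral_mcomb//;
  first exact: measurable_Xi.
exact: continuous_bmeas.
Qed.

Lemma expect_dirac xi f : Xi xi -> continuous f ->
  distr_on Xi (@dirac _ (Rvec R (dxi D)) xi R : Law) /\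
  expect (@dirac _ (Rvec R (dxi D)) xi R : Law) f = f xi.
Proof.
move=> Xixi cf; have dXi : distr_on Xi (@dirac _ (Rvec R (dxi D)) xi R : Law).
  by rewrite /distr_on /= diracE mem_set.
split => //; rewrite expect_int// /Rintegral integral_dirac.
- by rewrite diracE mem_set// mul1e.
- exact: measurable_Xi.
- by apply/measurable_EFinP; case: (continuous_bmeas cf).
Qed.

(** Multipliers of the loss constraints ([Some i]) become atoms of nu at c i; those of the moment
    constraint ([None]) add up to beta. *)
Lemma discrete_dual_measure (I : Type) (c : I -> 'cV[R]_(dx D))
    (l : seq (R * option I)) :
  (forall i, X (c i)) -> (forall p, List.In p l -> 0 <= p.1) ->
  exists2 beta : R, 0 <= beta &
  exists2 nu : {finite_measure set (Rvec R (dx D)) -> \bar R}, measure_on X nu &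
  forall (h : 'cV[R]_(dx D) -> R) (u : R), @bmeas _ (Rvec R (dx D)) R X h ->
    \sum_(p <- l) p.1 * (if p.2 is Some i then h (c i) else u)
    = \int[nu]_(z in X) h z + beta * u.
Proof.
move=> cX; have mX := @measurable_X _ D.
elim: l => [|[lam o] l IH] l0.
  exists 0 => //; pose nng0 : {nonneg R} := NngNum (lexx 0).
  exists (mcomb (Zlaw D) (Zlaw D) nng0 nng0).
    by rewrite /measure_on /= mcombE /= !mul0e adde0.
  by move=> h u bh; rewrite big_nil integral_mcomb//= !mul0r !addr0.
have [|beta beta0 [nu nuX H]] := IH; first by move=> p lp; apply: l0; right.
have lam0 : 0 <= lam by apply: (l0 (lam, o)); left.
case: o l0 => [i|] l0; last first.
  exists (beta + lam); first exact: addr_ge0.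
  by exists nu => // h u bh; rewrite big_cons H//=; lra.
exists beta => //.
pose dc := @dirac _ (Rvec R (dx D)) (c i) R.
pose m := mcomb nu dc (NngNum ler01) (NngNum lam0).
exists m.
  rewrite /measure_on /= /m mcombE /= nuX mule0 add0e /dc diracE memNset
    ?mule0//.
  by move=> /(_ (cX i)).
move=> h u bh; rewrite big_cons H//= /m integral_mcomb//= mul1r.
have -> : \int[dc]_(z in X) h z = h (c i).
  rewrite /Rintegral integral_dirac//.
    by rewrite diracE mem_set// mul1e.
  by apply/measurable_EFinP; case: bh.
lra.
Qed.

Lemma bmeas_Lipschitz (h : 'cV[R]_(dx D) -> R) (L : R) :
  (forall x y, `|h x - h y| <= L * enorm (x - y)) ->
  @bmeas _ (Rvec R (dx D)) R X h.
Proof.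
move=> hL; have ch := lipschitz_continuous hL; split.
  exact: measurable_funS (continuous_Rvec_measurable ch).
have [c cX cmax] := compact_EVT_max (X_neq0 D) (Xset_compact (d :=
  D)) (continuous_subspaceT ch).
have [b bX bmin] := compact_EVT_min (X_neq0 D) (Xset_compact (d :=
  D)) (continuous_subspaceT ch).
exists (`|h c| + `|h b|) => x Xx.
have h1 := cmax x (mem_set Xx); have h2 := bmin x (mem_set Xx).
have := ler_norm (h c); have := ler_norm (- h b); rewrite normrN.
rewrite ler_norml; have := normr_ge0 (h c); have := normr_ge0 (h b).
by move: h1 h2; lra.
Qed.

(** X is thinned to cell centres dense enough to cost at most e, leaving finitely many constraints.
    Evaluating the Lagrangian inequality at Dirac masses then gives the pointwise dual
    constraint. *)
Lemma dual_value_le (e : R) : 0 < eps D -> 0 < e ->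
  exists x alpha beta nu, dual_feasible D x alpha beta nu /\
    dual_objective D alpha beta nu <= dro_value D (constr D X) + e.
Proof.
move=> eps0 e0; have [x xmin] := argmin_neq0 (D := D) X; have [Xx _] := xmin.
have [delta d0 dP] := worst_case_dense x e0.
have [K [kappa [c [_ cX kc]]]] := compact_cells (Xset_compact (d :=
  D)) (X_neq0 D) d0.
set v := dro_value D (constr D X) + e.
pose g (o : option 'I_K.+1) (Q : Law) : R :=
  if o is Some i then eloss D Q (c i) - eloss D (Phat D) (c i) - eps D
  else expect Q (sqnorm (D := D)) - Omega D.
have cl := @continuous_loss _ D.
have cs := @continuous_sqnorm _ D.
have [|||Q QXi Hg|l l0 Hl] := @lagrange_multipliers R Law (option 'I_K.+1)
    (None :: [seq Some i | i <- enum 'I_K.+1]) (distr_on Xi)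
    (fun Q => eloss D Q x) g v (Phat D).
- move=> Q Q' t QXi QXi' t01; have [Q'' QXi'' HQ] := law_mix QXi QXi' t01.
  exists Q''; split => //; first exact: HQ.
  by move=> [i|]; rewrite /g /eloss ?HQ//; lra.
- exact: Phat_on_Xi.
- move=> [i|]; rewrite /g; first by rewrite subrr sub0r oppr_lt0.
  have := Phat_moment D; rewrite second_momentE; last exact: Phat_on_Xi.
  by rewrite lte_fin subr_lt0.
- apply: le_trans (_ : worst_case D (constr D [set c i | i in setT]) x <= v).
    apply: worst_case_ub; split => //.
      move=> _ [i _ <-]; have [|] := Hg (Some i); first by rewrite /g subr_le0.
      case; right; have : i \in enum 'I_K.+1 by rewrite mem_enum.
      elim: (enum _) => [//|j s IH].
      rewrite in_cons => /orP[/eqP ij|ins]; first by left; rewrite ij.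
      by right; exact: IH.
    rewrite second_momentE// lee_fin; have [|] := Hg None;
      first by rewrite /g subr_le0.
    by case; left.
  rewrite /v (dro_valueE xmin).
  apply: (dP [set c i | i in setT]) => y Xy.
  by exists (c (kappa y)); [exists (kappa y)|exact: kc].
have [beta beta0 [nu nuX Hnu]] := discrete_dual_measure cX l0.
have bP : @bmeas _ (Rvec R (dx D)) R X (fun z => eloss D (Phat D) z + eps D).
  apply: (@bmeas_Lipschitz _ (lip_x D)) => y z.
  rewrite opprD addrACA subrr addr0.
  by apply: eloss_lip; exact: Phat_on_Xi.
pose obj := \int[nu]_(z in X) (eloss D (Phat D) z + eps D).
(* This alpha makes the dual objective equal to v. *)
exists x, (v - beta * Omega D - obj), beta, nu; split; last first.
  by rewrite /dual_objective -/obj; lra.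
split => // xi Xixi.
have [dXi dl] := expect_dirac Xixi (cl x).
have := Hl _ dXi; rewrite {1}/eloss dl.
have bl : @bmeas _ (Rvec R (dx D)) R X (loss D ^~ xi).
  by apply: (@bmeas_Lipschitz _ (lip_x D)) => y z; exact: loss_lip_x.
have -> : \sum_(p <- l) p.1 * g p.2 (@dirac _ (Rvec R (dxi D)) xi R : Law)
  = \sum_(p <- l) p.1 * (if p.2 is Some i then loss D (c i) xi else sqnorm xi)
  - \sum_(p <- l) p.1 * (if p.2 is Some i then eloss D (Phat D) (c i) + eps D
                         else Omega D).
  rewrite -sumrB; apply: eq_bigr => p _; rewrite -mulrBr; congr (_ * _).
  rewrite /g; case: p.2 => [i|].
    by rewrite {1}/eloss (expect_dirac Xixi (cl (c i))).2; lra.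
  by rewrite (expect_dirac Xixi cs).2.
rewrite (Hnu _ (sqnorm xi) bl) (Hnu _ (Omega D) bP) -/obj /sqnorm.
lra.
Qed.

End strong_duality.

(** * Finite-sample bound *)

Section cell_sample.
Context d (T : measurableType d) {R : realType} {n K : nat}.
Variables (P : probability T R) (Z : probability (Rvec R n) R).
Variable z : nat -> {mfun T >-> Rvec R n}.
Hypothesis iid : iid_samples P Z z.
Variable kappa : Rvec R n -> 'I_K.+1.
Hypothesis mkappa : forall k, measurable (kappa @^-1` [set k]).

Definition cell_mass (k : 'I_K.+1) : R := fine (Z (kappa @^-1` [set k])).

Lemma cell_mass_ge0 k : 0 <= cell_mass k.
Proof. exact: fine_ge0. Qed.

Lemma cell_mass_sum1 : \sum_k cell_mass k = 1.
Proof.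
apply: EFin_inj; rewrite -sumEFin -(probability_setT Z).
have -> : [set: Rvec R n] = \big[setU/set0]_(k < K.+1) (kappa @^-1` [set k]).
  apply/seteqP; split => // x _.
  by rewrite -bigcup_mkord_ord; exists (kappa x) => //=; rewrite inord_val.
rewrite measure_bigsetU_ord//.
  by apply: eq_bigr => k _; rewrite fineK ?fin_num_measure.
by apply/trivIsetP => i j _ _ ij; apply/seteqP; split => // x [/= -> /eqP];
  rewrite (negbTE ij).
Qed.

Definition cells M w : seq 'I_K.+1 := [seq kappa (z m w) | m <- iota 0 M].

Lemma cells_law M (A : seq 'I_K.+1 -> bool) :
  measurable [set w | A (cells M w)] /\
  P [set w | A (cells M w)] = (iid_avg cell_mass M (fun s => (A s)%:R))%:E.
Proof.
have mz m k : measurable (z m @^-1` (kappa @^-1` [set k])).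
  by apply: measurable_sample; exact: mkappa.
pose pre (ks : seq 'I_K.+1) : set T :=
  [set w | forall m, (m < size ks)%N -> kappa (z m w) = nth ord0 ks m].
have preE ks : measurable (pre ks) /\
    P (pre ks) = (\prod_(m < size ks) cell_mass (nth ord0 ks m))%:E.
  have [H1 H2] := iid_all iid (size ks) (fun m => mkappa (nth ord0 ks m)).
  split; [exact: H1|rewrite [LHS]H2 -prodEFin; apply: eq_bigr => m _].
  by rewrite fineK ?fin_num_measure.
(* Strengthened induction: a prefix [ks] of visited cells is fixed and N cells are still free. The
   next cell splits the event into disjoint pieces, and independence is used only for the prefix
   cylinders. *)
have H N ks : measurable (pre ks `&`
    [set w | A (ks ++ [seq kappa (z m w) | m <- iota (size ks) N])]) /\
  P (pre ks `&` [set w | A (ks ++ [seq kappa (z m w) | m <- iota (size ks) N])])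
  = (fine (P (pre ks)) * iid_avg cell_mass N (fun s => (A (ks ++ s))%:R))%:E.
  elim: N ks => [|N IH] ks.
    rewrite /= cats0; case: (A ks).
      rewrite (_ : [set w | _] = setT) ?setIT; last by apply/seteqP; split.
      rewrite mulr1 fineK; last by rewrite (preE ks).2.
      by split => //; exact: (preE ks).1.
    rewrite (_ : [set w | _] = set0) ?setI0; last by apply/seteqP; split.
    by rewrite measure0 mulr0.
  set B := _ `&` _.
  pose F k := pre (rcons ks k) `&`
    [set w | A (rcons ks k ++ [seq kappa (z m w) | m <- iota (size ks).+1 N])].
  have FE k : measurable (F k) /\ P (F k) = (fine (P (pre (rcons ks k)))
      * iid_avg cell_mass N (fun s => (A (rcons ks k ++ s))%:R))%:E.
    by have := IH (rcons ks k); rewrite size_rcons.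
  have preS k w : pre (rcons ks k) w <-> pre ks w /\ kappa (z (size ks) w) = k.
    rewrite /pre /= size_rcons; split.
      move=> Hw; split.
        by move=> m mk; rewrite Hw ?ltnS ?(ltnW mk)// nth_rcons mk.
      by rewrite Hw// nth_rcons ltnn eqxx.
    move=> [Hw wk] m; rewrite ltnS leq_eqVlt nth_rcons => /predU1P[->|mk].
      by rewrite ltnn eqxx.
    by rewrite mk Hw.
  have BE : B = \big[setU/set0]_(k < K.+1) F k.
    apply/seteqP; split => w.
      move=> [pw Aw]; rewrite -bigcup_mkord_ord.
      exists (kappa (z (size ks) w)) => //=; rewrite inord_val; split.
        by apply/preS.
      by move: Aw; rewrite /= cat_rcons.
    rewrite -bigcup_mkord_ord => -[i _ [/preS[pw wk] Aw]]; split => //.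
    by move: Aw; rewrite /= cat_rcons wk.
  have mF k : measurable (F k) by case: (FE k).
  split; first by rewrite BE; exact: bigsetU_measurable.
  rewrite BE measure_bigsetU_ord//; last first.
    apply/trivIsetP => i j _ _ ij; apply/seteqP; split => // w.
    move=> [[/preS[_ wi] _] [/preS[_ wj] _]].
    by move: ij; rewrite -wi -wj eqxx.
  rewrite /= /avg mulr_sumr -sumEFin; apply: eq_bigr => k _.
  rewrite (FE k).2 mulrA; congr (_ * _)%:E; last first.
    by apply: eq_iid_avg => [j|s _]; [exact: cell_mass_ge0|rewrite cat_rcons].
  rewrite (preE _).2 (preE _).2 /= size_rcons big_ord_recr /=.
  rewrite nth_rcons ltnn eqxx; congr (_ * _).
  by apply: eq_bigr => m _; rewrite nth_rcons ltn_ord.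
have := H M [::]; rewrite (preE [::]).2 big_ord0 /= mul1r.
rewrite (_ : pre [::] = setT) ?setTI//.
by apply/seteqP; split.
Qed.

End cell_sample.

Section concentration.
Context {R : realType} (D : dro R).
Local Notation X := (Xset D).
Local Notation Xi := (Xiset D).
Local Notation Law := (probability (Rvec R (dxi D)) R).

Lemma ln2_ge : 2^-1 <= ln 2 :> R.
Proof.
have := @le_ln1Dx R (- 2^-1) _; rewrite (_ : 1 - 2^-1 = 2^-1) ?lnV ?posrE//.
  by move=> H; have := H; lra.
by lra.
Qed.

(** For J, M >= 2 both logarithms are at least 1/2, so ln J (ln M)^3 >= 1/16, whose square root
    explains the 4. *)
Lemma rate_le (J M : nat) : (2 <= J)%N -> (2 <= M)%N ->
  Num.sqrt (M%:R * J%:R) / M%:R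
    <= 4 * Num.sqrt (J%:R * ln J%:R * ln M%:R ^+ 3 / M%:R) :> R.
Proof.
move=> J2 M2.
have M0 : (0 : R) < M%:R by rewrite ltr0n (leq_trans _ M2).
have J0 : (0 : R) < J%:R by rewrite ltr0n (leq_trans _ J2).
have lnge (N : nat) : (2 <= N)%N -> 2^-1 <= ln N%:R :> R.
  move=> N2; apply: (le_trans ln2_ge);
    rewrite ler_ln ?posrE ?ltr0n ?(leq_trans _ N2)//.
  by rewrite ler_nat.
have lJ := lnge J J2; have lM := lnge M M2.
have -> : 4 = Num.sqrt (16 : R).
  by rewrite (_ : 16 = 4 ^+ 2) ?sqrtr_sqr ?ger0_norm//; ring.
have -> : Num.sqrt (M%:R * J%:R) / M%:R = Num.sqrt (J%:R / M%:R) :> R.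
  have -> : J%:R / M%:R = (M%:R * J%:R) * (M%:R ^+ 2)^-1 :> R.
    by field; rewrite gt_eqF.
  rewrite [RHS]sqrtrM ?mulr_ge0 ?(ltW M0) ?(ltW J0)//.
  by rewrite sqrtrV ?exprn_ge0 ?(ltW M0)// sqrtr_sqr ger0_norm// ltW.
rewrite -sqrtrM//.
have h3 : (2^-1) ^+ 3 <= ln M%:R ^+ 3 :> R
  by rewrite ler_pXn2r ?nnegrE// (le_trans _ lM).
have h4 : (2^-1 : R) * (2^-1) ^+ 3 <= ln J%:R * ln M%:R ^+ 3.
  by rewrite ler_pM.
rewrite ler_wsqrtr//.
have -> : 16 * (J%:R * ln J%:R * ln M%:R ^+ 3 / M%:R)
  = (J%:R / M%:R) * (16 * (ln J%:R * ln M%:R ^+ 3)) :> R by field;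
    rewrite gt_eqF.
rewrite ler_peMr ?divr_ge0 ?(ltW M0) ?(ltW J0)//.
lra.
Qed.

(** The excess compares two expected losses, each of absolute value at most half of this. *)
Definition loss_range : R := 2 * (c1 D + c2 D * Num.sqrt (Omega D)).

Lemma loss_range_ge0 : 0 <= loss_range.
Proof. by rewrite mulr_ge0// addr_ge0 ?c1_ge0// mulr_ge0 ?c2_ge0 ?sqrtr_ge0.
  Qed.

Lemma loss_excess_range Q x : distr_on Xi Q ->
  (second_moment Q <= (Omega D)%:E)%E -> X x ->
  0 <= loss_excess D Q x <= loss_range.
Proof.
move=> QXi Qm Xx; rewrite pospart_ge0 /=.
have := eloss_bound QXi Qm Xx.
have := eloss_bound (Phat_on_Xi D) (ltW (Phat_moment D)) Xx.
rewrite !ler_norml /loss_excess /pospart ge_max loss_range_ge0 andbT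
  /loss_range.
by have := eps_ge0 D; rewrite /eloss; lra.
Qed.

Section cells.
Variables (K : nat) (kappa : Rvec R (dx D) -> 'I_K.+1) (c : 'I_K.+1 ->
  'cV[R]_(dx D)).
Hypothesis mkappa : forall k, measurable (kappa @^-1` [set k]).
Hypothesis cX : forall k, X (c k).

Local Notation p := (cell_mass (Zlaw D) kappa).
Local Notation A := (constr D set0).
Local Notation excess := (fun (k : 'I_K.+1) (Q : Law) => loss_excess D Q (c k)).

Lemma bnd_eloss k : bnd A (fun Q => eloss D Q (c k)).
Proof.
by exists (c1 D + c2 D * Num.sqrt (Omega D)) => Q [QXi _ Qm];
  exact: eloss_bound.
Qed.

Lemma bnd_excess k : bnd A (excess k).
Proof.
exists loss_range => Q [QXi _ Qm];
  have /andP[H1 H2] := loss_excess_range QXi Qm (cX k).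
by rewrite ger0_norm.
Qed.

Lemma mean_deviation M :
  iid_avg p M (fun s => supr A (deviation p excess s))
  <= 4 * loss_radius D * Num.sqrt (M%:R * (nJ D)%:R).
Proof.
have -> : 4 * loss_radius D = 4 * rho_xi D * (opmax D * rho_x D).
  by rewrite loss_radiusE; ring.
have cl := @continuous_loss _ D.
(* Functionals Q -> E_Q v with continuous v. In the instance below xi is the free variable, while
   each sample enters through the coefficient vectors, its transposed blocks applied to the
   homogenised centre. *)
pose r (y : Law -> R) (v : 'cV[R]_(dxi D) -> R) :=
  continuous v /\ forall Q, A Q -> y Q = expect Q v.
apply: (@iid_avg_deviation_le R 'I_K.+1 p (@cell_mass_ge0 _ _ _ _ _)
  (cell_mass_sum1 _ mkappa) Law A (ex_intro _ _ (Phat_constr set0))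
  'cV[R]_(dxi D) Xi (fun k Q => eloss D Q (c k)) excess
  (fun k => loss D (c k)) r (nJ D) (dxi D + 1)
  (fun k j => (loss_block j)^T *m homog (c k)) (@homog R (dxi D))).
- exact: Xi_neq0.
- exact: bnd_excess.
- exact: bnd_eloss.
- move=> k; have [_ [b Hb]] := continuous_bmeas (cl (c k)).
  by exists b.
- move=> k Q Q' AQ AQ'; apply: (le_trans (pospart_dist _ _)).
  by rewrite /eloss le_eqVlt; apply/orP; left; apply/eqP; congr (`|_|); ring.
- split; first exact: cst_continuous.
  by move=> Q [QXi _ _]; rewrite (expect_cst 0 QXi).
- move=> k y v [cv yv].
  have c2l : continuous (fun x => 2 * loss D (c k) x)
    by exact/continuousZ_fun/cl.
  split; split.
  + exact: continuousD_fun.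
  + move=> Q AQ; have [QXi _ _] := AQ.
    by rewrite !fctE /= yv// (expectD QXi cv c2l) (expectZ _ QXi (cl (c k))).
  + have -> : v - (fun x => 2 * loss D (c k) x) = (fun x =>
    v x + (-1) * (2 * loss D (c k) x)).
      by apply/funext => x; rewrite !fctE /=; ring.
    exact/continuousD_fun/continuousZ_fun.
  + move=> Q AQ; have [QXi _ _] := AQ.
    have -> : v - (fun x => 2 * loss D (c k) x) = (fun x =>
      v x + (-1) * (2 * loss D (c k) x)).
      by apply/funext => x; rewrite !fctE /=; ring.
    rewrite !fctE /= yv// (expectD QXi cv (@continuousZ_fun _ _ (-1) _ c2l)).
    by rewrite (expectZ _ QXi c2l) (expectZ _ QXi (cl (c k))) /eloss; ring.
- move=> y v [cv yv] bv; apply: supr_le; first by exists (Phat D);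
  exact: Phat_constr.
  move=> Q AQ; have [QXi _ _] := AQ; rewrite yv// -(expect_cst (supr Xi v) QXi).
  apply: expect_le => //; first exact: cst_continuous.
  by move=> x Xx; exact: supr_ub.
- move=> k x x' _ _; rewrite !loss_homog.
  under eq_bigr do rewrite !dotv_mulmx.
  exact: max_ord_dist_sqrt.
- exact: sqrtr_ge0.
- by rewrite mulr_ge0 ?opmax_ge0 ?sqrtr_ge0.
- by move=> x Xx; apply: enorm_homog_le; exact: Xiset_bounded.
- move=> k j; apply: (le_trans (opnorm_trP _ _)).
  apply: ler_pM; [exact: opnorm_ge0|exact: enorm_ge0| |].
    exact: (max_ord_ge _ (fun j => opnorm (loss_block j))).
  by apply: enorm_homog_le; exact: Xset_bounded.
Qed.

Lemma deviation_bounded_differences s1 s2 k k' (b : R) : loss_range <= b ->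
  supr A (deviation p excess (s1 ++ k :: s2))
  <= supr A (deviation p excess (s1 ++ k' :: s2)) + b.
Proof.
move=> rb; apply: supr_le; first by exists (Phat D); exact: Phat_constr.
move=> Q AQ; have [QXi _ Qm] := AQ.
have bdev s : bnd A (deviation p excess s).
  apply: bnd_sum => j; apply: bndD; last exact/bndN/bnd_excess.
  exact/bnd_avg/bnd_excess.
have := supr_ub (bdev (s1 ++ k' :: s2)) AQ.
rewrite /deviation !big_cat !big_cons /= !fctE /=.
have /andP[H1 H2] := loss_excess_range QXi Qm (cX k).
have /andP[H3 H4] := loss_excess_range QXi Qm (cX k').
move: rb; lra.
Qed.

End cells.
End concentration.

(** * Weak duality and the out-of-sample guarantee *)

Section generalization.
Context {R : realType} (D : dro R).
Local Notation X := (Xset D).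
Local Notation Xi := (Xiset D).
Local Notation Law := (probability (Rvec R (dxi D)) R).

(** E_Q l(z) is at most E_Phat l(z) + eps plus the excess, and only the nonnegative excess is moved
    from nu to gamma Z. Cell sums exchange the integrals over xi and z. *)
Lemma dual_bound x alpha beta nu (gamma : R) (Q : Law) :
  dual_feasible D x alpha beta nu -> dominating_factors D nu gamma ->
  constr D set0 Q ->
  eloss D Q x <= dual_objective D alpha beta nu
    + gamma * \int[Zlaw D]_(z in X) loss_excess D Q z.
Proof.
move=> [Xx beta0 nuX feas] [gamma0 [mu muX muE]] [QXi _ Qm].
have mX := @measurable_X _ D.
have cl := @continuous_loss _ D.
apply/ler_addgt0Pr => e e0.
pose N := fine (nu X).
have N0 : 0 <= N by exact: fine_ge0.
(* Cells replace two nu-integrals of [lip_x]-Lipschitz functions, costing 2 N, and one Z-integral of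
   a function twice as steep, costing 2 gamma; the 1 keeps the divisor positive. *)
pose err : R := lip_x D * (2 * gamma + 2 * N) + 1.
have err0 : 0 < err.
  by rewrite ltr_wpDl// mulr_ge0 ?lip_x_ge0// addr_ge0// mulr_ge0.
pose delta : R := e / err.
have d0 : 0 < delta by rewrite divr_gt0.
have errd : lip_x D * delta * (2 * gamma + 2 * N) <= e.
  have <- : delta * err = e by rewrite /delta divfK ?gt_eqF.
  by rewrite /err; move: d0; lra.
have [K [kappa [c [mk cX kc]]]] := compact_cells (Xset_compact (d :=
  D)) (X_neq0 D) d0.
pose n_ k : R := fine (nu ((kappa @^-1` [set k]) `&` X)).
pose z_ k : R := fine (Zlaw D ((kappa @^-1` [set k]) `&` X)).
have n0 k : 0 <= n_ k by exact: fine_ge0.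
(* gamma Z - nu is a measure, so it is nonnegative on each cell. *)
have nz k : n_ k <= gamma * z_ k.
  have mkX : measurable ((kappa @^-1` [set k]) `&` X) by exact: measurableI.
  have := muE _ mkX; rewrite -(fineK (fin_num_measure mu _ mkX)).
  rewrite -(fineK (fin_num_measure nu _ mkX)) -(fineK (fin_num_measure (Zlaw
    D) _ mkX)).
  rewrite -EFinM -EFinB => -[H]; rewrite -subr_ge0 -/(n_ k) -/(z_ k) in H *.
  by rewrite -H fine_ge0.
have cell (m : {finite_measure set (Rvec R (dx D)) ->
  \bar R}) (h : 'cV[R]_(dx D) -> R) (L : R) :
    0 <= L -> (forall y y', `|h y - h y'| <= L * enorm (y - y')) ->
    `|\int[m]_(y in X) h y
      - \sum_k h (c k) * fine (m ((kappa @^-1` [set k]) `&` X))|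
    <= L * delta * fine (m X).
  move=> L0 hL; apply: (integral_cells mX m (c := fun k => h (c k)) mk).
    exact: bmeas_Lipschitz hL.
  by move=> y Xy; apply: (le_trans (hL _ _)); rewrite ler_wpM2l// kc.
have l0 := lip_x_ge0 D.
have feas' xi : Xi xi -> loss D x xi <= alpha + beta * sqnorm (D := D) xi
    + (\sum_k n_ k * loss D (c k) xi + lip_x D * delta * N).
  move=> Xixi; apply: (le_trans (feas xi Xixi)); rewrite /sqnorm lerD2l.
  have := cell nu (loss D ^~ xi) (lip_x D) l0 (fun y y' =>
    loss_lip_x y y' Xixi).
  under eq_bigr do rewrite mulrC.
  by rewrite ler_norml /n_ /N; lra.
have [csum Esum] := expect_sum (index_enum 'I_K.+1) QXi
  (fun k => @continuousZ_fun _ D (n_ k) _ (cl (c k))).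
have cs := @continuous_sqnorm _ D.
have cquad : continuous (fun xi => alpha + beta * sqnorm (D := D) xi).
  exact: (@continuousD_fun _ D (fun=> alpha) _ (@cst_continuous _ _ alpha)
    (@continuousZ_fun _ D beta _ cs)).
have cint : continuous (fun xi =>
  \sum_k n_ k * loss D (c k) xi + lip_x D * delta * N).
  exact: (@continuousD_fun _ D _ (fun=> lip_x D * delta * N) csum
    (@cst_continuous _ _ _)).
have E1 : eloss D Q x <= alpha + beta * expect Q (sqnorm (D := D))
    + (\sum_k n_ k * eloss D Q (c k) + lip_x D * delta * N).
  apply: (@le_trans _ _ (expect Q (fun xi => (alpha + beta * sqnorm (D := D) xi)
    + (\sum_k n_ k * loss D (c k) xi + lip_x D * delta * N)))).
    by apply: expect_le => //; exact: continuousD_fun.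
  rewrite (expectD QXi cquad cint).
  rewrite (expectD QXi (@cst_continuous _ _ alpha) (@continuousZ_fun _ D beta
    _ cs)).
  rewrite (expectD QXi csum (@cst_continuous _ _ _)) !(expect_cst _ QXi).
  rewrite (expectZ _ QXi cs) Esum lerD2l lerD2r.
  by under eq_bigr do rewrite (expectZ _ QXi (cl _)).
have E2 : expect Q (sqnorm (D := D)) <= Omega D.
  by move: Qm; rewrite second_momentE// lee_fin.
have E3 : \sum_k n_ k * eloss D Q (c k)
    <= \sum_k n_ k * (eloss D (Phat D) (c k) + eps D)
       + gamma * \sum_k z_ k * loss_excess D Q (c k).
  rewrite mulr_sumr -big_split; apply: ler_sum => k _ /=.
  apply: (@le_trans _ _ (n_ k * (eloss D (Phat D) (c k) + eps D)
     + n_ k * loss_excess D Q (c k))).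
    rewrite -mulrDr ler_wpM2l//.
    have : eloss D Q (c k) - eloss D (Phat D) (c k) - eps D
        <= loss_excess D Q (c k) by rewrite /loss_excess /pospart le_max lexx.
    lra.
  by rewrite lerD2l mulrA ler_wpM2r// pospart_ge0.
have E4 := cell nu (fun y => eloss D (Phat D) y + eps D) (lip_x D) l0.
have {}E4 : \sum_k n_ k * (eloss D (Phat D) (c k) + eps D)
    <= \int[nu]_(y in X) (eloss D (Phat D) y + eps D) + lip_x D * delta * N.
  have : forall y y', `|(eloss D (Phat D) y + eps D) - (eloss D (Phat D) y'
    + eps D)|
      <= lip_x D * enorm (y - y').
    move=> y y'; rewrite opprD addrACA subrr addr0.
    by apply: eloss_lip; exact: Phat_on_Xi.
  move=> /E4; under eq_bigr do rewrite mulrC.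
  by rewrite ler_norml /n_ /N; lra.
have E5 : \sum_k z_ k * loss_excess D Q (c k)
    <= \int[Zlaw D]_(y in X) loss_excess D Q y + 2 * lip_x D * delta.
  have H : `|\int[Zlaw D]_(y in X) loss_excess D Q y
      - \sum_k loss_excess D Q (c k) * z_ k|
        <= 2 * lip_x D * delta * fine (Zlaw D X)
    := cell (Zlaw D) (loss_excess D Q) (2 * lip_x D) (mulr_ge0 (ler0n _ 2) l0)
        (fun y y' => loss_excess_lip y y' QXi).
  have ZX := Z_on_X D.
  move: H; rewrite ZX mulr1; under eq_bigr do rewrite mulrC.
  by rewrite ler_norml; lra.
rewrite /dual_objective.
have E2' := ler_wpM2l beta0 E2; have E5' := ler_wpM2l gamma0 E5.
move: E1 E3 E4 E5' E2' errd.
rewrite -/(eloss D (Phat D)).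
set I1 := \int[nu]_(y in X) _; set I2 := \int[Zlaw D]_(y in X) _.
set S1 := \sum_k n_ k * eloss D Q (c k).
set S2 := \sum_k n_ k * (_ + _); set S3 := \sum_k _.
lra.
Qed.

Lemma optimal_dual_value nu : 0 < eps D -> optimal_dual_measure D nu ->
  exists x alpha beta, dual_feasible D x alpha beta nu /\
    dual_objective D alpha beta nu <= dro_value D (constr D X).
Proof.
move=> eps0 [x [alpha [beta [feas opt]]]]; exists x, alpha, beta; split => //.
apply/ler_addgt0Pr => e e0.
have [x' [alpha' [beta' [nu' [feas' le']]]]] := dual_value_le eps0 e0.
exact: (le_trans (opt _ _ _ _ feas')).
Qed.

Context d (T : measurableType d) (P : probability T R).
Variable z : nat -> {mfun T >-> Rvec R (dx D)}.
Hypothesis iid : iid_samples P (Zlaw D) z.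
Variables (M : nat) (tau : R).
Hypotheses (J2 : (2 <= nJ D)%N) (M2 : (2 <= M)%N) (tau01 : 0 < tau < 1).

Lemma deviation_event (eta : R) : 0 < eta ->
  exists F : set T, [/\ measurable F, ((1 - tau)%:E <= P F)%E &
    forall w, F w -> (forall m, (m < M)%N -> X (z m w)) /\
      forall Q : Law, constr D set0 Q ->
      \int[Zlaw D]_(x in X) loss_excess D Q x
      <= M%:R^-1 * \sum_(m < M) loss_excess D Q (z m w)
         + sampling_error D 16 M tau + eta].
Proof.
move=> eta0; have mX := @measurable_X _ D.
have M0 : (0 : R) < M%:R by rewrite ltr0n (leq_trans _ M2).
pose rt := Num.sqrt ((2 * M%:R)^-1 * ln tau^-1).
have rt0 : 0 <= rt by exact: sqrtr_ge0.
have r1 : 0 < rt + 1 by rewrite ltr_wpDl.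
pose theta : R := eta / 2 / (rt + 1).
have th0 : 0 < theta by rewrite !divr_gt0.
have thr : theta * rt <= eta / 2.
  have <- : theta * (rt + 1) = eta / 2 by rewrite /theta divfK ?gt_eqF.
  by move: th0; lra.
have l0 := lip_x_ge0 D.
(* Passing to cells costs 2 [lip_x] delta in the integral and as much in the empirical mean. *)
pose delta : R := eta / 2 / (4 * lip_x D + 1).
have l1 : 0 < 4 * lip_x D + 1 by move: l0; lra.
have d0 : 0 < delta by rewrite !divr_gt0.
have dl : 4 * lip_x D * delta <= eta / 2.
  have <- : delta * (4 * lip_x D + 1) = eta / 2 by rewrite /delta divfK ?gt_eqF.
  by move: d0; lra.
have [K [kappa [c [mk cX kc]]]] := compact_cells (Xset_compact (d :=
  D)) (X_neq0 D) d0.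
pose p := cell_mass (Zlaw D) kappa.
have p0 : forall k, 0 <= p k by move=> k; exact: cell_mass_ge0.
have p1 : \sum_k p k = 1 by exact: cell_mass_sum1.
pose excess (k : 'I_K.+1) (Q : Law) := loss_excess D Q (c k).
pose A := constr D set0.
pose F (s : seq 'I_K.+1) := supr A (deviation p excess s).
(* McDiarmid's inequality needs a positive constant, whereas the range vanishes when c1 = c2 = 0;
   [theta] costs at most eta / 2. *)
pose b := loss_range D + theta.
have b0 : 0 < b by rewrite ltr_wpDl// loss_range_ge0.
pose u := b * Num.sqrt (M%:R * ln tau^-1 / 2).
pose mean := iid_avg p M F.
pose big (s : seq 'I_K.+1) : bool := mean + u <= F s.
have [mB PB] := cells_law iid mk M big.
have PBtau : (P [set w | big (cells z kappa M w)] <= tau%:E)%E.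
  rewrite PB lee_fin; apply: mcdiarmid => //; first by rewrite (leq_trans _ M2).
  move=> s1 s2 k k' _; apply: deviation_bounded_differences => //.
  by rewrite /b lerDl ltW.
pose G := [set w | forall m, (m < M)%N -> X (z m w)].
have [mG PG] : measurable G /\ P G = 1%E.
  have [H1 H2] := iid_all iid M (fun=> mX); split; first exact: H1.
  rewrite [LHS]H2; have ZX := Z_on_X D.
  by rewrite big1// => m _; exact: ZX.
exists (G `\` [set w | big (cells z kappa M w)]); split.
- exact: measurableD.
- have : (P G <= P (G `\` [set w | big (cells z kappa M w)])
  + P [set w | big (cells z kappa M w)])%E.
    apply: (@le_trans _ _ (P ((G `\` [set w | big (cells z kappa M w)]) `|`
      [set w | big (cells z kappa M w)]))).
      rewrite le_measure ?inE//; first by apply: measurableU => //;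
        exact: measurableD.
      by move=> w Gw; have [?|?] := pselect (big (cells z kappa M w));
        [right|left].
    by apply: measureU2 => //; exact: measurableD.
  rewrite PG => H; rewrite EFinB leeBlDr//.
  by apply: (le_trans H); rewrite leeD2l.
move=> w [Gw nbig]; split => // Q AQ; have [QXi _ Qm] := AQ.
have Fw : F (cells z kappa M w) < mean + u by rewrite ltNge; exact/negP.
have bdev : bnd A (deviation p excess (cells z kappa M w)).
  apply: bnd_sum => j; apply: bndD; last by apply: bndN; exact: bnd_excess.
  by apply: bnd_avg => k; exact: bnd_excess.
have Hdev : avg p (excess ^~ Q) * M%:R - \sum_(m < M) excess (kappa (z m w)) Q
    <= F (cells z kappa M w).
  apply: (le_trans _ (supr_ub bdev AQ)).
  rewrite /deviation fct_sumE /cells big_map.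
  have -> : iota 0 M = index_iota 0 M by rewrite /index_iota subn0.
  by rewrite big_mkord sumrB sumr_const card_ord mulr_natr.
set I1 := \int[Zlaw D]_(x in X) _.
have HI : I1 <= avg p (excess ^~ Q) + 2 * lip_x D * delta.
  have bl : @bmeas _ (Rvec R (dx D)) R X (loss_excess D Q).
    by apply: (@bmeas_Lipschitz _ _ _ (2 * lip_x D)) => y y';
      exact: loss_excess_lip.
  have H : `|I1 - \sum_k excess k Q * fine (Zlaw D ((kappa @^-1` [set k]) `&`
    X))|
      <= 2 * lip_x D * delta * fine (Zlaw D X).
    apply: (integral_cells mX (Zlaw D) (c := fun k => excess k Q) mk bl).
    move=> y Xy; apply: (le_trans (loss_excess_lip _ _ QXi)).
    by apply: ler_wpM2l; [rewrite mulr_ge0|exact: kc].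
  have H2 : \sum_k excess k Q * fine (Zlaw D ((kappa @^-1` [set k]) `&` X))
      <= avg p (excess ^~ Q).
    apply: ler_sum => k _; rewrite mulrC ler_wpM2r ?pospart_ge0//.
    have mkX : measurable ((kappa @^-1` [set k]) `&` X) by exact: measurableI.
    by rewrite /p /cell_mass fine_le ?fin_num_measure// le_measure// inE.
  have ZX := Z_on_X D; move: H H2; rewrite ZX mulr1 ler_norml; lra.
have Hs : \sum_(m < M) excess (kappa (z m w)) Q
    <= \sum_(m < M) loss_excess D Q (z m w) + 2 * lip_x D * delta * M%:R.
  rewrite mulr_natr -[X in _ <= _ + X *+ _]/(2 * lip_x D * delta).
  rewrite -[X in _ <= _ + _ *+ X](card_ord M) -sumr_const -big_split.
  apply: ler_sum => m _ /=; rewrite /excess.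
  have := loss_excess_lip (z m w) (c (kappa (z m w))) QXi.
  have := ler_wpM2l l0 (kc _ (Gw m (ltn_ord m))).
  by rewrite ler_norml; lra.
have Hmean : mean / M%:R <= 16 * loss_radius D
    * Num.sqrt ((nJ D)%:R * ln (nJ D)%:R * ln M%:R ^+ 3 / M%:R).
  have LR0 : 0 <= loss_radius D.
    by rewrite loss_radiusE !mulr_ge0 ?opmax_ge0 ?sqrtr_ge0.
  have := ler_wpM2l LR0 (@rate_le R _ _ J2 M2).
  have := mean_deviation mk cX M; rewrite -/mean => Hm.
  have : mean / M%:R <= 4 * loss_radius D * Num.sqrt (M%:R * (nJ D)%:R) / M%:R.
    by rewrite ler_pM2r ?invr_gt0.
  lra.
have Hu : u / M%:R = b * rt.
  rewrite /u.
  have -> : M%:R * ln tau^-1 / 2 = M%:R ^+ 2 * ((2 * M%:R)^-1 * ln tau^-1).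
    by field; rewrite gt_eqF.
  rewrite sqrtrM ?sqr_ge0// sqrtr_sqr ger0_norm ?(ltW M0)// -/rt.
  by field; rewrite gt_eqF.
rewrite /sampling_error -/rt.
have Hb : b * rt <= 2 * (c1 D + c2 D * Num.sqrt (Omega D)) * rt + eta / 2.
  by rewrite /b mulrDl lerD2l.
have key : I1 <= M%:R^-1 * \sum_(m < M) loss_excess D Q (z m w)
    + mean / M%:R + u / M%:R + 4 * lip_x D * delta.
  rewrite -(ler_pM2l M0) !mulrDr mulrA divff ?gt_eqF// mul1r.
  rewrite [M%:R * (mean / _)]mulrC [M%:R * (u / _)]mulrC !divfK ?gt_eqF//.
  by have := ler_wpM2l (ltW M0) HI; move: Hdev Hs Fw; lra.
move: key Hmean Hb; rewrite Hu; lra.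
Qed.

Lemma sampling_error_ge0 : 0 <= sampling_error D 16 M tau.
Proof.
rewrite /sampling_error addr_ge0//.
  apply: mulr_ge0; last exact: sqrtr_ge0.
  apply: mulr_ge0 => //; rewrite loss_radiusE.
  by rewrite !mulr_ge0 ?opmax_ge0 ?sqrtr_ge0.
apply: mulr_ge0; last exact: sqrtr_ge0.
exact: loss_range_ge0.
Qed.

(* The events of deviation_event lose an arbitrarily small eta; their upper
   limit has probability at least 1 - tau as well and loses nothing. *)
Lemma uniform_event :
  exists F : set T, [/\ measurable F, ((1 - tau)%:E <= P F)%E &
    forall w, F w -> (forall m, (m < M)%N -> X (z m w)) /\
      forall Q : Law, constr D (sample_set z M w) Q ->
      \int[Zlaw D]_(x in X) loss_excess D Q x <= sampling_error D 16 M tau].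
Proof.
have /choice[F FP] : forall k : nat, exists F : set T,
  [/\ measurable F, ((1 - tau)%:E <= P F)%E &
    forall w, F w -> (forall m, (m < M)%N -> X (z m w)) /\
      forall Q : Law, constr D set0 Q ->
      \int[Zlaw D]_(x in X) loss_excess D Q x
      <= M%:R^-1 * \sum_(m < M) loss_excess D Q (z m w)
         + sampling_error D 16 M tau + k.+1%:R^-1].
  by move=> k; apply: deviation_event; rewrite invr_gt0.
have mF k : measurable (F k) by case: (FP k).
exists (lim_sup_set F); split.
- by apply: bigcap_measurable => // k _; exact: bigcup_measurable.
- have := @lim_sup_set_cvg _ _ _ P F mF _.
  have -> : (P (\bigcup_(k >= 0) F k) < +oo)%E.
    by rewrite ltey_eq fin_num_measure//; exact: bigcup_measurable.
  move=> /(_ isT) cF; apply: (cvge_ge _ cF).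
  apply: nearW => k; have [_ Fk _] := FP k; apply: (le_trans Fk).
  rewrite le_measure ?inE//; first by exact: bigcup_measurable.
  by apply: bigcup_sup => /=.
move=> w Fw; split.
  by have [k _ Fk] := Fw 0%N I; have [_ _ /(_ w Fk) []] := FP k.
move=> Q SQ; have [QXi QS Qm] := SQ; apply/ler_addgt0Pr => e e0.
have [n ne] : exists n, n.+1%:R^-1 < e.
  by have [n] := ltr_add_invr e0; rewrite add0r; exists n.
have [k /= nk Fk] := Fw n I.
have [_ _ /(_ w Fk) [_ /(_ Q (constr_sub (@sub0set _ _) SQ))]] := FP k.
have s0 : M%:R^-1 * \sum_(m < M) loss_excess D Q (z m w) <= 0.
  rewrite mulr_ge0_le0 ?invr_ge0//; apply: sumr_le0 => m _.
  by rewrite excess_le0; apply: QS; exists m => /=.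
have kn : k.+1%:R^-1 <= n.+1%:R^-1 :> R.
  by rewrite lef_pV2 ?posrE ?ltr0n// ler_nat.
by move: ne s0 kn; move: (k.+1%:R^-1) (n.+1%:R^-1) => a1 a2; lra.
Qed.

(** The event does not depend on gamma, so the bound holds on it for all dominating factors at once
    and the infimum may be taken afterwards. *)
Lemma generalization_bound nu (xhat : T -> 'cV[R]_(dx D)) :
  0 < eps D -> optimal_dual_measure D nu -> dominating_factors D nu !=set0 ->
  (forall w, dro_argmin D (constr D (sample_set z M w)) (xhat w)) ->
  with_probability_ge P (1 - tau)
    [set w | worst_case D (constr D X) (xhat w)
             <= dro_value D (constr D X)
                + inf (dominating_factors D nu) * sampling_error D 16 M tau].
Proof.
move=> eps0 nuopt [gamma0 dom0] xmin.
have [F [mF PF FP]] := uniform_event; exists F; split => // w Fw.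
have [zX HQ] := FP w Fw.
have [x [alpha [beta [feas objv]]]] := optimal_dual_value eps0 nuopt.
have SX : sample_set z M w `<=` X by move=> _ [m /= mM <-]; exact: zX.
have [Xxh xhle] := xmin w; have [Xx _ _ _] := feas.
have err0 := sampling_error_ge0.
set err := sampling_error D 16 M tau in HQ err0 *.
have bound gamma : dominating_factors D nu gamma ->
    worst_case D (constr D X) (xhat w)
      <= dro_value D (constr D X) + gamma * err.
  move=> dom; have [g0 _] := dom.
  (* The sampled worst case dominates the true one, and [xhat] is at least as good for it as the
     dual's own x. *)
  apply: (le_trans (worst_case_sub _ SX)); apply: (le_trans (xhle x Xx)).
  apply: worst_case_le => Q SQ.
  apply: (le_trans (dual_bound feas dom (constr_sub (@sub0set _ _) SQ))).
  by rewrite lerD// ler_wpM2l// HQ.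
rewrite /=; have [e0|en0] := eqVneq err 0.
  by have := bound _ dom0; rewrite e0 !mulr0.
have ep : 0 < err by rewrite lt_neqAle eq_sym en0.
rewrite addrC -lerBlDr -ler_pdivrMr//.
apply: lb_le_inf; first by exists gamma0.
by move=> gamma dom; rewrite ler_pdivrMr// lerBlDr addrC; exact: bound.
Qed.

End generalization.

Theorem theorem4 (R : realType) :
  (forall (D : dro R) (d : measure_display) (T : measurableType d)
     (P : probability T R) (z : nat -> {mfun T >-> Rvec R (dx D)}),
     iid_samples P (Zlaw D) z ->
     let PM := fun (M : nat) (w : T) =>
       sampled_ambiguity_set D M (fun m => z m w) in
     [/\ dro_argmin D (ambiguity_set D) !=set0,
         forall M w, (0 < M)%N -> dro_argmin D (PM M w) !=set0 &
         forall xhat : nat -> T -> 'cV[R]_(dx D),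
           (forall M w, (0 < M)%N -> dro_argmin D (PM M w) (xhat M w)) ->
           cvg_in_probability P (fun M w => dro_value D (PM M w))
             (dro_value D (ambiguity_set D))
           /\ cvg_in_probability P
             (fun M w => edist_set (xhat M w) (dro_argmin D (ambiguity_set D)))
             0]) /\
  (exists C : R, 0 < C /\
     forall (D : dro R) (d : measure_display) (T : measurableType d)
       (P : probability T R) (z : nat -> {mfun T >-> Rvec R (dx D)})
       (nu : {finite_measure set (Rvec R (dx D)) -> \bar R})
       (M : nat) (tau : R) (xhat : T -> 'cV[R]_(dx D)),
       iid_samples P (Zlaw D) z ->
       0 < eps D ->
       optimal_dual_measure D nu ->
       dominating_factors D nu !=set0 ->
       (2 <= nJ D)%N -> (2 <= M)%N -> 0 < tau < 1 ->
       (forall w, dro_argmin D (sampled_ambiguity_set D M (fun m => z m w))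
                    (xhat w)) ->
       with_probability_ge P (1 - tau)
         [set w | worst_case D (ambiguity_set D) (xhat w)
                  <= dro_value D (ambiguity_set D)
                     + inf (dominating_factors D nu)
                       * sampling_error D C M tau]).
Proof.
have PME (D : dro R) d (T : measurableType d)
    (z : nat -> {mfun T >-> Rvec R (dx D)}) M w :
    sampled_ambiguity_set D M (fun m => z m w) = constr D (sample_set z M w).
  by rewrite sampled_ambiguity_setE.
split.
  move=> D d T P z iid PM; rewrite ambiguity_setE.
  have -> : PM = fun M w => constr D (sample_set z M w).
    by apply/funext => M; apply/funext => w; exact: PME.
  split; [exact: argmin_neq0|by move=> M w _; exact: argmin_neq0|].
  exact: consistency.
(* 4 from [mean_deviation] times 4 from [rate_le]. *)
exists 16; split => //.
move=> D d T P z nu M tau xhat iid eps0 nuopt dom J2 M2 tau01 xmin.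
rewrite ambiguity_setE; apply: (generalization_bound iid) => // w.
by rewrite -PME; exact: xmin.
Qed.
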